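(* Let $T>0$, $s\ge2$, and suppose $u\in C([0,T];H^s_+(\mathbb{R}))$ solves $$i\partial_t u+\partial_{xx}u+(D+|D|)(|u|^2)\,u=0 .$$ Define operators on $L^2_+(\mathbb{R})$ by $$L_u=D-T_uT_{\bar u},\qquad B_u=T_uT_{\partial_x\bar u}-T_{\partial_xu}T_{\bar u}+i(T_uT_{\bar u})^2 .$$ Then the Lax equation $$\frac{d}{dt}L_u=[B_u,L_u]$$ holds (as an identity of operators applied to functions in the domain $H^1_+(\mathbb{R})$ of $L_u$).
   Context: $D=-i\partial_x$; $|D|$ has Fourier symbol $|\xi|$. $L^2_+(\mathbb{R})=\{f\in L^2(\mathbb{R}):\operatorname{supp}\hat f\subset[0,\infty)\}$, $H^s_+(\mathbb{R})=H^s(\mathbb{R})\cap L^2_+(\mathbb{R})$, $\Pi_+$ is the orthogonal projection of $L^2(\mathbb{R})$ onto $L^2_+(\mathbb{R})$, and $T_bf=\Pi_+(bf)$ is the Toeplitz operator on $L^2_+(\mathbb{R})$ with symbol $b$. For $u\in H^2_+(\mathbb{R})$, $L_u$ is self-adjoint with domain $H^1_+(\mathbb{R})$ and $B_u$ is bounded and skew-adjoint. $[A,B]=AB-BA$. *)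

(* Defs.v *)
From HB Require Import structures.
From mathcomp Require Import all_boot all_order all_algebra.
From mathcomp Require Import all_classical all_reals all_analysis.
From mathcomp Require Import complex.

Set Implicit Arguments.
Unset Strict Implicit.
Unset Printing Implicit Defensive.

Import Order.TTheory GRing.Theory Num.Theory.
Import numFieldNormedType.Exports.

Local Open Scope classical_set_scope.
Local Open Scope ring_scope.
Local Open Scope complex_scope.

(* An element of L^2(R) is represented by a function R -> R[i], and equalities
   in L^2 are equalities almost everywhere.  The operators below are total
   functions on representatives: an L^2 class specified by a property that
   determines it up to a.e. equality is picked by [xget], whose value is the
   (irrelevant) zero function when no such class exists. *)

Section L2.
Context {R : realType}.
Local Notation mu := (@lebesgue_measure R).
Local Notation I := (Complex 0 1 : R[i]).
Implicit Types (f g h : R -> R[i]) (D : set R).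

Definition cint D f : R[i] :=
  (\int[mu]_(x in D) complex.Re (f x)) +i* (\int[mu]_(x in D) complex.Im (f x)).

Definition aeeq f g : Prop := {ae mu, forall x, f x = g x}.

Definition L2norm f : \bar R :=
  Lnorm mu 2%:E (fun x => (Normc.normc (f x))%:E).

Definition L2 f : Prop :=
  [/\ measurable_fun [set: R] (fun x => complex.Re (f x)),
      measurable_fun [set: R] (fun x => complex.Im (f x))
    & (L2norm f < +oo)%E].

Definition L2inner f g : R[i] := cint setT (fun x => f x * (g x)^*).

(* hat f (xi) = \int e^{- i x xi} f(x) dx, as the L^2 limit of the integrals
   over [-n, n]. *)
Definition truncated_fourier (n : nat) f : R -> R[i] := fun xi =>
  cint `[- n%:R, n%:R] (fun x => (cos (x * xi) -i* sin (x * xi)) * f x).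

Definition is_fourier f g : Prop :=
  [/\ L2 f, L2 g &
      L2norm (truncated_fourier n f \- g) @[n --> \oo] --> (0 : \bar R)].

Definition fourier f : R -> R[i] := xget (fun=> 0) [set g | is_fourier f g].

Definition L2plus f : Prop :=
  L2 f /\ {ae mu, forall xi, xi < 0 -> fourier f xi = 0}.

Definition bessel (s : R) f : R -> R[i] :=
  fun xi => ((1 + xi ^+ 2) `^ (s / 2))%:C * fourier f xi.

Definition sobolev (s : R) f : Prop := L2 f /\ L2 (bessel s f).

Definition sobolev_norm (s : R) f : \bar R := L2norm (bessel s f).

Definition sobolev_plus (s : R) f : Prop := sobolev s f /\ L2plus f.

Definition Pi_plus f : R -> R[i] :=
  xget (fun=> 0)
    [set h | L2plus h /\ forall g, L2plus g -> L2inner (f \- h) g = 0].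

Definition toeplitz (b : R -> R[i]) f : R -> R[i] := Pi_plus (b \* f).

(* The weak derivative, with C^1 compactly supported test functions. *)
Definition test_function (phi : R -> R) : Prop :=
  [/\ forall x, derivable phi x 1, continuous (phi^`()%classic)
    & exists M : R, forall x, M < `|x| -> phi x = 0].

Definition is_weak_derivative f h : Prop :=
  forall phi, test_function phi ->
    cint setT (fun x => (phi^`()%classic x)%:C * f x) =
    - cint setT (fun x => (phi x)%:C * h x).

Definition dx f : R -> R[i] :=
  xget (fun=> 0) [set h | L2 h /\ is_weak_derivative f h].

Definition Dop f : R -> R[i] := fun x => - I * dx f x.

Definition absD f : R -> R[i] :=
  xget (fun=> 0)
    [set h | L2 h /\ aeeq (fourier h) (fun xi => `|xi|%:C * fourier f xi)].

Definition conjf f : R -> R[i] := fun x => (f x)^*.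

Definition sqmod f : R -> R[i] := fun x => (Normc.normc (f x) ^+ 2)%:C.

Definition lax_L (u f : R -> R[i]) : R -> R[i] :=
  Dop f \- toeplitz u (toeplitz (conjf u) f).

Definition lax_B (u f : R -> R[i]) : R -> R[i] := fun x =>
  toeplitz u (toeplitz (dx (conjf u)) f) x
  - toeplitz (dx u) (toeplitz (conjf u) f) x
  + I * toeplitz u (toeplitz (conjf u) (toeplitz u (toeplitz (conjf u) f))) x.

Definition commutator (A B : (R -> R[i]) -> (R -> R[i])) f : R -> R[i] :=
  A (B f) \- B (A f).

(* Time-dependent functions are only considered on [0, T]; limits in time are
   taken within [0, T], hence are one-sided at the endpoints. *)
Definition continuous_sobolev_plus (T s : R) (u : R -> R -> R[i]) : Prop :=
  (forall t, 0 <= t <= T -> sobolev_plus s (u t)) /\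
  (forall t, 0 <= t <= T ->
    sobolev_norm s (u t' \- u t) @[t' --> within `[0, T] (nbhs t)]
      --> (0 : \bar R)).

Definition L2_derivative (T : R) (v : R -> R -> R[i]) (t : R) (w : R -> R[i])
    : Prop :=
  [/\ forall t', 0 <= t' <= T -> L2 (v t'),
      L2 w
    & L2norm (fun x => ((t' - t)^-1)%:C * (v t' x - v t x) - w x)
        @[t' --> within `[0, T] t^'] --> (0 : \bar R)].

(* For u in C([0, T]; H^s_+), s >= 2, every term of the equation belongs to
   L^2, and the equation is understood in L^2 at each time. *)
Definition solves_equation (T : R) (u : R -> R -> R[i]) : Prop :=
  forall t, 0 <= t <= T ->
    exists2 ut : R -> R[i], L2_derivative T u t ut &
      aeeq (fun x => I * ut x + dx (dx (u t)) x
              + (Dop (sqmod (u t)) x + absD (sqmod (u t)) x) * u t x)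
           (fun=> 0).

End L2.

(* Main.v *)
Require Import Defs.
From mathcomp Require Import all_boot all_order all_algebra.
From mathcomp Require Import all_classical all_reals all_analysis.
From mathcomp Require Import complex.
From mathcomp Require Import measurable_realfun ring lra.

(* Everything is reduced to the Fourier transform on L^2, obtained from
   truncated L^1 transforms: testing against exp(- e |xi|), whose transform is
   the Poisson kernel, and Schur's test give [|f^|^2 <= 2 pi |f|^2], and the
   limit e -> 0 gives the inversion formula and Plancherel. On the Fourier side
   Pi_+ is multiplication by the indicator of [0, oo), d/dx by i xi and |D| by
   |xi|; H^1 is a space of bounded functions, stable under products, and the
   product of two functions of L^2_+ one of which is bounded is in L^2_+ if it
   is in L^2.
     Put v = conj u, p = P(v f), g = P(d|u|^2/dx), P = Pi_+. Since u multiplies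
   L^2_+ into itself, L f = - i f' - u p and B f = u P(v' f) - u' p + i u P(v u p).
   The Leibniz rule and the commutation of P with d/dx give
     [B, L] f = i u P(v'' f) - i u'' p - 2 u P((|u|^2)' p),
   and P((|u|^2)' p) = g p + P(conj(g) v f), because (|u|^2)' = g + conj g and
   conj(g) (v f - p) is the conjugate of an element of L^2_+. The equation reads
   u_t = i u'' + 2 g u, as i (D + |D|) = 2 P d/dx, so that
     [B, L] f = - u_t p - u P(conj(u_t) f),
   which is the derivative of - T_u T_v f = - u P(v f); the difference quotients
   converge since H^1 controls the sup norm of u(t') - u(t). *)

Set Implicit Arguments.
Unset Strict Implicit.
Unset Printing Implicit Defensive.

Import Order.TTheory GRing.Theory Num.Theory.
Import numFieldNormedType.Exports.

Local Open Scope classical_set_scope.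
Local Open Scope ring_scope.
Local Open Scope complex_scope.

Local Notation mu := lebesgue_measure.
Local Notation Re := complex.Re.
Local Notation Im := complex.Im.
Local Notation nc := Normc.normc.
Local Notation "z ^*" := (conjc z) : ring_scope.

(** The operators of the statement are picked by [xget] and known only up to a.e. equality, so the
    proof works with relations that hold for any representative: [is_fourier f F], [isP f h],
    [weak_der f h]. Neither mollification nor density of smooth functions is used. The regular
    objects are truncated transforms: by inversion, [2 pi] times the conjugate of [f] is the L^2
    limit of the ordinary L^1 transforms of the conjugate of [F] cut to [-n, n]. The sup bound in
    H^1, the Leibniz rule and the product theorem in the Hardy space are each checked on these
    transforms, by Fubini and pointwise arguments, and survive the limit. Inversion is kept in
    conjugated form, so that the direct transform serves twice; the factors [2 pi] come from its
    lack of normalisation. *)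

#[local] Instance ae_lebesgue_filter {R : realType} :
  Filter (nbhs (almost_everywhere (@lebesgue_measure R))).
Proof. exact: ae_filter_ringOfSetsType. Qed.

(** * Complex-valued measurable functions and L^2 *)

Section modulus.
Context {R : realType}.
Implicit Types z w : R[i].

Lemma ReD z w : Re (z + w) = Re z + Re w. Proof. by case: z; case: w. Qed.
Lemma ImD z w : Im (z + w) = Im z + Im w. Proof. by case: z; case: w. Qed.
Lemma ReN z : Re (- z) = - Re z. Proof. by case: z. Qed.
Lemma ImN z : Im (- z) = - Im z. Proof. by case: z. Qed.
Lemma ReM z w : Re (z * w) = Re z * Re w - Im z * Im w.
Proof. by case: z; case: w. Qed.
Lemma ImM z w : Im (z * w) = Re z * Im w + Im z * Re w.
Proof. by case: z; case: w. Qed.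
Lemma ReJ z : Re z^* = Re z. Proof. by case: z. Qed.
Lemma ImJ z : Im z^* = - Im z. Proof. by case: z. Qed.

Lemma complex_ext z w : Re z = Re w -> Im z = Im w -> z = w.
Proof. by case: z => a b; case: w => c d /= -> ->. Qed.

Lemma conjcM z w : (z * w)^* = z^* * w^*. Proof. exact: rmorphM. Qed.
Lemma conjcB z w : (z - w)^* = z^* - w^*. Proof. exact: rmorphB. Qed.
Lemma conjcD z w : (z + w)^* = z^* + w^*. Proof. exact: rmorphD. Qed.
Lemma conjcR (x : R) : (x%:C)^* = x%:C. Proof. by apply: complex_ext; rewrite /= ?oppr0. Qed.

Definition ReIm := (ReD, ImD, ReN, ImN, ReM, ImM, ReJ, ImJ).

Lemma normc_sqr z : nc z ^+ 2 = Re z ^+ 2 + Im z ^+ 2.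
Proof. by case: z => a b; rewrite /= sqr_sqrtr// addr_ge0// sqr_ge0. Qed.

Lemma normc_ge0 z : 0 <= nc z. Proof. by case: z => a b; apply: sqrtr_ge0. Qed.

Lemma mul_conjc z : z * z^* = (nc z ^+ 2)%:C.
Proof.
rewrite normc_sqr; case: z => a b; apply: complex_ext => /=; ring.
Qed.

Lemma normc_conjc z : nc z^* = nc z.
Proof. by case: z => a b; rewrite /= sqrrN. Qed.

Lemma normcR (x : R) : nc x%:C = `|x|.
Proof. by rewrite /= expr0n addr0 sqrtr_sqr. Qed.

Lemma normr_Re z : `|Re z| <= nc z.
Proof.
by case: z => a b; rewrite -sqrtr_sqr ler_wsqrtr//= lerDl sqr_ge0.
Qed.

Lemma normr_Im z : `|Im z| <= nc z.
Proof.
by case: z => a b; rewrite -sqrtr_sqr ler_wsqrtr//= lerDr sqr_ge0.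
Qed.

Lemma normc_le z : nc z <= `|Re z| + `|Im z|.
Proof.
rewrite -(@ler_pXn2r _ 2) ?nnegrE ?addr_ge0 ?normc_ge0//.
rewrite normc_sqr sqrrD !real_normK ?num_real//.
by rewrite -addrA addrCA lerDr mulrn_wge0// mulr_ge0.
Qed.

Lemma normc_sqrD z w : nc (z + w) ^+ 2 <= 2 * nc z ^+ 2 + 2 * nc w ^+ 2.
Proof.
rewrite !normc_sqr !ReIm.
have := sqr_ge0 (Re z - Re w); have := sqr_ge0 (Im z - Im w); nra.
Qed.

Lemma normc_eq0 z : nc z = 0 -> z = 0.
Proof. exact: Normc.eq0_normc. Qed.

Lemma normcM z w : nc (z * w) = nc z * nc w.
Proof. exact: Normc.normcM. Qed.

Lemma normc_unit (t : R) : nc (cos t -i* sin t) = 1.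
Proof. by rewrite /= sqrrN cos2Dsin2 sqrtr1. Qed.

Lemma normcB z w : nc (z - w) = nc (w - z).
Proof. by rewrite -opprB; exact: normcN. Qed.

Lemma normc_lipschitz z w : `|nc z - nc w| <= nc (z - w).
Proof.
have h (a b : R[i]) : nc a - nc b <= nc (a - b).
  by have := le_normcD (a - b) b; rewrite subrK lerBlDr.
by rewrite ler_norml h andbT lerNl opprB normcB h.
Qed.

End modulus.

Section complex_measurability.
Context {d : measure_display} {T : measurableType d} {R : realType}.
Implicit Types f g : T -> R[i].

Definition cmeas f := measurable_fun setT (fun x => Re (f x)) /\
  measurable_fun setT (fun x => Im (f x)).

Lemma cmeasD f g : cmeas f -> cmeas g -> cmeas (fun x => f x + g x).
Proof.
move=> [f1 f2] [g1 g2]; split; under eq_fun do rewrite ReIm;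
 exact: measurable_funD.
Qed.

Lemma cmeasN f : cmeas f -> cmeas (fun x => - f x).
Proof.
move=> [f1 f2]; split; under eq_fun do rewrite ReIm; exact: measurableT_comp.
Qed.

Lemma cmeasB f g : cmeas f -> cmeas g -> cmeas (fun x => f x - g x).
Proof. by move=> cf cg; apply: cmeasD => //; exact: cmeasN. Qed.

Lemma cmeasM f g : cmeas f -> cmeas g -> cmeas (fun x => f x * g x).
Proof.
move=> [f1 f2] [g1 g2]; split; under eq_fun do rewrite ReIm.
  by apply: measurable_funB; exact: measurable_funM.
by apply: measurable_funD; exact: measurable_funM.
Qed.

Lemma cmeasJ f : cmeas f -> cmeas (fun x => (f x)^*).
Proof.
move=> [f1 f2]; split; first by under eq_fun do rewrite ReIm.
under eq_fun do rewrite ReIm; exact: measurableT_comp.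
Qed.

Lemma cmeas_cst c : cmeas (fun=> c).
Proof. by split; exact: measurable_cst. Qed.

Lemma cmeasR (f : T -> R) : measurable_fun setT f -> cmeas (fun x => (f x)%:C).
Proof. by move=> mf; split. Qed.

Lemma measurable_normc f : cmeas f -> measurable_fun setT (fun x => nc (f x)).
Proof.
move=> [f1 f2].
rewrite (_ : (fun x => _) = (fun x => Num.sqrt (Re (f x) ^+ 2 + Im (f x) ^+ 2))); last first.
  by apply/funext => x; case: (f x).
apply: measurableT_comp; first exact: (continuous_measurable_fun (@sqrt_continuous R)).
by apply: measurable_funD; exact: measurable_funX.
Qed.

End complex_measurability.

Lemma cmeas_comp {R : realType} d (T : measurableType d) d' (T' : measurableType d')
    (f : T -> R[i]) (h : T' -> T) :
  measurable_fun setT h -> cmeas f -> cmeas (fun x => f (h x)).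
Proof.
by move=> mh [f1 f2]; split; [exact: (measurableT_comp f1)|exact: (measurableT_comp f2)].
Qed.

(** * Integration of complex-valued functions *)

Section complex_integral.
Context {R : realType}.
Local Notation mu := (@lebesgue_measure R).
Implicit Types f g : R -> R[i].

Definition cinteg f := mu.-integrable [set: R] (fun x => (Re (f x))%:E) /\
  mu.-integrable [set: R] (fun x => (Im (f x))%:E).

Lemma cinteg_cmeas f : cinteg f -> cmeas f.
Proof.
by move=> [/measurable_int f1 /measurable_int f2]; split; apply/measurable_EFinP.
Qed.

Lemma le_cinteg f (g : R -> R) : cmeas f ->
  mu.-integrable setT (fun x => (g x)%:E) -> (forall x, nc (f x) <= g x) ->
  cinteg f.
Proof.
move=> [f1 f2] ig fg; split; (apply: le_integrable ig => //;
  [exact/measurable_EFinP|move=> x _ /=; rewrite lee_fin (le_trans _ (ler_norm _))//]).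
  exact: le_trans (normr_Re _) (fg x).
exact: le_trans (normr_Im _) (fg x).
Qed.

Lemma integrable_normc f : cinteg f -> mu.-integrable setT (fun x => (nc (f x))%:E).
Proof.
move=> fi; have [f1 f2] := fi.
apply: (@le_integrable _ _ _ mu setT _ _ (fun x => (`|Re (f x)| + `|Im (f x)|)%:E)) => //.
- by apply/measurable_EFinP/measurable_normc/cinteg_cmeas.
- move=> x _ /=; rewrite lee_fin [leLHS]ger0_norm ?normc_ge0//.
  rewrite [leRHS]ger0_norm ?addr_ge0//; exact: normc_le.
- under eq_fun do rewrite EFinD.
  by apply: integrableD => //; exact: integrable_norm.
Qed.

Lemma cintegD f g : cinteg f -> cinteg g -> cinteg (fun x => f x + g x).
Proof.
move=> [f1 f2] [g1 g2]; split; under eq_fun do rewrite ReIm EFinD;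
 exact: integrableD.
Qed.

Lemma cintegZ c f : cinteg f -> cinteg (fun x => c * f x).
Proof.
move=> [f1 f2]; split; under eq_fun do rewrite ReIm ?EFinB ?EFinD !EFinM.
  by apply: integrableB => //; exact: integrableZl.
by apply: integrableD => //; exact: integrableZl.
Qed.

Lemma cintegN f : cinteg f -> cinteg (fun x => - f x).
Proof.
by move=> /(cintegZ (-1)); under eq_fun do rewrite mulN1r.
Qed.

Lemma cintegB f g : cinteg f -> cinteg g -> cinteg (fun x => f x - g x).
Proof. by move=> fi gi; apply: cintegD => //; exact: cintegN. Qed.

Lemma cintegJ f : cinteg f -> cinteg (fun x => (f x)^*).
Proof.
move=> [f1 f2]; split; first by under eq_fun do rewrite ReIm.
under eq_fun do rewrite ReIm EFinN; exact: integrableN.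
Qed.

Lemma cintegMl f g (M : R) : cmeas g -> (forall x, nc (g x) <= M) -> cinteg f ->
  cinteg (fun x => g x * f x).
Proof.
move=> mg gM fi; apply: (@le_cinteg _ (fun x => M * nc (f x))).
- by apply: cmeasM => //; exact: cinteg_cmeas.
- by under eq_fun do rewrite EFinM; apply: integrableZl => //; exact: integrable_normc.
- by move=> x; rewrite normcM ler_wpM2r ?normc_ge0.
Qed.

Lemma eq_cint f g : (forall x, f x = g x) -> cint setT f = cint setT g.
Proof. by move=> fg; congr cint; apply/funext. Qed.

Lemma cintD f g : cinteg f -> cinteg g ->
  cint setT (fun x => f x + g x) = cint setT f + cint setT g.
Proof.
move=> [f1 f2] [g1 g2]; apply: complex_ext; rewrite !ReIm /= -RintegralD//;
 apply: eq_Rintegral => x _; rewrite ReIm//.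
Qed.

Lemma cintZ c f : cinteg f -> cint setT (fun x => c * f x) = c * cint setT f.
Proof.
move=> [f1 f2]; apply: complex_ext; rewrite !ReIm /= -!RintegralZl//.
  rewrite -RintegralB//.
  - by apply: eq_Rintegral => x _; rewrite ReIm//.
  - by apply: (integrableZl _ _ f1).
  - by apply: (integrableZl _ _ f2).
rewrite -RintegralD//.
- by apply: eq_Rintegral => x _; rewrite ReIm//.
- by apply: (integrableZl _ _ f2).
- by apply: (integrableZl _ _ f1).
Qed.

Lemma cintN f : cinteg f -> cint setT (fun x => - f x) = - cint setT f.
Proof.
move=> fi; rewrite -mulN1r -cintZ//; apply: eq_cint => x; by rewrite mulN1r.
Qed.

Lemma cintB f g : cinteg f -> cinteg g ->
  cint setT (fun x => f x - g x) = cint setT f - cint setT g.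
Proof. by move=> fi gi; rewrite cintD// ?cintN//; exact: cintegN. Qed.

Lemma cintJ f : cinteg f -> cint setT (fun x => (f x)^*) = (cint setT f)^*.
Proof.
move=> [f1 f2]; apply: complex_ext; rewrite !ReIm /=.
  by apply: eq_Rintegral => x _; rewrite ReIm.
rewrite -mulN1r -RintegralZl//; apply: eq_Rintegral => x _.
by rewrite ReIm mulN1r.
Qed.

Lemma ae_eq_cint f g : cmeas f -> cmeas g -> aeeq f g ->
  cint setT f = cint setT g.
Proof.
move=> [f1 f2] [g1 g2] fg; congr Complex; congr fine; apply: ae_eq_integral => //;
  try exact/measurable_EFinP.
- by apply: filterS fg => x -> _.
- by apply: filterS fg => x -> _.
Qed.

Lemma ae_eq_integrable (f g : R -> R) : measurable_fun setT g ->
  {ae mu, forall x, f x = g x} -> mu.-integrable setT (fun x => (f x)%:E) ->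
  mu.-integrable setT (fun x => (g x)%:E).
Proof.
move=> mg fg /integrableP[mf fi]; apply/integrableP; split.
  exact/measurable_EFinP.
rewrite -(@ge0_ae_eq_integral _ _ _ mu setT (fun x => `|(f x)%:E|)%E)//.
- exact: measurableT_comp.
- by apply: measurableT_comp => //; exact/measurable_EFinP.
- by apply: filterS fg => x -> _.
Qed.

(** Multiplying [f] by the conjugate of its integral [I] turns the integral into the real number
    [|I|^2]; a real part is at most a modulus, and one factor [|I|] is then cancelled. *)
Lemma normc_cint f : cinteg f -> nc (cint setT f) <= \int[mu]_x nc (f x).
Proof.
move=> fi; set I := cint setT f.
have [I0|I0] := eqVneq (nc I) 0.
  by rewrite I0; apply: Rintegral_ge0 => x _; exact: normc_ge0.
have Ip : 0 < nc I by rewrite lt_def I0 normc_ge0.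
rewrite -(ler_pM2l Ip) -expr2.
have -> : nc I ^+ 2 = Re (cint setT (fun x => I^* * f x)).
  by rewrite cintZ// mulrC mul_conjc.
rewrite -RintegralZl//; last exact: integrable_normc.
apply: le_Rintegral => //.
- by have [] := cintegZ I^* fi.
- by apply: (integrableZl _ _ (integrable_normc fi)).
- move=> x _; rewrite (le_trans (ler_norm _))// (le_trans (normr_Re _))//.
  by rewrite normcM normc_conjc.
Qed.

Lemma cint_mkcond D f : cint D f = cint setT (fun x => (\1_D x)%:C * f x).
Proof.
apply: complex_ext => /=; rewrite Rintegral_mkcond; apply: eq_Rintegral => x _;
 rewrite patchE indicE; case: ifPn => _; rewrite ?mul1r ?mul0r//= ReIm;
 by rewrite ?mul0r ?mul1r ?subr0 ?add0r ?addr0.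
Qed.

End complex_integral.

(** * Fubini's theorem for real and complex integrands *)

Section fubini.
Context {R : realType}.
Local Notation mu := (@lebesgue_measure R).
Local Notation RR := (measurableTypeR R).

(** No section of [f] is assumed integrable: Tonelli gives the measurability of the integrals of the
    positive and negative parts, and the real integral is [fine] of their difference whatever their
    values. *)
Lemma measurable_Rintegral2 (f : RR * RR -> R) : measurable_fun setT f ->
  measurable_fun setT (fun x => \int[mu]_y f (x, y)).
Proof.
move=> mf; have mEf : measurable_fun setT (EFin \o f) by exact/measurable_EFinP.
have := measurable_fun_fubini_tonelli_F (m2 := mu) _ (measurable_funepos mEf).
have := measurable_fun_fubini_tonelli_F (m2 := mu) _ (measurable_funeneg mEf).
move=> /(_ (fun=> funeneg_ge0 _ _)) mn /(_ (fun=> funepos_ge0 _ _)) mp.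
rewrite (_ : (fun x => _) = fine \o (fubini_F mu (EFin \o f)^\+ \- fubini_F mu (EFin \o f)^\-)%E).
  by apply: measurableT_comp => //; exact: emeasurable_funB.
apply/funext => x; rewrite /= /Rintegral integralE /fubini_F; congr (fine (_ - _)%E).
  by apply: eq_integral => y _; rewrite !funeposE.
by apply: eq_integral => y _; rewrite !funenegE.
Qed.

Lemma measurable_swapRR : measurable_fun setT (fun p : RR * RR => (p.2, p.1)).
Proof.
by apply/measurable_fun_pairP; split; [exact: measurable_snd|exact: measurable_fst].
Qed.

Lemma real_fubini (f : RR * RR -> R) : measurable_fun setT f ->
  (\int[mu]_x \int[mu]_y `|f (x, y)|%:E < +oo)%E ->
  [/\ mu.-integrable setT (fun x => (\int[mu]_y f (x, y))%:E),
      mu.-integrable setT (fun y => (\int[mu]_x f (x, y))%:E) &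
      \int[mu]_x \int[mu]_y f (x, y) = \int[mu]_y \int[mu]_x f (x, y)].
Proof.
move=> mf fi.
have mEf : measurable_fun setT (EFin \o f) by exact/measurable_EFinP.
have If : (mu \x mu)%E.-integrable setT (EFin \o f).
  by apply/integrable12ltyP.
have mF : measurable_fun setT (fun x => \int[mu]_y f (x, y)).
  exact: measurable_Rintegral2.
have mG : measurable_fun setT (fun y => \int[mu]_x f (x, y)).
  apply: (@measurable_Rintegral2 (f \o (fun p : RR * RR => (p.2, p.1)))).
  by apply: measurableT_comp => //; exact: measurable_swapRR.
have iF := integrable_fubini_F If.
have mfs : measurable_fun setT (EFin \o f \o (fun p : RR * RR => (p.2, p.1))).
  by apply: measurableT_comp => //; exact: measurable_swapRR.
have Ifs : (mu \x mu)%E.-integrable setT (EFin \o f \o (fun p : RR * RR => (p.2, p.1))).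
  apply/(integrable12ltyP mu mu mfs); exact/(integrable21ltyP mu mu mEf).
have iG := integrable_fubini_F Ifs.
(* The inner integral may be infinite on a null set; [fine] changes it only there, which affects
   neither integrability nor the value of the outer integral. *)
have leF (h : RR -> \bar R) : mu.-integrable setT h -> measurable_fun setT (fine \o h) ->
    mu.-integrable setT (EFin \o (fine \o h)) /\
    (\int[mu]_x (fine (h x))%:E = \int[mu]_x h x)%E.
  move=> ih mh; split.
    apply: le_integrable ih => //; first exact/measurable_EFinP.
    by move=> x _ /=; case: (h x) => //= ; rewrite ?leey// normr0 leey.
  apply: ae_eq_integral => //; first exact/measurable_EFinP.
    by have /measurable_int := ih.
  have := integrable_ae measurableT ih.
  by apply: filterS => x /= /(_ I) hx _; rewrite fineK.
have [iF' eF] := leF _ iF mF; have [iG' eG] := leF _ iG mG.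
split; [exact: iF'|exact: iG'|].
rewrite /Rintegral; congr fine; rewrite [LHS]eF [RHS]eG.
exact: (Fubini If).
Qed.

Lemma complex_fubini (f : RR * RR -> R[i]) : cmeas f ->
  (\int[mu]_x \int[mu]_y (nc (f (x, y)))%:E < +oo)%E ->
  [/\ cinteg (fun x => cint setT (fun y => f (x, y))),
      cinteg (fun y => cint setT (fun x => f (x, y))) &
      cint setT (fun x => cint setT (fun y => f (x, y))) =
      cint setT (fun y => cint setT (fun x => f (x, y)))].
Proof.
move=> mf fi; have [mf1 mf2] := mf.
have bnd (g : RR * RR -> R) : measurable_fun setT g ->
    (forall p, `|g p| <= nc (f p)) ->
    (\int[mu]_x \int[mu]_y `|g (x, y)|%:E < +oo)%E.
  move=> mg gf; apply: le_lt_trans fi.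
  have m1 : measurable_fun setT (fun p => (Num.norm (g p))%:E).
    by apply/measurable_EFinP; exact: measurableT_comp.
  have m2 : measurable_fun setT (fun p => (nc (f p))%:E).
    by apply/measurable_EFinP; exact: measurable_normc.
  apply: ge0_le_integral => //.
  - by move=> x _; apply: integral_ge0 => y _; rewrite lee_fin.
  - by apply: (measurable_fun_fubini_tonelli_F (m2 := mu) _ m1) => x; rewrite lee_fin.
  - apply: (measurable_fun_fubini_tonelli_F (m2 := mu) _ m2) => x.
    by rewrite lee_fin normc_ge0.
  - move=> x _; apply: ge0_le_integral => //.
    + exact: (measurableT_comp m1).
    + exact: (measurableT_comp m2).
    + by move=> y _; rewrite lee_fin.
have [a1 a2 a3] := real_fubini mf1 (bnd _ mf1 (fun p => normr_Re _)).
have [b1 b2 b3] := real_fubini mf2 (bnd _ mf2 (fun p => normr_Im _)).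
split; [exact: (conj a1 b1)|exact: (conj a2 b2)|].
by apply: complex_ext; [exact: a3|exact: b3].
Qed.

(** The bound [M |f(x)| |g(y)|] makes the double integrand absolutely integrable. The lemma serves
    the exponential kernel, of modulus 1, and the Poisson kernel, bounded by [2 / e]. *)
Lemma complex_exchange (k : RR * RR -> R[i]) (M : R) (f g : R -> R[i]) : cmeas k ->
  (forall p, nc (k p) <= M) -> cinteg f -> cinteg g ->
  cinteg (fun x => f x * cint setT (fun y => k (x, y) * g y)) /\
  cint setT (fun x => f x * cint setT (fun y => k (x, y) * g y)) =
  cint setT (fun y => g y * cint setT (fun x => k (x, y) * f x)).
Proof.
move=> mk kM fi gi.
have M0 : 0 <= M by apply: le_trans (kM (0, 0)); exact: normc_ge0.
have mf := cinteg_cmeas fi; have mg := cinteg_cmeas gi.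
have mkx x : cmeas (fun y => k (x, y)) by exact: (cmeas_comp _ mk).
have mky y : cmeas (fun x => k (x, y)) by exact: (cmeas_comp _ mk).
pose h (p : RR * RR) := f p.1 * (k p * g p.2).
have mh : cmeas h.
  apply: cmeasM; first exact: (cmeas_comp (@measurable_fst _ _ _ _) mf).
  by apply: cmeasM => //; exact: (cmeas_comp (@measurable_snd _ _ _ _) mg).
have e1 x : f x * cint setT (fun y => k (x, y) * g y) = cint setT (fun y => h (x, y)).
  rewrite -cintZ; first by apply: eq_cint.
  exact: cintegMl (mkx x) (fun y => kM _) gi.
have e2 y : g y * cint setT (fun x => k (x, y) * f x) = cint setT (fun x => h (x, y)).
  rewrite -cintZ; last exact: cintegMl (mky y) (fun x => kM _) fi.
  by apply: eq_cint => x; rewrite /h/=; ring.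
rewrite (eq_cint e1) (eq_cint e2).
suff [] : [/\ cinteg (fun x => cint setT (fun y => h (x, y))),
      cinteg (fun y => cint setT (fun x => h (x, y))) &
      cint setT (fun x => cint setT (fun y => h (x, y))) =
      cint setT (fun y => cint setT (fun x => h (x, y)))].
  by move=> i1 _ ->; split; first by under eq_fun do rewrite e1.
apply: complex_fubini => //.
have nf := integrable_normc fi; have ng := integrable_normc gi.
pose K := \int[mu]_y nc (g y).
have EK : (\int[mu]_y (nc (g y))%:E = K%:E)%E.
  by rewrite fineK//; exact: integrable_fin_num.
apply: (@le_lt_trans _ _ (\int[mu]_x ((nc (f x) * (M * K))%:E))%E); last first.
  apply: integrable_lty => //; under eq_fun do rewrite mulrC EFinM.
  exact: integrableZl.
apply: ge0_le_integral => //.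
- by move=> x _; apply: integral_ge0 => y _; rewrite lee_fin normc_ge0.
- apply: (measurable_fun_fubini_tonelli_F (m2 := mu) (fun p => (nc (h p))%:E)).
    by apply/measurable_EFinP; exact: measurable_normc.
  by move=> x; rewrite lee_fin normc_ge0.
- by apply/measurable_EFinP/measurable_funM => //; exact: measurable_normc.
move=> x _; apply: (@le_trans _ _ (\int[mu]_y ((nc (f x) * M)%:E * (nc (g y))%:E))%E).
  apply: ge0_le_integral => //.
  - by move=> y _; rewrite lee_fin normc_ge0.
  - by apply/measurable_EFinP/measurable_normc; exact: (cmeas_comp _ mh).
  - by apply/measurable_EFinP/measurable_funM => //; exact: measurable_normc.
  - move=> y _; rewrite -EFinM lee_fin /h /= !normcM -mulrA ler_wpM2l ?normc_ge0//.
    by rewrite ler_wpM2r ?normc_ge0.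
rewrite integralZl// EK -EFinM lee_fin mulrA//.
Qed.

End fubini.

(** * The space L^2 and the Cauchy-Schwarz inequality *)

Section L2_space.
Context {R : realType}.
Local Notation mu := (@lebesgue_measure R).
Implicit Types f g : R -> R[i].

(** The square of the L^2 norm as a real number: it keeps extended reals and roots out of the
    estimates, and the factor 2 of [N2D] replaces the triangle inequality. *)
Definition N2 f : R := \int[mu]_x (nc (f x) ^+ 2).

Definition sqint f := mu.-integrable [set: R] (fun x => (nc (f x) ^+ 2)%:E).

Lemma N2_ge0 f : 0 <= N2 f.
Proof. by apply: Rintegral_ge0 => x _; exact: sqr_ge0. Qed.

Lemma L2norm_sqr f : (L2norm f `^ 2 = \int[mu]_x (nc (f x) ^+ 2)%:E)%E.
Proof.
rewrite /L2norm powR_Lnorm; last by rewrite pnatr_eq0.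
apply: eq_integral => x _; rewrite /= ger0_norm ?normc_ge0//.
by rewrite powR_mulrn// normc_ge0.
Qed.

Lemma L2P f : L2 f <-> cmeas f /\ sqint f.
Proof.
have e : cmeas f -> (L2norm f < +oo)%E <-> sqint f.
  move=> mf; have p0 : (0 <= L2norm f)%E by exact: Lnorm_ge0.
  have me : measurable_fun setT (fun x => (nc (f x) ^+ 2)%:E).
    by apply/measurable_EFinP/measurable_funX/measurable_normc.
  have ea : (\int[mu]_x `|(nc (f x) ^+ 2)%:E| = \int[mu]_x (nc (f x) ^+ 2)%:E)%E.
    by apply: eq_integral => x _; rewrite gee0_abs// lee_fin sqr_ge0.
  split=> [fin|/integrableP[_]].
    apply/integrableP; split => //; rewrite ea -L2norm_sqr.
    by apply: poweR_lty.
  rewrite ea -L2norm_sqr => fi; rewrite ltNge leye_eq; apply/negP => /eqP ny.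
  by move: fi; rewrite ny poweRyr// pnatr_eq0.
by split=> [[f1 f2 f3]|[[f1 f2] /e f3]]; split => //; [exact/e|exact: f3].
Qed.

Lemma L2_cmeas f : L2 f -> cmeas f. Proof. by move=> /L2P[]. Qed.
Lemma L2_sqint f : L2 f -> sqint f. Proof. by move=> /L2P[]. Qed.

Lemma L2normE f : L2 f -> L2norm f = (Num.sqrt (N2 f))%:E.
Proof.
move=> Lf; have [_ _ fin] := Lf; have p0 : (0 <= L2norm f)%E by exact: Lnorm_ge0.
have := L2norm_sqr f.
have [r rE] : exists r : R, L2norm f = r%:E.
  by exists (fine (L2norm f)); rewrite fineK// ge0_fin_numE.
rewrite rE in p0 *; rewrite poweR_EFin => e.
have -> : N2 f = r ^+ 2 by rewrite /N2 /Rintegral -e /= powR_mulrn.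
by rewrite sqrtr_sqr ger0_norm.
Qed.

Lemma le_L2 f (g : R -> R) : cmeas f -> mu.-integrable setT (fun x => (g x)%:E) ->
  (forall x, nc (f x) ^+ 2 <= g x) -> L2 f /\ N2 f <= \int[mu]_x g x.
Proof.
move=> mf ig fg; have sf : sqint f.
  apply: le_integrable ig => //.
    by apply/measurable_EFinP/measurable_funX/measurable_normc.
  by move=> x _ /=; rewrite lee_fin ger0_norm ?sqr_ge0// (le_trans (fg x))// ler_norm.
split; first exact/L2P.
by apply: le_Rintegral => // x _.
Qed.

Lemma sqint2 f g : sqint f -> sqint g ->
  mu.-integrable setT (fun x => (2 * nc (f x) ^+ 2 + 2 * nc (g x) ^+ 2)%:E) /\
  \int[mu]_x (2 * nc (f x) ^+ 2 + 2 * nc (g x) ^+ 2) = 2 * N2 f + 2 * N2 g.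
Proof.
move=> sf sg; have i1 := integrableZl measurableT 2 sf.
have i2 := integrableZl measurableT 2 sg; split.
  by under eq_fun do rewrite EFinD !EFinM; exact: integrableD.
by rewrite RintegralD// !RintegralZl.
Qed.

Lemma L2DN2 f g : L2 f -> L2 g -> L2 (fun x => f x + g x) /\
  N2 (fun x => f x + g x) <= 2 * N2 f + 2 * N2 g.
Proof.
move=> Lf Lg; have [i e] := sqint2 (L2_sqint Lf) (L2_sqint Lg).
rewrite -e; apply: le_L2 => // [|x]; last exact: normc_sqrD.
by apply: cmeasD; exact: L2_cmeas.
Qed.

Lemma L2D f g : L2 f -> L2 g -> L2 (fun x => f x + g x).
Proof. by move=> Lf Lg; have [] := L2DN2 Lf Lg. Qed.

Lemma N2D f g : L2 f -> L2 g -> N2 (fun x => f x + g x) <= 2 * N2 f + 2 * N2 g.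
Proof. by move=> Lf Lg; have [] := L2DN2 Lf Lg. Qed.

Lemma L2M b f (M : R) : cmeas b -> {ae mu, forall x, nc (b x) <= M} -> L2 f ->
  L2 (fun x => b x * f x) /\ N2 (fun x => b x * f x) <= M ^+ 2 * N2 f.
Proof.
move=> mb bM Lf; have mf := L2_cmeas Lf.
(* The bound on [b] holds only a.e., so [M^2 |f|^2] need not dominate [|b f|^2] everywhere. This
   minimum lies below it at every point and agrees a.e. with [|b f|^2]. *)
pose g x := Num.min (nc (b x) ^+ 2 * nc (f x) ^+ 2) (M ^+ 2 * nc (f x) ^+ 2).
have iM : mu.-integrable setT (fun x => (M ^+ 2 * nc (f x) ^+ 2)%:E).
  by under eq_fun do rewrite EFinM; apply: integrableZl => //; exact: L2_sqint.
have mbf : cmeas (fun x => b x * f x) by exact: cmeasM.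
have mn : measurable_fun setT (fun x => nc (b x * f x) ^+ 2).
  by apply/measurable_funX/measurable_normc.
have mg : measurable_fun setT g.
  apply: measurable_minr; apply: measurable_funM => //;
    by apply/measurable_funX/measurable_normc.
have g0 x : 0 <= g x by rewrite /g le_min; apply/andP; split; apply: mulr_ge0; exact: sqr_ge0.
have ig : mu.-integrable setT (fun x => (g x)%:E).
  apply: le_integrable iM => //; first exact/measurable_EFinP.
  move=> x _ /=; rewrite lee_fin ger0_norm//.
  by rewrite (le_trans _ (ler_norm _))// /g ge_min lexx orbT.
have gE : {ae mu, forall x, g x = nc (b x * f x) ^+ 2}.
  apply: filterS bM => x bx; rewrite normcM exprMn /g min_l// ler_wpM2r ?sqr_ge0//.
  by rewrite ler_sqr ?nnegrE ?normc_ge0// (le_trans _ bx)// normc_ge0.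
split; first by apply/L2P; split => //; exact: ae_eq_integrable gE ig.
have -> : N2 (fun x => b x * f x) = \int[mu]_x g x.
  congr fine; apply: ae_eq_integral => //; try exact/measurable_EFinP.
  by apply: filterS gE => x -> _.
rewrite -RintegralZl//; last exact: L2_sqint.
by apply: le_Rintegral => // x _; rewrite /g ge_min lexx orbT.
Qed.

Lemma L2Z c f : L2 f -> L2 (fun x => c * f x).
Proof.
move=> Lf; have [] // := @L2M (fun=> c) f (nc c) (cmeas_cst c) _ Lf.
exact: filterE.
Qed.

Lemma L2N f : L2 f -> L2 (fun x => - f x).
Proof. by move=> /(L2Z (-1)); under eq_fun do rewrite mulN1r. Qed.

Lemma L2B f g : L2 f -> L2 g -> L2 (fun x => f x - g x).
Proof. by move=> Lf Lg; apply: L2D => //; exact: L2N. Qed.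

Lemma eq_N2 f g : (forall x, nc (f x) = nc (g x)) -> N2 f = N2 g.
Proof. by move=> fg; apply: eq_Rintegral => x _; rewrite fg. Qed.

Lemma N2N f : N2 (fun x => - f x) = N2 f.
Proof. by apply: eq_N2 => x; exact: normcN. Qed.

Lemma N2J f : N2 (fun x => (f x)^*) = N2 f.
Proof. by apply: eq_N2 => x; rewrite normc_conjc. Qed.

Lemma L2J f : L2 f -> L2 (fun x => (f x)^*).
Proof.
move=> /L2P[mf sf]; apply/L2P; split; first exact: cmeasJ.
by rewrite /sqint; under eq_fun do rewrite normc_conjc.
Qed.

Lemma L2_0 : L2 (fun=> 0 : R[i]).
Proof.
apply/L2P; split; first exact: cmeas_cst.
by rewrite /sqint; under eq_fun do rewrite Normc.normc0 expr0n; exact: integrable0.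
Qed.

Lemma ae_eq_L2 f g : cmeas g -> aeeq f g -> L2 f -> L2 g.
Proof.
move=> mg fg /L2P[mf sf]; apply/L2P; split => //.
apply: ae_eq_integrable sf; last by apply: filterS fg => x ->.
by apply/measurable_funX/measurable_normc.
Qed.

Lemma ae_eq_N2 f g : cmeas f -> cmeas g -> aeeq f g -> N2 f = N2 g.
Proof.
move=> mf mg fg; congr fine; apply: ae_eq_integral => //;
  try by apply/measurable_EFinP/measurable_funX/measurable_normc.
by apply: filterS fg => x -> _.
Qed.

Lemma N2_eq0 f : L2 f -> N2 f = 0 -> aeeq f (fun=> 0).
Proof.
move=> /L2P[mf sf] f0.
have me : measurable_fun setT (fun x => (nc (f x) ^+ 2)%:E).
  by apply/measurable_EFinP/measurable_funX/measurable_normc.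
have : (\int[mu]_x `|(nc (f x) ^+ 2)%:E| = 0)%E.
  transitivity (\int[mu]_x (nc (f x) ^+ 2)%:E)%E; last first.
    by rewrite -[LHS]fineK; [congr EFin|exact: integrable_fin_num].
  by apply: eq_integral => x _; rewrite gee0_abs// lee_fin sqr_ge0.
move/(ae_eq_integral_abs mu measurableT me).1; apply: filterS => x /(_ I) /= [].
by move/eqP; rewrite sqrf_eq0 => /eqP /normc_eq0.
Qed.

Lemma cinteg_mul f g : L2 f -> L2 g -> cinteg (fun x => f x * g x).
Proof.
move=> Lf Lg; have [i _] := sqint2 (L2_sqint Lf) (L2_sqint Lg).
apply: le_cinteg i _; first by apply: cmeasM; exact: L2_cmeas.
move=> x; rewrite normcM.
have := sqr_ge0 (nc (f x) - nc (g x)); have := sqr_ge0 (nc (f x)).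
have := sqr_ge0 (nc (g x)); nra.
Qed.

(** The quadratic [t -> int (t |f| - |g|)^2] is nonnegative, in particular at its minimiser
    [C / N2 f]. *)
Lemma cauchy_schwarz f g : L2 f -> L2 g ->
  nc (cint setT (fun x => f x * g x)) ^+ 2 <= N2 f * N2 g.
Proof.
move=> Lf Lg; have fgi := cinteg_mul Lf Lg.
pose C := \int[mu]_x (nc (f x * g x)).
have C0 : 0 <= C by apply: Rintegral_ge0 => x _; exact: normc_ge0.
have quad (t : R) : 0 <= t ^+ 2 * N2 f - 2 * t * C + N2 g.
  have i1 : mu.-integrable setT (fun x => (t ^+ 2 * nc (f x) ^+ 2)%:E).
    by under eq_fun do rewrite EFinM; apply: integrableZl => //; exact: L2_sqint.
  have i2 : mu.-integrable setT (fun x => (2 * t * nc (f x * g x))%:E).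
    by under eq_fun do rewrite EFinM; apply: integrableZl => //; exact: integrable_normc.
  have i3 := L2_sqint Lg.
  have i12 : mu.-integrable setT (fun x => (t ^+ 2 * nc (f x) ^+ 2 - 2 * t * nc (f x * g x))%:E).
    by under eq_fun do rewrite EFinB; exact: integrableB.
  rewrite -RintegralZl//; last exact: L2_sqint.
  rewrite -RintegralZl//; last exact: integrable_normc.
  rewrite -RintegralB// -RintegralD//; apply: Rintegral_ge0 => x _.
  by rewrite normcM; have := sqr_ge0 (t * nc (f x) - nc (g x)); nra.
apply: (@le_trans _ _ (C ^+ 2)).
  by rewrite ler_sqr ?nnegrE ?normc_ge0//; exact: normc_cint.
(* If [N2 f] vanishes the quadratic is affine in [t]; were [C] positive, its value at
   [(N2 g + 1) / C] would be [- N2 g - 2], which is negative. *)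
have [A0|A0] := eqVneq (N2 f) 0.
  rewrite A0 mul0r; have [->|Cn] := eqVneq C 0; first by rewrite expr0n.
  have Cp : 0 < C by rewrite lt_def Cn.
  have := quad ((N2 g + 1) / C); rewrite A0 mulr0 add0r.
  have -> : 2 * ((N2 g + 1) / C) * C = 2 * (N2 g + 1) by field.
  have := N2_ge0 g; nra.
have Ap : 0 < N2 f by rewrite lt_def A0 N2_ge0.
have := quad (C / N2 f); rewrite -(ler_pM2l Ap) mulr0.
have -> : N2 f * ((C / N2 f) ^+ 2 * N2 f - 2 * (C / N2 f) * C + N2 g) =
   N2 f * N2 g - C ^+ 2 by field.
by rewrite subr_ge0.
Qed.

End L2_space.

(** * Convergence in L^2 *)

Section L2_convergence.
Context {R : realType}.
Local Notation mu := (@lebesgue_measure R).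
Implicit Types f g : R -> R[i].

(** Membership in L^2 is asked only near the limit, because functions of time are controlled only
    within [0, T]. *)
Lemma cvg_L2norm {T : Type} (F : set_system T) {FF : Filter F} (h : T -> R -> R[i]) :
  (\forall t \near F, L2 (h t)) ->
  L2norm (h t) @[t --> F] --> (0 : \bar R) <-> N2 (h t) @[t --> F] --> (0 : R).
Proof.
move=> Lh; split=> [h0|h0].
  have : (fine (L2norm (h t))) ^+ 2 @[t --> F] --> (0 : R).
    rewrite (_ : (0 : R) = (fine 0%E) ^+ 2); last by rewrite expr0n.
    under eq_fun do rewrite expr2.
    by rewrite expr2; apply: cvgM; apply: fine_cvg.
  apply: cvg_trans; apply: near_eq_cvg; near=> t.
  have Lt : L2 (h t) by near: t.
  by rewrite L2normE//= sqr_sqrtr// N2_ge0.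
have : (Num.sqrt (N2 (h t)))%:E @[t --> F] --> (0 : \bar R).
  apply: cvg_EFin; first exact: filterE.
  rewrite (_ : 0%R = Num.sqrt 0); last by rewrite sqrtr0.
  exact: (continuous_cvg _ (@sqrt_continuous R 0) h0).
apply: cvg_trans; apply: near_eq_cvg; near=> t.
have Lt : L2 (h t) by near: t.
by rewrite L2normE.
Unshelve. all: by end_near. Qed.

Lemma squeeze0 {T : Type} (F : set_system T) {FF : Filter F} (a b : T -> R) :
  (\forall t \near F, 0 <= a t <= b t) -> b t @[t --> F] --> (0 : R) ->
  a t @[t --> F] --> (0 : R).
Proof. by move=> ab b0; apply: (squeeze_cvgr ab) b0; exact: cvg_cst. Qed.

Lemma cvgZ0 {T : Type} (F : set_system T) {FF : Filter F} (c : R) (a : T -> R) :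
  a t @[t --> F] --> (0 : R) -> c * a t @[t --> F] --> (0 : R).
Proof. by move=> a0; rewrite -(mulr0 c); apply: cvgM => //; exact: cvg_cst. Qed.

Lemma cvgD0 {T : Type} (F : set_system T) {FF : Filter F} (a b : T -> R) :
  a t @[t --> F] --> (0 : R) -> b t @[t --> F] --> (0 : R) ->
  a t + b t @[t --> F] --> (0 : R).
Proof. by move=> a0 b0; rewrite -(addr0 0); exact: cvgD. Qed.

Definition L2to (h : nat -> R -> R[i]) f :=
  [/\ forall n, L2 (h n), L2 f & N2 (fun x => h n x - f x) @[n --> \oo] --> (0 : R)].

Lemma le_L2to (h : nat -> R -> R[i]) f (a : nat -> R) : (forall n, L2 (h n)) -> L2 f ->
  (forall n, N2 (fun x => h n x - f x) <= a n) -> a n @[n --> \oo] --> (0 : R) ->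
  L2to h f.
Proof.
move=> Lh Lf ha a0; split => //; apply: squeeze0 a0; near=> n.
by rewrite N2_ge0 ha.
Unshelve. all: by end_near. Qed.

Lemma aeeq_sub0 f g : aeeq (fun x => f x - g x) (fun=> 0) -> aeeq f g.
Proof. by apply: filterS => x /eqP; rewrite subr_eq0 => /eqP. Qed.

Lemma L2to_uniq h f g : L2to h f -> L2to h g -> aeeq f g.
Proof.
move=> [Lh Lf hf] [_ Lg hg]; apply: aeeq_sub0.
apply: N2_eq0; first exact: L2B.
have : (fun=> N2 (fun x => f x - g x)) @ \oo --> (0 : R).
  apply: (@squeeze0 _ _ _ _ (fun n => 2 * N2 (fun x => h n x - f x) +
     2 * N2 (fun x => h n x - g x))); last by apply: cvgD0; exact: cvgZ0.
  near=> n; rewrite N2_ge0/=.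
  rewrite (@eq_N2 _ _ (fun x => (h n x - g x) + - (h n x - f x))); last first.
    by move=> x; congr nc; ring.
  apply: le_trans (N2D _ _) _; [exact: L2B|by apply: L2N; exact: L2B|].
  by rewrite N2N addrC.
move=> /(cvg_lim (@Rhausdorff R)) <-; apply/esym/cvg_lim => //; exact: cvg_cst.
Unshelve. all: by end_near. Qed.

Lemma L2to_ext h k f : (forall n x, h n x = k n x) -> L2to h f -> L2to k f.
Proof. by move=> e; rewrite (_ : h = k)//; apply/funext => n; apply/funext. Qed.

Lemma L2to_ae h f g : L2 g -> aeeq f g -> L2to h f -> L2to h g.
Proof.
move=> Lg fg [Lh Lf hf]; split => //; apply: cvg_trans hf.
apply: near_eq_cvg; near=> n; apply: ae_eq_N2.
- by apply: L2_cmeas; exact: L2B.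
- by apply: L2_cmeas; exact: L2B.
- by apply: filterS fg => x ->.
Unshelve. all: by end_near. Qed.

Lemma L2toD h k f g : L2to h f -> L2to k g ->
  L2to (fun n x => h n x + k n x) (fun x => f x + g x).
Proof.
move=> [Lh Lf hf] [Lk Lg kg].
apply: (@le_L2to _ _ (fun n => 2 * N2 (fun x => h n x - f x) +
     2 * N2 (fun x => k n x - g x))).
- by move=> n; exact: L2D.
- exact: L2D.
- move=> n.
  rewrite (@eq_N2 _ _ (fun x => (h n x - f x) + (k n x - g x))); last first.
    by move=> x; congr nc; ring.
  by apply: N2D; exact: L2B.
- by apply: cvgD0; exact: cvgZ0.
Qed.

Lemma L2toM b (M : R) h f : cmeas b -> {ae mu, forall x, nc (b x) <= M} ->
  L2to h f -> L2to (fun n x => b x * h n x) (fun x => b x * f x).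
Proof.
move=> mb bM [Lh Lf hf].
have H k : L2 k -> L2 (fun x => b x * k x) /\ N2 (fun x => b x * k x) <= M ^+ 2 * N2 k.
  exact: L2M.
apply: (@le_L2to _ _ (fun n => M ^+ 2 * N2 (fun x => h n x - f x))).
- by move=> n; have [] := H _ (Lh n).
- by have [] := H _ Lf.
- move=> n; rewrite (@eq_N2 _ _ (fun x => b x * (h n x - f x))).
    by have [] := H _ (L2B (Lh n) Lf).
  by move=> x; rewrite mulrBr.
- exact: cvgZ0.
Qed.

Lemma L2toZ c h f : L2to h f -> L2to (fun n x => c * h n x) (fun x => c * f x).
Proof.
by apply: (@L2toM (fun=> c) (nc c)); [exact: cmeas_cst|exact: filterE].
Qed.

Lemma L2to_cst f : L2 f -> L2to (fun=> f) f.
Proof.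
move=> Lf; split => //; apply: (@squeeze0 _ _ _ _ (fun=> 0)); last exact: cvg_cst.
near=> n; rewrite N2_ge0/= (@eq_N2 _ _ (fun=> 0)); last by move=> x; rewrite subrr.
rewrite /N2 Rintegral_cst// Normc.normc0 expr0n mul0r//.
Unshelve. all: by end_near. Qed.

Definition ctends (A : nat -> R[i]) a := nc (A n - a) @[n --> \oo] --> (0 : R).

Lemma ctends_uniq A a b : ctends A a -> ctends A b -> a = b.
Proof.
move=> Aa Ab; apply/eqP; rewrite -subr_eq0; apply/eqP/normc_eq0.
have : (fun=> nc (a - b)) @ \oo --> (0 : R).
  apply: (@squeeze0 _ _ _ _ (fun n => nc (A n - a) + nc (A n - b))).
    near=> n; rewrite normc_ge0/= -normcN.
    rewrite (_ : - (a - b) = (A n - a) + - (A n - b)); last by ring.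
    by have := le_normcD (A n - a) (- (A n - b)); rewrite [nc (- _)]normcN.
  exact: cvgD0.
move=> /(cvg_lim (@Rhausdorff R)) <-; apply/esym/cvg_lim => //; exact: cvg_cst.
Unshelve. all: by end_near. Qed.

Lemma ctends_cst a : ctends (fun=> a) a.
Proof.
apply: (@squeeze0 _ _ _ _ (fun=> 0)); last exact: cvg_cst.
by near=> n; rewrite subrr Normc.normc0 lexx.
Unshelve. all: by end_near. Qed.

Lemma ctends_ext A B a : (forall n, A n = B n) -> ctends A a -> ctends B a.
Proof. by move=> /funext ->. Qed.

Lemma ctendsD A B a b : ctends A a -> ctends B b -> ctends (fun n => A n + B n) (a + b).
Proof.
move=> Aa Bb; apply: (@squeeze0 _ _ _ _ (fun n => nc (A n - a) + nc (B n - b))).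
  near=> n; rewrite normc_ge0/= (_ : _ - _ = (A n - a) + (B n - b)); last by ring.
  exact: le_normcD.
exact: cvgD0.
Unshelve. all: by end_near. Qed.

Lemma ctendsZ c A a : ctends A a -> ctends (fun n => c * A n) (c * a).
Proof.
move=> /(@cvgZ0 _ _ _ (nc c)); apply: cvg_trans; apply: near_eq_cvg.
by near=> n; rewrite -mulrBr normcM.
Unshelve. all: by end_near. Qed.

Lemma L2to_cint h f g : L2to h f -> L2 g ->
  ctends (fun n => cint setT (fun x => h n x * g x)) (cint setT (fun x => f x * g x)).
Proof.
move=> [Lh Lf hf] Lg.
have : Num.sqrt (N2 g * N2 (fun x => h n x - f x)) @[n --> \oo] --> (0 : R).
  rewrite (_ : 0%R = Num.sqrt 0); last by rewrite sqrtr0.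
  exact: (continuous_cvg _ (@sqrt_continuous R 0) (cvgZ0 _ hf)).
apply: squeeze0; near=> n; rewrite normc_ge0 andTb.
rewrite -cintB; [|exact: cinteg_mul|exact: cinteg_mul].
rewrite -[leLHS]ger0_norm ?normc_ge0// -sqrtr_sqr ler_wsqrtr//.
rewrite (@eq_cint _ _ (fun x => (h n x - f x) * g x)); last by move=> x; ring.
by rewrite mulrC; apply: cauchy_schwarz => //; exact: L2B.
Unshelve. all: by end_near. Qed.

(** Dominated convergence with the dominating function [(M + M)^2 |f|^2]. Through this lemma and its
    corollary [cvg_mult1] pass the truncations, the Abel weights, the cutoffs and the arctangent
    kernels. *)
Lemma cvg_mult (c : nat -> R -> R[i]) (c0 : R -> R[i]) (M : R) f :
  (forall n, cmeas (c n)) -> cmeas c0 ->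
  (forall n x, nc (c n x) <= M) -> (forall x, nc (c0 x) <= M) ->
  {ae mu, forall x, ctends (c^~ x) (c0 x)} -> L2 f ->
  L2to (fun n x => c n x * f x) (fun x => c0 x * f x).
Proof.
move=> mc mc0 cM c0M cc0 Lf; have mf := L2_cmeas Lf; have sf := L2_sqint Lf.
have Lcf b : cmeas b -> (forall x, nc (b x) <= M) -> L2 (fun x => b x * f x).
  by move=> mb bM; have [] := L2M mb (filterE _ bM) Lf.
split; [by move=> n; exact: Lcf|exact: Lcf|].
have M0 : 0 <= M by apply: le_trans (c0M 0); exact: normc_ge0.
have := @dominated_convergence _ _ _ mu setT measurableT
  (fun n x => (nc (c n x * f x - c0 x * f x) ^+ 2)%:E) (cst 0%E)
  (fun x => ((M + M) ^+ 2 * nc (f x) ^+ 2)%:E).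
case.
- move=> n; apply/measurable_EFinP/measurable_funX/measurable_normc.
  by apply: L2_cmeas; apply: L2B; exact: Lcf.
- exact: measurable_cst.
- apply: filterS cc0 => x h _ /=; apply: cvg_EFin; first exact: filterE.
  have : (nc (f x) ^+ 2) * (nc (c n x - c0 x) * nc (c n x - c0 x)) @[n --> \oo] --> (0 : R).
    by apply: cvgZ0; rewrite -(mulr0 0); exact: cvgM.
  apply: cvg_trans; apply: near_eq_cvg; near=> n => /=.
  by rewrite -mulrBl normcM exprMn mulrC expr2.
- by under eq_fun do rewrite EFinM; exact: integrableZl.
- apply: filterE => x n _ /=; rewrite lee_fin ger0_norm ?sqr_ge0//.
  rewrite -mulrBl normcM exprMn ler_wpM2r ?sqr_ge0//.
  rewrite ler_sqr ?nnegrE ?normc_ge0 ?addr_ge0//.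
  by apply: le_trans (le_normcD _ _) _; rewrite [nc (- _)]normcN lerD.
move=> _ _; rewrite integral0 => /fine_cvg; exact.
Unshelve. all: by end_near. Qed.

Lemma cvg_mult1 (c : nat -> R -> R[i]) f : (forall n, cmeas (c n)) ->
  (forall n x, nc (c n x) <= 1) -> (forall x, ctends (c^~ x) 1) -> L2 f ->
  L2to (fun n x => c n x * f x) f.
Proof.
move=> mc c1 cc Lf.
have e : (fun x => 1 * f x) = f by apply/funext => x; rewrite mul1r.
have := @cvg_mult c (fun=> 1) 1 f mc (cmeas_cst 1) c1; rewrite e; apply => //.
- by move=> x; rewrite Normc.normc1.
- exact: filterE.
Qed.

End L2_convergence.

(** * Completeness of L^2 *)

Section L2_complete.
Context {R : realType}.
Local Notation mu := (@lebesgue_measure R).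
Implicit Types f g : R -> R[i].

Lemma limn_einf_le (u : nat -> \bar R) C : (forall n, (u n <= C)%E) ->
  (limn_einf u <= C)%E.
Proof.
move=> uC; rewrite limn_einf_lim; apply: lime_le; first exact: is_cvg_einfs.
apply: filterE => n; apply: le_trans (uC n); apply: ereal_inf_lbound.
by exists n => /=.
Qed.

Lemma ctends_cvg (A : nat -> R[i]) a : Re (A n) @[n --> \oo] --> Re a ->
  Im (A n) @[n --> \oo] --> Im a -> ctends A a.
Proof.
move=> Aa Ab.
apply: (@squeeze0 _ _ _ _ _ (fun n => `|Re (A n) - Re a| + `|Im (A n) - Im a|)).
  near=> n; rewrite normc_ge0 andTb.
  by apply: le_trans (normc_le _) _; rewrite !ReIm.
by apply: cvgD0; apply/norm_cvg0P; apply/subr_cvg0.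
Unshelve. all: by end_near. Qed.

(** Fatou's lemma; membership of the limit in L^2 is a conclusion. It serves both completeness and
    the removal of the Abel weight in [plancherel_le]. *)
Lemma fatou_N2 (k : nat -> R -> R[i]) g (C : R) : (forall n, L2 (k n)) -> cmeas g ->
  {ae mu, forall x, ctends (k^~ x) (g x)} -> (forall n, N2 (k n) <= C) ->
  L2 g /\ N2 g <= C.
Proof.
move=> Lk mg kg kC.
have me h : cmeas h -> measurable_fun [set: R] (fun x => (nc (h x : R[i]) ^+ 2)%:E).
  by move=> mh; apply/measurable_EFinP/measurable_funX/measurable_normc.
have mk n := me _ (L2_cmeas (Lk n)).
have le : (\int[mu]_x (nc (g x) ^+ 2)%:E <= C%:E)%E.
  have := fatou mu measurableT mk _.
  rewrite (@ae_eq_integral _ _ _ mu setT (fun x => (nc (g x) ^+ 2)%:E)) //.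
  - move=> h; apply: le_trans (h _) _ => [n x _|]; first by rewrite lee_fin sqr_ge0.
    apply: limn_einf_le => n; rewrite -[leLHS]fineK ?lee_fin; first exact: kC.
    by apply: integrable_fin_num => //; exact: L2_sqint.
  - rewrite /limn_einf; apply: measurableT_comp => //.
    apply: (@measurable_fun_limn_esup _ _ _ _ (fun n x => - (nc (k n x) ^+ 2)%:E)%E) => n.
    exact: measurableT_comp.
  - exact: me.
  - apply: filterS kg => x kgx _ /=; apply: (cvg_limn_einf_sup _).1.
    apply: cvg_EFin; first exact: filterE.
    have cn : nc (k n x) @[n --> \oo] --> nc (g x).
      apply/subr_cvg0/norm_cvg0P; apply: squeeze0 kgx; near=> n; rewrite normr_ge0 andTb.
      exact: normc_lipschitz.
    by under eq_fun do rewrite /= expr2; rewrite expr2; exact: cvgM.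
have sg : sqint g.
  apply/integrableP; split; first exact: me.
  apply: le_lt_trans (ltry C); apply: le_trans le.
  by under eq_integral do rewrite gee0_abs ?lee_fin ?sqr_ge0//.
split; first exact/L2P.
by rewrite -lee_fin fineK//; exact: integrable_fin_num.
Unshelve. all: by end_near. Qed.

(** The increments [d n] have squared norm at most [8^-n], so the series of [2^n |d n|^2] has
    integral at most the sum of [4^-n] and is finite a.e. Where it is finite,
    [|d n| <= 2^-n + 2^n |d n|^2] makes the telescoping series converge absolutely. *)
Lemma fast_cvg (h : nat -> R -> R[i]) : (forall n, L2 (h n)) ->
  (forall n, N2 (fun x => h n.+1 x - h n x) <= 8^-1 ^+ n) ->
  exists2 g, cmeas g & {ae mu, forall x, ctends (h^~ x) (g x)}.
Proof.
move=> Lh hd; pose d n x := h n.+1 x - h n x.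
have Ld n : L2 (d n) by exact: L2B.
pose w n x : \bar R := (2 ^+ n * nc (d n x) ^+ 2)%:E.
have mw n : measurable_fun [set: R] (w n).
  by apply/measurable_EFinP/measurable_funM => //;
    apply/measurable_funX/measurable_normc/L2_cmeas.
have w0 n x : (0 <= w n x)%E by rewrite lee_fin mulr_ge0// ?sqr_ge0// exprn_ge0.
have iw : (\int[mu]_x \sum_(0 <= n <oo) w n x < +oo)%E.
  rewrite integral_nneseries//.
  apply: (@le_lt_trans _ _ (\sum_(0 <= n <oo) (geometric 1 4^-1 n)%:E)%E).
    apply: lee_nneseries => [n _ _|n _]; first exact: integral_ge0.
    have i : mu.-integrable setT (fun x => (nc (d n x) ^+ 2)%:E) by exact: L2_sqint.
    rewrite /w; under eq_integral do rewrite EFinM.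
    rewrite integralZl// -[X in (_ * X)%E]fineK; last exact: integrable_fin_num.
    have -> : geometric 1 4^-1 n = 2 ^+ n * 8^-1 ^+ n :> R.
      by rewrite /geometric/= mul1r -exprMn; congr (_ ^+ _); field.
    by rewrite -EFinM lee_fin ler_wpM2l ?exprn_ge0//; exact: hd.
  have lt1 : `|4^-1 : R| < 1 by rewrite ger0_norm// invf_lt1// ltr1n.
  have -> : (\sum_(0 <= n <oo) (geometric 1 4^-1 n)%:E)%E =
     limn (EFin \o series (geometric (1:R) 4^-1)).
    congr (limn _); apply/funext => n /=; rewrite /series/= sumEFin//.
  rewrite EFin_lim ?ltry//; exact: is_cvg_geometric_series.
have : {ae mu, forall x, (\sum_(0 <= n <oo) w n x)%E \is a fin_num}.
  have iW : mu.-integrable setT (fun x => (\sum_(0 <= n <oo) w n x)%E).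
    apply/integrableP; split; first exact: (@ge0_emeasurable_sum _ _ _ setT w xpredT
      (fun n x _ _ => w0 n x) (fun n _ => mw n)).
    by under eq_integral do rewrite gee0_abs ?nneseries_ge0//.
  by have := integrable_ae measurableT iW; apply: filterS => x; exact.
move=> aefin.
have cv (p : R[i] -> R) x : {morph p : a b / a - b} -> (forall z, `|p z| <= nc z) ->
    (\sum_(0 <= n <oo) w n x)%E \is a fin_num -> cvgn (fun n => p (h n x)).
  move=> pB pn fx.
  have : cvgn (series (telescope (fun n => p (h n x)))).
    apply: normed_cvg; apply: nondecreasing_is_cvgn.
      by apply/nondecreasing_seqP => n; rewrite /normed_series_of seriesSr lerDl;
        exact: normr_ge0.
    exists (2 + fine (\sum_(0 <= n <oo) w n x)) => _ [n _ <-].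
    apply: (@le_trans _ _ (\sum_(0 <= i < n) (2^-1 ^+ i + 2 ^+ i * nc (d i x) ^+ 2))).
      apply: ler_sum => i _; rewrite [leLHS](_ : _ = `|p (d i x)|); last by rewrite pB.
      apply: le_trans (pn _) _.
      have p2 : (2 : R) ^+ i * 2^-1 ^+ i = 1 by rewrite -exprMn divff ?expr1n.
      have q0 : (0 : R) < 2 ^+ i by rewrite exprn_gt0.
      rewrite -(ler_pM2l q0) mulrDr p2.
      have := mulr_ge0 (ltW q0) (normc_ge0 (d i x)).
      have := sqr_ge0 (1 - 2 ^+ i * nc (d i x)); nra.
    rewrite big_split lerD//.
      have lt1 : `|2^-1 : R| < 1 by rewrite ger0_norm// invf_lt1// ltr1n.
      have := @geometric_le_lim _ n 1 2^-1 (ler01) _ lt1.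
      move=> /(_ (ltac:(by rewrite invr_gt0))) H.
      rewrite [leRHS](_ : _ = 1 / (1 - 2^-1)); last by field.
      apply: le_trans H; rewrite /series/= le_eqVlt; apply/orP; left; apply/eqP.
      by apply: eq_bigr => i _; rewrite mul1r.
    rewrite -lee_fin fineK// -sumEFin.
    by apply: (@nneseries_lim_ge _ (fun n => w n x) xpredT 0%N n) => m _ _.
  rewrite telescopeK => /cvg_ex [l cl]; apply/cvg_ex; exists (l + p (h 0%N x)).
  have cD : (p (h n x) - p (h 0%N x)) + p (h 0%N x) @[n --> \oo] --> l + p (h 0%N x).
    by apply: cvgD; [exact: cl|exact: cvg_cst].
  apply: cvg_trans cD; apply: near_eq_cvg; near=> n; by rewrite /= subrK.
(* A limit superior is measurable in [x] whether or not the sequence converges there, and it is the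
   limit where it does. *)
pose lim_of (p : R[i] -> R) x := fine (limn_esup (fun n => (p (h n x))%:E)).
have lim_ofE (p : R[i] -> R) x : cvgn (fun n => p (h n x)) -> p
  (h n x) @[n --> \oo] --> lim_of p x.
  move=> /cvg_ex[l pl]; suff -> : lim_of p x = l by [].
  rewrite /lim_of (cvg_limn_einf_sup (l := l%:E) _).2//.
  by apply: cvg_EFin; first exact: filterE.
exists (fun x => Complex (lim_of (@complex.Re R) x) (lim_of (@complex.Im R) x)).
  have mp (p : R[i] -> R) : (forall n, measurable_fun [set: R] (fun x => p (h n x))) ->
      measurable_fun [set: R] (lim_of p).
    move=> mph; apply: measurableT_comp => //.
    by apply: (@measurable_fun_limn_esup _ _ _ _ (fun n x => (p (h n x))%:E)) => n;
      exact/measurable_EFinP.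
  by split; apply: mp => n; have [] := L2_cmeas (Lh n).
apply: filterS aefin => x fx; apply: ctends_cvg.
  apply: (lim_ofE (@complex.Re R)); apply: cv => //; last exact: normr_Re.
  by move=> a b; rewrite !ReIm.
apply: (lim_ofE (@complex.Im R)); apply: cv => //; last exact: normr_Im.
by move=> a b; rewrite !ReIm.
Unshelve. all: by end_near. Qed.

Theorem L2_complete (h : nat -> R -> R[i]) : (forall n, L2 (h n)) ->
  (forall e : R, 0 < e -> exists N, forall m n, (N <= m)%N -> (N <= n)%N ->
    N2 (fun x => h m x - h n x) <= e) -> exists f, L2to h f.
Proof.
move=> Lh hC.
have /choice[N0 HN0] k : exists N, forall m n, (N <= m)%N -> (N <= n)%N ->
    N2 (fun x => h m x - h n x) <= 8^-1 ^+ k.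
  by apply: hC; rewrite exprn_gt0.
(* The partial sums make [N] nondecreasing and at least [N0]; the summand [k] makes it tend to
   infinity. *)
pose N k := (k + \sum_(j < k.+1) N0 j)%N.
have N0N k : (N0 k <= N k)%N by rewrite /N big_ord_recr /= addnA leq_addl.
have NS k : (N k <= N k.+1)%N.
  rewrite /N [X in (_ <= _ + X)%N]big_ord_recr /=.
  by apply: leq_add => //; exact: leq_addr.
have [] := @fast_cvg (fun k => h (N k)).
- by [].
- by move=> k; apply: HN0 => //; exact: leq_trans (NS k).
move=> g mg hg.
(* Fatou applied to [h m - h (N (j + M))] as [j] grows carries the Cauchy bound over to [h m - g];
   thus the whole sequence converges, not only the subsequence. *)
have key (e : R) : 0 < e -> exists M, forall m, (M <= m)%N ->
    L2 (fun x => h m x - g x) /\ N2 (fun x => h m x - g x) <= e.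
  move=> e0; have [M HM] := hC _ e0; exists M => m Mm.
  have kM j : (M <= N (j + M)%N)%N by rewrite /N -addnA addnCA leq_addr.
  apply: (@fatou_N2 (fun j x => h m x - h (N (j + M)%N) x)).
  - by move=> n; exact: L2B.
  - by apply: cmeasB => //; exact: L2_cmeas.
  - apply: filterS hg => x hgx.
    have : ctends (fun j => h (N (j + M)%N) x) (g x).
      by rewrite /ctends (cvg_shiftn M (fun j => nc (h (N j) x - g x))).
    move=> /(ctendsZ (-1)) /(ctendsD (ctends_cst (h m x))).
    by rewrite mulN1r; apply: ctends_ext => n; rewrite mulN1r.
  - by move=> j; apply: HM.
have Lg : L2 g.
  have [M HM] := key 1 ltr01; have [L _] := HM M (leqnn _).
  have := L2B (Lh M) L; congr L2; apply/funext => x; ring.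
exists g; split => //; apply/cvgrPdist_le => e e0.
have [M HM] := key e e0; exists M => // m /= Mm.
by rewrite sub0r normrN ger0_norm ?N2_ge0//; have [] := HM m Mm.
Qed.

End L2_complete.

(** * The Fourier transform on L^2 *)

Section intervals.
Context {R : realType}.
Local Notation mu := (@lebesgue_measure R).
Implicit Types f g : R -> R[i].

Definition box (a b : R) (x : R) : R[i] := (\1_`[a, b] x)%:C.

Lemma box_in a b x : a <= x <= b -> box a b x = 1.
Proof. by move=> axb; rewrite /box indicE mem_set//= in_itv. Qed.

Lemma box_out a b x : ~~ (a <= x <= b) -> box a b x = 0.
Proof. by move=> axb; rewrite /box indicE memNset//= in_itv/=; exact/negP. Qed.

Lemma boxE a b x : box a b x = if a <= x <= b then 1 else 0.
Proof. by case: ifPn => [/box_in|/box_out]. Qed.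

Lemma measurable_indic_itv a b : measurable_fun [set: R] (\1_`[a, b] : R -> R).
Proof. exact: measurable_indic. Qed.

Lemma cmeas_box a b : cmeas (box a b).
Proof. by apply: cmeasR; exact: measurable_indic_itv. Qed.

Lemma normc_box a b x : nc (box a b x) <= 1.
Proof. by rewrite boxE; case: ifP; rewrite ?Normc.normc1 ?Normc.normc0. Qed.

Lemma box_id a b x : box a b x * box a b x = box a b x.
Proof. by rewrite boxE; case: ifP; rewrite ?mulr1 ?mulr0. Qed.

Lemma boxJ a b x : (box a b x)^* = box a b x.
Proof. by rewrite boxE; case: ifP; rewrite ?conjc1 ?conjc0. Qed.

Lemma integrable_indic_itvcc a b : mu.-integrable [set: R] (fun x => (\1_`[a, b] x : R)%:E).
Proof. exact: (integrable_indic_itv a b true false). Qed.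

Lemma L2_box a b : L2 (box a b).
Proof.
have h x : nc (box a b x) ^+ 2 <= \1_`[a, b] x.
  rewrite /box normcR indicE; case: (_ \in _) => /=;
    by rewrite ?normr1 ?normr0 ?expr1n ?expr0n.
by have [] := le_L2 (cmeas_box a b) (integrable_indic_itvcc a b) h.
Qed.

Lemma cint_box a b f : cint `[a, b] f = cint setT (fun x => box a b x * f x).
Proof. exact: cint_mkcond. Qed.

Lemma L2_box_mul a b f : L2 f -> L2 (fun x => box a b x * f x).
Proof.
by move=> Lf; have [] := L2M (cmeas_box a b) (filterE _ (normc_box a b)) Lf.
Qed.

Lemma cinteg_box_mul a b f : L2 f -> cinteg (fun x => box a b x * f x).
Proof. by move=> Lf; exact: cinteg_mul (L2_box a b) Lf. Qed.

Lemma cvg_box f : L2 f -> L2to (fun n x => box (- n%:R) n%:R x * f x) f.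
Proof.
apply: cvg_mult1.
- by move=> n; exact: cmeas_box.
- by move=> n x; exact: normc_box.
- move=> x; apply: (@squeeze0 _ _ _ _ _ (fun=> 0)); last exact: cvg_cst.
  near=> n; rewrite box_in ?subrr ?Normc.normc0 ?lexx//.
  rewrite -ler_norml; near: n; exact: nbhs_infty_ger.
Unshelve. all: by end_near. Qed.

(** The primitive of [f] from minus infinity is zero, and by Lebesgue differentiation its derivative
    is a.e. [f]. *)
Lemma real_ae0_of_intervals (f : R -> R) : mu.-integrable setT (fun x => (f x)%:E) ->
  (forall x, \int[mu]_(t in `]-oo, x]) f t = 0) -> {ae mu, forall x, f x = 0}.
Proof.
move=> fi f0.
have locf : locally_integrable [set: R] f.
  by have := integrable_locally measurableT fi; rewrite patch_setT.
have fiy y : mu.-integrable `]-oo, y] (EFin \o f).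
  exact: integrableS fi.
have := FTC1Ny fiy locf; apply: filterS => x [_].
rewrite (_ : (fun x => _) = cst 0); last exact/funext.
by rewrite derive1_cst.
Qed.

(** Integrability is asked on bounded intervals only, which suits differences such as [H - i xi F].
    Cutting to [-n, n] gives integrable functions to which the half-line criterion applies. *)
Lemma ae0_of_intervals f : (forall a b, cinteg (fun x => box a b x * f x)) ->
  (forall a b, a < b -> cint setT (fun x => box a b x * f x) = 0) ->
  aeeq f (fun=> 0).
Proof.
move=> fi f0.
have key (n : nat) : {ae mu, forall x, box (- n%:R) n%:R x * f x = 0}.
  have [i1 i2] := fi (- n%:R) n%:R.
  (* On []-oo, x]] the function cut to [-n, n] integrates over the interval from -n to min(x, n);
     when this is degenerate at most the point -n is left, a null set. *)
  have cut (x : R) : cint `]-oo, x] (fun x => box (- n%:R) n%:R x * f x) = 0.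
    rewrite cint_mkcond; have [nx|xn] := ltP (- n%:R) (Num.min x n%:R).
      rewrite -[RHS](f0 (- n%:R) (Num.min x n%:R) nx); apply: eq_cint => t.
      rewrite mulrA; congr (_ * _); rewrite indicE.
      case: (boolP (t \in _)); rewrite ?mul1r ?mul0r ?inE ?notin_setE/= in_itv/=.
        move=> tx; have [tn|tn] := boolP (- n%:R <= t <= n%:R).
          rewrite !box_in//; case/andP: tn => -> /=; by rewrite le_min tx.
        rewrite !box_out//; apply: contra tn => /andP[-> /=].
        by rewrite le_min => /andP[].
      move=> /negP tx; rewrite box_out//; apply: contra tx => /andP[_].
      by rewrite le_min => /andP[].
    rewrite (@ae_eq_cint _ _ (fun=> 0)).
    - rewrite -[X in cint _ X](_ : (fun x => 0 * 0) = _); last by apply/funext => y;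
      rewrite mulr0.
      rewrite cintZ ?mul0r//; split; exact: integrable0.
    - apply: cmeasM; first by apply: cmeasR; apply: measurable_indic.
      by apply: cinteg_cmeas; exact: fi.
    - exact: cmeas_cst.
    - exists [set (- n%:R)]; split; [exact: measurable_set1|exact: lebesgue_measure_set1|].
      move=> t /=; apply: contra_notP => tn; rewrite indicE.
      case: (boolP (t \in _)); rewrite ?mul1r ?mul0r//= inE/= in_itv/= => tx.
      rewrite box_out ?mul0r//; apply/negP => /andP[nt tn'].
      apply: tn; apply/eqP; rewrite eq_le nt andbT.
      by apply: le_trans xn; rewrite le_min tx.
  have z1 x : \int[mu]_(t in `]-oo, x]) complex.Re (box (- n%:R) n%:R t * f t) = 0.
    by have := cut x; rewrite /cint => -[].
  have z2 x : \int[mu]_(t in `]-oo, x]) complex.Im (box (- n%:R) n%:R t * f t) = 0.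
    by have := cut x; rewrite /cint => -[].
  have := real_ae0_of_intervals i1 z1; have := real_ae0_of_intervals i2 z2.
  by apply: filterS2 => x e1 e2; apply: complex_ext.
have : {ae mu, forall x n, box (- n%:R) n%:R x * f x = 0}.
  exact/ae_foralln.
apply: filterS => x fx.
have [n xn] : exists n : nat, `|x| <= n%:R.
  by exists (Num.truncn `|x|).+1; rewrite ltW// truncnS_gt.
by have := fx n; rewrite box_in ?mul1r// -ler_norml.
Qed.

End intervals.

(** * Invariance of Lebesgue measure under translations and reflection *)

Section invariance.
Context {R : realType}.
Local Notation mu := (@lebesgue_measure R).

(** The image of [mu] under [phi] is [mu]. Positive and negative parts are treated separately, so
    [f] need not be integrable. *)
Lemma integral_invariant (phi : measurableTypeR R -> measurableTypeR R) :
  measurable_fun setT phi ->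
  (forall A, measurable A -> mu (phi @^-1` A) = mu A) ->
  forall f : R -> \bar R, measurable_fun setT f ->
  (\int[mu]_x f (phi x) = \int[mu]_x f x)%E.
Proof.
move=> mphi inv.
have ge0 (f : R -> \bar R) : measurable_fun setT f -> (forall x, 0 <= f x)%E ->
    (\int[mu]_x f (phi x) = \int[mu]_x f x)%E.
  move=> mf f0.
  have := @ge0_integral_pushforward _ _ _ _ _ phi mphi mu setT f measurableT mf (fun y _ => f0 y).
  rewrite preimage_setT => <-; apply: eq_measure_integral => A mA _.
  exact: inv.
move=> f mf; rewrite integralE [RHS]integralE; congr (_ - _)%E.
  rewrite -(ge0 _ (measurable_funepos mf) (fun x => funepos_ge0 _ _)).
  by apply: eq_integral => x _; rewrite !funeposE.
rewrite -(ge0 _ (measurable_funeneg mf) (fun x => funeneg_ge0 _ _)).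
by apply: eq_integral => x _; rewrite !funenegE.
Qed.

Lemma lebesgue_measure_shift (c : R) (A : set R) : measurable A ->
  mu ((fun x : R => x + c) @^-1` A) = mu A.
Proof.
move=> mA; have mc : measurable_fun setT (fun x : measurableTypeR R => x + c : measurableTypeR R).
  exact: measurable_funD.
rewrite -[LHS]/(pushforward mu (fun x : measurableTypeR R => x + c : measurableTypeR R) A).
apply/esym/lebesgue_measure_unique => //= _ [[a b]] _ <-.
rewrite /pushforward (_ : _ @^-1` _ = `]a - c, b - c]%classic).
  by rewrite !lebesgue_measure_itv/= !lte_fin ltrD2r -!EFinD; case: ifP => // _; congr EFin; ring.
by apply/seteqP; split => x /=; rewrite !in_itv/= ltrBlDr lerBrDr.
Qed.

Lemma lebesgue_measure_opp (A : set R) : measurable A ->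
  mu ((fun x : R => - x) @^-1` A) = mu A.
Proof. exact: lebesgue_measureN. Qed.

Lemma cint_opp (f : R -> R[i]) : cmeas f ->
  cint setT (fun x => f (- x)) = cint setT f.
Proof.
move=> [f1 f2]; have mc : measurable_fun setT (fun x : measurableTypeR R => - x :
  measurableTypeR R).
  exact: measurableT_comp.
by apply: complex_ext; congr fine; apply: (integral_invariant mc lebesgue_measure_opp);
  exact/measurable_EFinP.
Qed.

End invariance.

(** * The Fourier transform of integrable functions *)

Section L1_fourier.
Context {R : realType}.
Local Notation mu := (@lebesgue_measure R).
Local Notation RR := (measurableTypeR R).
Implicit Types f g : R -> R[i].

Definition ek (x xi : R) : R[i] := cos (x * xi) -i* sin (x * xi).

Lemma normc_ek x xi : nc (ek x xi) = 1.
Proof. exact: normc_unit. Qed.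

Lemma ekC x xi : ek x xi = ek xi x.
Proof. by rewrite /ek mulrC. Qed.

Lemma ekDl x y xi : ek (x + y) xi = ek x xi * ek y xi.
Proof.
rewrite /ek mulrDl cosD sinD; apply: complex_ext; rewrite /= ?ReIm /=; ring.
Qed.

Lemma ekDr x xi eta : ek x (xi + eta) = ek x xi * ek x eta.
Proof. by rewrite ekC ekDl !(ekC x). Qed.

Lemma ekN x xi : ek (- x) xi = (ek x xi)^*.
Proof. by rewrite /ek mulNr cosN sinN; apply: complex_ext; rewrite /= ?opprK. Qed.

Lemma ekNr x xi : ek x (- xi) = (ek x xi)^*.
Proof. by rewrite ekC ekN ekC. Qed.

Lemma cmeas_ek2 : cmeas (fun p : RR * RR => ek p.1 p.2).
Proof.
have m : measurable_fun setT (fun p : RR * RR => p.1 * p.2 : R).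
  by apply: measurable_funM; [exact: measurable_fst|exact: measurable_snd].
split => /=.
  by apply: (measurableT_comp _ m); exact: continuous_measurable_fun (@continuous_cos R).
have ms : measurable_fun setT (fun p : RR * RR => sin (p.1 * p.2) : R).
  by apply: (measurableT_comp _ m); exact: continuous_measurable_fun (@continuous_sin R).
exact: (measurableT_comp (@oppr_measurable R setT) ms).
Qed.

Lemma cmeas_ek xi : cmeas (fun x => ek x xi).
Proof. exact: (cmeas_comp (h := fun x : RR => (x, xi : RR)) _ cmeas_ek2). Qed.

Definition ft f (xi : R) : R[i] := cint setT (fun x => ek x xi * f x).

Lemma cinteg_ek f xi : cinteg f -> cinteg (fun x => ek x xi * f x).
Proof. by apply: (@cintegMl _ _ _ 1) => [|x]; [exact: cmeas_ek|rewrite normc_ek]. Qed.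

Lemma eq_ft f g xi : (forall x, f x = g x) -> ft f xi = ft g xi.
Proof. by move=> fg; apply: eq_cint => x; rewrite fg. Qed.

Lemma normc_ft f xi : cinteg f -> nc (ft f xi) <= \int[mu]_x nc (f x).
Proof.
move=> fi; apply: le_trans (normc_cint (cinteg_ek xi fi)) _.
rewrite le_eqVlt; apply/orP; left; apply/eqP; apply: eq_Rintegral => x _.
by rewrite normcM normc_ek mul1r.
Qed.

Lemma cmeas_cint2 (h : RR * RR -> R[i]) : cmeas h ->
  cmeas (fun x => cint setT (fun y => h (x, y))).
Proof. by move=> [h1 h2]; split; [exact: (measurable_Rintegral2 h1)|exact:
  (measurable_Rintegral2 h2)]. Qed.

Lemma cmeas_ft f : cinteg f -> cmeas (ft f).
Proof.
move=> fi; apply: (@cmeas_cint2 (fun p => ek p.2 p.1 * f p.2)); apply: cmeasM.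
  exact: (cmeas_comp (h := fun p : RR * RR => (p.2, p.1)) measurable_swapRR cmeas_ek2).
exact: (cmeas_comp (@measurable_snd _ _ _ _) (cinteg_cmeas fi)).
Qed.

(** Fubini with the symmetric kernel [e^{- i x xi}]. This multiplication formula is the means by
    which transforms are moved from one factor of an integral to the other. *)
Lemma ft_mul f g : cinteg f -> cinteg g ->
  cinteg (fun x => f x * ft g x) /\
  cint setT (fun x => f x * ft g x) = cint setT (fun x => g x * ft f x).
Proof.
move=> fi gi.
have mk : cmeas (fun p : RR * RR => ek p.2 p.1).
  exact: (cmeas_comp (h := fun p : RR * RR => (p.2, p.1)) measurable_swapRR cmeas_ek2).
have nk (p : RR * RR) : nc (ek p.2 p.1) <= 1 by rewrite normc_ek.
have [i e] := complex_exchange mk nk fi gi; split; first exact: i.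
rewrite [LHS]e.
by apply: eq_cint => y; congr (_ * _); apply: eq_cint => x; rewrite /= ekC.
Qed.

Lemma ftD f g xi : cinteg f -> cinteg g ->
  ft (fun x => f x + g x) xi = ft f xi + ft g xi.
Proof.
move=> fi gi; rewrite /ft -cintD; [|exact: cinteg_ek|exact: cinteg_ek].
by apply: eq_cint => x; rewrite mulrDr.
Qed.

Lemma ftZ c f xi : cinteg f -> ft (fun x => c * f x) xi = c * ft f xi.
Proof.
move=> fi; rewrite /ft -cintZ; last exact: cinteg_ek.
by apply: eq_cint => x; rewrite mulrCA.
Qed.

Lemma ftJ f xi : cinteg f -> ft (fun x => (f x)^*) xi = (ft f (- xi))^*.
Proof.
move=> fi; rewrite /ft -cintJ; last exact: cinteg_ek.
by apply: eq_cint => x; rewrite conjcM ekNr conjcK.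
Qed.

Lemma ft_mod f xi eta : ft (fun x => ek x (- eta) * f x) xi = ft f (xi - eta).
Proof. by apply: eq_cint => x; rewrite mulrA -ekDr. Qed.

End L1_fourier.

(** * The Abel weight and its transform, the Poisson kernel *)

Section Abel_kernel.
Context {R : realType}.
Local Notation mu := (@lebesgue_measure R).
Local Notation RR := (measurableTypeR R).
Variable e : R.
Hypothesis e0 : 0 < e.

Definition wt (xi : R) : R := expR (- (e * `|xi|)).
(** [2 pi] times the Poisson kernel of the half-plane at height [e]: the transform of the Abel
    weight [wt], of total mass [2 pi]. *)
Definition kern (z : R) : R := 2 * e / (e ^+ 2 + z ^+ 2).

Lemma den_gt0 z : 0 < e ^+ 2 + z ^+ 2.
Proof. by rewrite ltr_pwDl ?exprn_gt0// sqr_ge0. Qed.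

(** The summand 1 keeps the integrand nonnegative, as needed for the fundamental theorem of calculus
    on a half-line in the form used. The integral with the cosine alone is recovered in [ft_wt] by
    subtraction. *)
Lemma half_line (z : R) : (\int[mu]_(x in `[0%R, +oo[) (expR (- (e * x)) * (1 + cos (z * x)))%:E =
  (e^-1 + e / (e ^+ 2 + z ^+ 2))%:E)%E.
Proof.
have d0 := den_gt0 z.
pose F (x : R) := - (expR (- (e * x)) / e) +
  expR (- (e * x)) * (z * sin (z * x) - e * cos (z * x)) / (e ^+ 2 + z ^+ 2).
have dF (x : R) : is_derive x 1 F (expR (- (e * x)) * (1 + cos (z * x))).
  have d1 : is_derive x 1 (fun x => expR (- (e * x))) (- e * expR (- (e * x))).
    apply: is_derive_eq; rewrite /GRing.scale/=; ring.
  have d2 : is_derive x 1 (fun x => sin (z * x)) (z * cos (z * x)).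
    apply: is_derive_eq; rewrite /GRing.scale/=; ring.
  have d3 : is_derive x 1 (fun x => cos (z * x)) (- (z * sin (z * x))).
    apply: is_derive_eq; rewrite /GRing.scale/=; ring.
  rewrite /F; apply: is_derive_eq; rewrite /GRing.scale/=.
  field; by rewrite !gt_eqF.
have ex0 : expR (- (e * x)) @[x --> +oo] --> (0 : R).
  apply: (@cvg_comp _ _ _ (fun x => e * x) (fun y => expR (- y)) _ +oo).
    exact: (gt0_cvgMry e0 (@cvg_id _ _)).
  exact: cvgr_expR.
have Fy : F x @[x --> +oo] --> (0 : R).
  apply/norm_cvg0P.
  apply: (@squeeze0 _ _ _ _ _ (fun x => (e^-1 + (`|z| + e) / (e ^+ 2 + z ^+ 2)) * expR (-
    (e * x)))).
    near=> x; rewrite normr_ge0 andTb /F.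
    have x0 := expR_ge0 (- (e * x)).
    apply: le_trans (ler_normD _ _) _; rewrite mulrDl; apply: lerD.
      by rewrite normrN ger0_norm ?divr_ge0 ?(ltW e0)// mulrC.
    rewrite !normrM normfV (ger0_norm x0) (gtr0_norm d0) [leRHS]mulrC mulrA.
    rewrite ler_wpM2r ?invr_ge0 ?(ltW d0)// ler_wpM2l//.
    apply: le_trans (ler_normB _ _) _; rewrite !normrM (gtr0_norm e0) lerD//.
      rewrite ler_piMr//; have := sin_max (z * x); exact.
    rewrite ler_piMr ?(ltW e0)//; exact: cos_max.
  exact: cvgZ0.
rewrite (@ge0_continuous_FTC2y _ _ F 0 0) //; first last.
- by move=> x _; rewrite derive1E; have [_] := dF x.
- apply: cvg_at_right_filter; apply: differentiable_continuous.
  by apply/derivable1_diffP; have [] := dF 0.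
- apply: continuous_subspaceT => x; apply: differentiable_continuous.
  by apply/derivable1_diffP.
- rewrite /F mulr0 oppr0 expR0 mulr0 sin0 cos0 -EFinB; congr EFin; field.
  by rewrite !gt_eqF.
Unshelve. all: by end_near. Qed.

Lemma wt_ge0 xi : 0 <= wt xi. Proof. exact: expR_ge0. Qed.

Lemma wt_le1 xi : wt xi <= 1.
Proof. by rewrite -expR0 ler_expR oppr_le0 mulr_ge0// ltW. Qed.

Lemma continuous_wt : continuous wt.
Proof.
move=> x; apply: continuous_comp; last exact: continuous_expR.
apply: continuousN; apply: continuousM; first exact: cst_continuous.
exact: norm_continuous.
Qed.

Lemma full_line (z : R) : (\int[mu]_x (wt x * (1 + cos (z * x)))%:E =
  (2 * (e^-1 + e / (e ^+ 2 + z ^+ 2)))%:E)%E.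
Proof.
rewrite ge0_symfun_integralT.
- rewrite EFinM -half_line set_itvcy; congr (_ * _)%E; apply: eq_integral => x.
  by rewrite inE/= => x0; rewrite /wt ger0_norm.
- by move=> x; rewrite mulr_ge0 ?wt_ge0//; have := cos_geN1 (z * x); lra.
- move=> x; apply: continuousM; first exact: continuous_wt.
  apply: continuousD; first exact: cst_continuous.
  apply: continuous_comp; last exact: continuous_cos.
  by apply: continuousM; [exact: cst_continuous|exact: cvg_id].
- by move=> x; rewrite /= /wt normrN mulrN cosN.
Qed.

Lemma measurable_wt : measurable_fun [set: R] wt.
Proof. exact: continuous_measurable_fun continuous_wt. Qed.

Lemma integral_wt : (\int[mu]_x (wt x)%:E = (2 / e)%:E)%E.
Proof.
have h : (\int[mu]_x (2 * wt x)%:E = (2 * (2 / e))%:E)%E.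
  have := full_line 0.
  have -> : 2 * (e^-1 + e / (e ^+ 2 + 0 ^+ 2)) = 2 * (2 / e).
    by rewrite expr0n addr0; field; rewrite gt_eqF.
  move=> <-; apply: eq_integral => x _; rewrite mul0r cos0; congr EFin; ring.
transitivity (\int[mu]_x (2^-1%:E * (2 * wt x)%:E))%E.
  by apply: eq_integral => x _; rewrite -EFinM; congr EFin; field.
rewrite ge0_integralZl//; last 2 first.
- by apply/measurable_EFinP/measurable_funM => //; exact: measurable_wt.
- by move=> x _; rewrite lee_fin mulr_ge0// wt_ge0.
by rewrite h -EFinM; congr EFin; field; rewrite gt_eqF.
Qed.

Lemma integrable_wt : mu.-integrable setT (fun x => (wt x)%:E).
Proof.
apply/integrableP; split; first by apply/measurable_EFinP; exact: measurable_wt.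
under eq_integral do rewrite gee0_abs ?lee_fin ?wt_ge0//.
by rewrite integral_wt ltry.
Qed.

Lemma cinteg_wt : cinteg (fun x => (wt x)%:C).
Proof.
apply: le_cinteg integrable_wt _; first by apply: cmeasR; exact: measurable_wt.
by move=> x; rewrite normcR ger0_norm ?wt_ge0.
Qed.

(** [wt] is even, so its transform equals its own conjugate and is real; the real part is the value
    of [full_line] minus that of [integral_wt]. *)
Lemma ft_wt (z : R) : ft (fun x => (wt x)%:C) z = (kern z)%:C.
Proof.
have ci := cinteg_ek z cinteg_wt.
have eJ : (ft (fun x => (wt x)%:C) z)^* = ft (fun x => (wt x)%:C) z.
  rewrite /ft -cintJ// -[LHS]cint_opp; last first.
    by apply: cmeasJ; exact: cinteg_cmeas.
  by apply: eq_cint => x; rewrite conjcM ekN conjcK conjcR /wt normrN.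
apply: complex_ext; last by have := congr1 (@complex.Im R) eJ; rewrite ReIm /=; lra.
have e1 : \int[mu]_x (wt x * (1 + cos (z * x))) = 2 * (e^-1 + e / (e ^+ 2 + z ^+ 2)).
  by rewrite /Rintegral full_line.
have e2 : \int[mu]_x (wt x) = 2 / e by rewrite /Rintegral integral_wt.
have i3 := ci.1.
have e3 : \int[mu]_x (wt x + complex.Re (ek x z * (wt x)%:C)) =
    2 * (e^-1 + e / (e ^+ 2 + z ^+ 2)).
  rewrite -e1; apply: eq_Rintegral => x _.
  by rewrite ReIm /= mulr0 subr0 (mulrC x z); ring.
move: e3; rewrite RintegralD//; last exact: integrable_wt.
rewrite e2 /kern /= => h; have -> : 2 * e / (e ^+ 2 + z ^+ 2) =
  2 * (e^-1 + e / (e ^+ 2 + z ^+ 2)) - 2 / e.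
  by field; rewrite !gt_eqF// den_gt0.
by rewrite -h addrC addKr.
Qed.

End Abel_kernel.

(** * The weighted Plancherel identity and Schur's test *)

Section plancherel.
Context {R : realType}.
Local Notation mu := (@lebesgue_measure R).
Local Notation RR := (measurableTypeR R).
Implicit Types f g : R -> R[i].

Lemma kern_ge0 (e z : R) : 0 < e -> 0 <= kern e z.
Proof. by move=> e0; rewrite divr_ge0 ?mulr_ge0 ?(ltW e0)// ltW// den_gt0. Qed.

Lemma kernN (e z : R) : kern e (- z) = kern e z.
Proof. by rewrite /kern sqrrN. Qed.

Lemma kern_le (e z : R) : 0 < e -> kern e z <= 2 / e.
Proof.
move=> e0; rewrite /kern ler_pdivrMr ?den_gt0//.
rewrite (_ : 2 / e * _ = 2 * e + 2 / e * z ^+ 2); last by field; rewrite gt_eqF.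
by rewrite lerDl mulr_ge0 ?sqr_ge0// divr_ge0// ltW.
Qed.

Lemma continuous_kern (e : R) : 0 < e -> continuous (kern e).
Proof.
move=> e0 x; rewrite /continuous_at /kern; apply: cvgM; first exact: cvg_cst.
apply: cvgV; first by rewrite gt_eqF// den_gt0.
by apply: cvgD; [exact: cvg_cst|exact: exprn_continuous].
Qed.

Lemma measurable_kern (e : R) : 0 < e -> measurable_fun [set: R] (kern e).
Proof. by move=> e0; apply: continuous_measurable_fun; exact: continuous_kern. Qed.

Lemma is_derive_atan_div (e c x : R) : 0 < e ->
  is_derive x 1 (fun y => 2 * atan ((y - c) / e)) (kern e (x - c)).
Proof.
move=> e0.
have d1 : is_derive x 1 (fun y => (y - c) / e) e^-1.
  by apply: is_derive_eq; rewrite /GRing.scale/=; ring.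
have d2 : is_derive x 1 (fun y => atan ((y - c) / e)) ((1 + ((x - c) / e) ^+ 2)^-1 * e^-1).
  by apply: is_derive_eq; rewrite /GRing.scale/=; ring.
apply: is_derive_eq; rewrite /GRing.scale/= /kern; field.
by rewrite !gt_eqF// den_gt0.
Qed.

Lemma integral_kern (e : R) : 0 < e -> (\int[mu]_x (kern e x)%:E = (2 * pi)%:E)%E.
Proof.
move=> e0; rewrite ge0_symfun_integralT; last 3 first.
- by move=> x; exact: kern_ge0.
- exact: continuous_kern.
- by move=> x; rewrite /= kernN.
rewrite -set_itvcy EFinM; congr (_ * _)%E.
pose F (x : R) := 2 * atan ((x - 0) / e).
have dF (x : R) : is_derive x 1 F (kern e x) by have := is_derive_atan_div 0 x e0; rewrite subr0.
rewrite (@ge0_continuous_FTC2y _ _ F 0 pi) //.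
- by rewrite /F subrr mul0r atan0 mulr0 sube0.
- by move=> x _; exact: kern_ge0.
- by apply: continuous_subspaceT => x; exact: continuous_kern.
- rewrite (_ : pi = 2 * (pi / 2)); last by field.
  apply: cvgM; first exact: cvg_cst.
  apply: (@cvg_comp _ _ _ (fun x => (x - 0) / e) atan _ +oo); last exact: cvgy_atan.
  under eq_fun do rewrite subr0 mulrC.
  by apply: (gt0_cvgMry _ (@cvg_id _ _)); rewrite invr_gt0.
- apply: cvg_at_right_filter; apply: differentiable_continuous.
  by apply/derivable1_diffP; have [] := dF 0.
- by move=> x _; rewrite derive1E; have [_] := dF x.
Qed.

Lemma integral_kern_shift (e c : R) : 0 < e ->
  (\int[mu]_x (kern e (x + c))%:E = (2 * pi)%:E)%E.
Proof.
move=> e0; rewrite -(integral_kern e0).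
have mc : measurable_fun setT (fun x : measurableTypeR R => x + c : measurableTypeR R).
  exact: measurable_funD.
apply: (integral_invariant mc (lebesgue_measure_shift c) (f := fun x => (kern e x)%:E)).
by apply/measurable_EFinP; exact: measurable_kern.
Qed.

Lemma integral_kern_itv (e a b x : R) : 0 < e -> a < b ->
  \int[mu]_(y in `[a, b]) kern e (y - x) =
  2 * atan ((b - x) / e) - 2 * atan ((a - x) / e).
Proof.
move=> e0 ab; rewrite /Rintegral.
have dF y := is_derive_atan_div x y e0.
rewrite (@continuous_FTC2 _ _ (fun y => 2 * atan ((y - x) / e)) a b ab) //.
- apply: continuous_subspaceT => y.
  apply: (@continuous_comp _ _ _ (fun y : R => y - x) (kern e)); last exact: continuous_kern.
  by apply: cvgB; [exact: cvg_id|exact: cvg_cst].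
- have cF y : {for y, continuous (fun y => 2 * atan ((y - x) / e))}.
    by apply: differentiable_continuous; apply/derivable1_diffP; have [] := dF y.
  split; first by move=> y _; have [] := dF y.
  - exact: cvg_at_right_filter (cF a).
  - exact: cvg_at_left_filter (cF b).
- by move=> y _; rewrite derive1E; have [_] := dF y.
Qed.

Lemma cmeas_kern2 (e : R) : 0 < e -> cmeas (fun p : RR * RR => (kern e (p.2 - p.1))%:C).
Proof.
move=> e0; apply: cmeasR; apply: (measurableT_comp (measurable_kern e0)).
by apply: measurable_funB; [exact: measurable_snd|exact: measurable_fst].
Qed.

Lemma cinteg_kern (e x : R) g : 0 < e -> cinteg g -> cinteg (fun y => (kern e (y - x))%:C * g y).
Proof.
move=> e0; apply: (@cintegMl _ _ _ (2 / e)).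
  apply: cmeasR; apply: (measurableT_comp (measurable_kern e0)).
  exact: measurable_funB.
by move=> y; rewrite normcR ger0_norm ?kern_ge0//; exact: kern_le.
Qed.

(** Two uses of the multiplication formula. The weight makes [h] integrable, which the transform of
    [g] need not be, so the transform can be moved from [f] to [h]. In the result the transform is
    moved once more, from [g] to the weight modulated by [e^{i x xi}], where it yields the Poisson
    kernel centred at [x]. *)
Lemma abel_plancherel (e : R) f g : 0 < e -> cinteg f -> cinteg g ->
  cint setT (fun xi => (wt e xi)%:C * (ft f xi * (ft g xi)^*)) =
  cint setT (fun x => f x * (cint setT (fun y => (kern e (y - x))%:C * g y))^*).
Proof.
move=> e0 fi gi; pose C := \int[mu]_x nc (g x).
have gC xi : nc (ft g xi) <= C by exact: normc_ft.
pose h xi := (ft g xi)^* * (wt e xi)%:C.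
have hi : cinteg h.
  apply: (@cintegMl _ _ _ C); last exact: cinteg_wt.
    by apply: cmeasJ; exact: cmeas_ft.
  by move=> xi; rewrite normc_conjc.
have [_ e1] := ft_mul fi hi.
transitivity (cint setT (fun x => h x * ft f x)).
  by apply: eq_cint => x; rewrite /h; ring.
rewrite -e1; apply: eq_cint => x; congr (_ * _).
have wi : cinteg (fun xi => ek xi (- x) * (wt e xi)%:C) by apply: cinteg_ek; exact: cinteg_wt.
have [_ e2] := ft_mul wi gi.
rewrite /ft -cintJ; last exact: cinteg_kern.
transitivity (cint setT (fun xi => ((ek xi (- x) * (wt e xi)%:C) * ft g xi)^*)).
  apply: eq_cint => xi; rewrite /h !conjcM conjcR ekNr conjcK; ring.
rewrite (cintJ (ft_mul wi gi).1) e2 -(cintJ (ft_mul gi wi).1).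
by apply: eq_cint => y; rewrite (ft_mod (fun x => (wt e x)%:C)) (ft_wt e0) mulrC.
Qed.

(** [|f(x)| |f(y)|] is at most half the sum of [|f(x)|^2] and [|f(y)|^2]. The kernel is symmetric
    with mass [2 pi] in each variable, so each of the two terms, [A] and [B], contributes
    [pi N2 f]. *)
Lemma schur (e : R) f : 0 < e -> cinteg f -> L2 f ->
  nc (cint setT (fun x => f x * (cint setT (fun y => (kern e (y - x))%:C * f y))^*)) <=
  2 * pi * N2 f.
Proof.
move=> e0 fi Lf; have mf := cinteg_cmeas fi.
have ki x := cinteg_kern x e0 fi.
have bk (p : RR * RR) : nc (kern e (p.2 - p.1))%:C <= 2 / e.
  by rewrite normcR ger0_norm ?kern_ge0//; exact: kern_le.
have [ii _] := complex_exchange (cmeas_kern2 e0) bk (cintegJ fi) fi.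
have ii' : cinteg (fun x => f x * (cint setT (fun y => (kern e (y - x))%:C * f y))^*).
  by have := cintegJ ii; under eq_fun do rewrite conjcM conjcK.
apply: le_trans (normc_cint ii') _; rewrite -lee_fin.
rewrite fineK; last by apply: integrable_fin_num => //; exact: integrable_normc.
pose K (x y : R) := kern e (y - x).
have K0 x y : 0 <= K x y by exact: kern_ge0.
have mK : measurable_fun setT (fun p : RR * RR => K p.1 p.2).
  apply: (measurableT_comp (measurable_kern e0)).
  by apply: measurable_funB; [exact: measurable_snd|exact: measurable_fst].
have mn : measurable_fun setT (fun x : RR => nc (f x) ^+ 2).
  by apply/measurable_funX/measurable_normc.
pose A (p : RR * RR) := (K p.1 p.2 / 2 * nc (f p.1) ^+ 2)%:E.
pose B (p : RR * RR) := (K p.1 p.2 / 2 * nc (f p.2) ^+ 2)%:E.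
have mA : measurable_fun setT A.
  apply/measurable_EFinP/measurable_funM; first exact: measurable_funM.
  exact: (measurableT_comp mn).
have mB : measurable_fun setT B.
  apply/measurable_EFinP/measurable_funM; first exact: measurable_funM.
  exact: (measurableT_comp mn).
have A0 p : (0 <= A p)%E by rewrite lee_fin mulr_ge0 ?sqr_ge0// divr_ge0.
have B0 p : (0 <= B p)%E by rewrite lee_fin mulr_ge0 ?sqr_ge0// divr_ge0.
have mAx x : measurable_fun setT (fun y => A (x, y)) by exact: (measurableT_comp mA).
have mBx x : measurable_fun setT (fun y => B (x, y)) by exact: (measurableT_comp mB).
have mBy y : measurable_fun setT (fun x => B (x, y)) by exact: (measurableT_comp mB).
have EA x : (\int[mu]_y A (x, y) = (pi * nc (f x) ^+ 2)%:E)%E.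
  transitivity (\int[mu]_y ((nc (f x) ^+ 2 / 2)%:E * (kern e (y - x))%:E))%E.
    by apply: eq_integral => y _; rewrite -EFinM /A /K/=; congr EFin; field.
  rewrite ge0_integralZl//.
  - by rewrite (integral_kern_shift (- x) e0) -EFinM; congr EFin; field.
  - apply/measurable_EFinP; apply: (measurableT_comp (measurable_kern e0)).
    exact: measurable_funB.
  - by move=> y _; rewrite lee_fin kern_ge0.
  - by rewrite lee_fin divr_ge0// sqr_ge0.
have EB y : (\int[mu]_x B (x, y) = (pi * nc (f y) ^+ 2)%:E)%E.
  transitivity (\int[mu]_x ((nc (f y) ^+ 2 / 2)%:E * (kern e (x - y))%:E))%E.
    apply: eq_integral => x _; rewrite -EFinM /B /K/= -(kernN e (x - y)) opprB.
    by congr EFin; field.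
  rewrite ge0_integralZl//.
  - by rewrite (integral_kern_shift (- y) e0) -EFinM; congr EFin; field.
  - apply/measurable_EFinP; apply: (measurableT_comp (measurable_kern e0)).
    exact: measurable_funB.
  - by move=> x _; rewrite lee_fin kern_ge0.
  - by rewrite lee_fin divr_ge0// sqr_ge0.
have EN : (\int[mu]_x (pi * nc (f x) ^+ 2)%:E = (pi * N2 f)%:E)%E.
  under eq_integral do rewrite EFinM.
  rewrite integralZl//; last exact: L2_sqint.
  by rewrite -[X in (_ * X)%E]fineK//; apply: integrable_fin_num => //; exact: L2_sqint.
have mIA : measurable_fun setT (fun x : RR => (pi * nc (f x) ^+ 2)%:E).
  by apply/measurable_EFinP/measurable_funM.
have mIB : measurable_fun setT (fun x => \int[mu]_y B (x, y))%E.
  exact: (measurable_fun_fubini_tonelli_F (m2 := mu) _ mB).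
have -> : (2 * pi * N2 f)%:E = (\int[mu]_x ((pi * nc (f x) ^+ 2)%:E + \int[mu]_y B (x, y)))%E.
  rewrite ge0_integralD//; last 2 first.
  - by move=> x _; rewrite lee_fin mulr_ge0 ?pi_ge0 ?sqr_ge0.
  - by move=> x _; exact: integral_ge0.
  rewrite EN (fubini_tonelli (m1 := mu) (m2 := mu) B mB B0).
  under [X in (_ + X)%E]eq_integral do rewrite EB.
  by rewrite EN -EFinD; congr EFin; ring.
apply: ge0_le_integral => //.
- by move=> x _; rewrite lee_fin normc_ge0.
- apply/measurable_EFinP/measurable_normc; exact: cinteg_cmeas.
- exact: emeasurable_funD.
move=> x _; rewrite -EA -ge0_integralD//.
rewrite normcM normc_conjc.
apply: (@le_trans _ _ (\int[mu]_y ((nc (f x))%:E * (nc ((kern e (y - x))%:C * f y))%:E))%E).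
  rewrite integralZl//; last exact: integrable_normc.
  rewrite EFinM lee_wpmul2l ?lee_fin ?normc_ge0//.
  rewrite -[leRHS]fineK ?lee_fin; first exact: normc_cint.
  by apply: integrable_fin_num => //; exact: integrable_normc.
apply: ge0_le_integral => //.
- by move=> y _; rewrite -EFinM lee_fin mulr_ge0 ?normc_ge0.
- apply/measurable_EFinP/measurable_funM => //.
  by apply: measurable_normc; exact: cinteg_cmeas.
- by apply: emeasurable_funD.
move=> y _; rewrite -EFinM -EFinD lee_fin normcM normcR ger0_norm ?kern_ge0// /K /=.
have := mulr_ge0 (K0 x y) (sqr_ge0 (nc (f x) - nc (f y))); rewrite /K; nra.
Qed.

End plancherel.

(** * Removing the Abel weight *)

Section plancherel_limit.
Context {R : realType}.
Local Notation mu := (@lebesgue_measure R).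
Local Notation RR := (measurableTypeR R).
Implicit Types f g : R -> R[i].

Definition eps (n : nat) : R := (n.+1%:R)^-1.

Lemma ae_neq (a : R) : {ae mu, forall x : R, x != a}.
Proof.
exists [set a]; split; [exact: measurable_set1|exact: lebesgue_measure_set1|].
by move=> x /= /negP; rewrite negbK => /eqP.
Qed.

Lemma eps_gt0 n : 0 < eps n.
Proof. by rewrite invr_gt0. Qed.

Lemma eps_cvg0 : eps n @[n --> \oo] --> (0 : R).
Proof. exact: cvg_harmonic. Qed.

Lemma ctendsR (a : nat -> R) (l : R) : a n @[n --> \oo] --> l ->
  ctends (fun n => (a n)%:C) l%:C.
Proof. by move=> al; apply: ctends_cvg => //=; exact: cvg_cst. Qed.

Lemma wt_cvg1 (c xi : R) : ctends (fun n => (wt (c * eps n) xi)%:C) 1.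
Proof.
apply: ctendsR; rewrite -[X in _ --> X](@expR0 R).
apply: (continuous_cvg _ (@continuous_expR R 0)).
rewrite -oppr0; apply: cvgN; rewrite -(mul0r `|xi|); apply: cvgM; last exact: cvg_cst.
by apply: cvgZ0; exact: eps_cvg0.
Qed.

Lemma wtM (e d xi : R) : wt e xi * wt d xi = wt (e + d) xi.
Proof. by rewrite /wt -expRD; congr expR; ring. Qed.

(** The transform of [f] is bounded, so its product with an integrable weight is in L^2. [schur]
    bounds the norm uniformly in the weight, and Fatou removes the weight. *)
Lemma plancherel_le f : cinteg f -> L2 f ->
  L2 (ft f) /\ N2 (ft f) <= 2 * pi * N2 f.
Proof.
move=> fi Lf; have mf := cmeas_ft fi; pose C := \int[mu]_x nc (f x).
have fC xi : nc (ft f xi) <= C by exact: normc_ft.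
have C0 : 0 <= C by apply: le_trans (fC 0); exact: normc_ge0.
(* The exponent is halved because the weight gets squared: [wt (e / 2) ^ 2 = wt e]. *)
have en n : 0 < 2^-1 * eps n by rewrite mulr_gt0// ?invr_gt0// eps_gt0.
have Lk n : L2 (fun xi => (wt (2^-1 * eps n) xi)%:C * ft f xi).
  have iw : mu.-integrable setT (fun xi => (C ^+ 2 * wt (2^-1 * eps n) xi)%:E).
    by under eq_fun do rewrite EFinM; apply: integrableZl => //; exact: integrable_wt.
  suff h xi : nc ((wt (2^-1 * eps n) xi)%:C * ft f xi) ^+ 2 <= C ^+ 2 * wt (2^-1 * eps n) xi.
    apply: (le_L2 _ iw h).1.
    by apply: cmeasM => //; apply: cmeasR; exact: measurable_wt.
  rewrite normcM exprMn mulrC normcR ger0_norm ?wt_ge0//.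
  apply: ler_pM; rewrite ?sqr_ge0//; first by rewrite ler_sqr ?nnegrE ?normc_ge0.
  by rewrite expr2 ler_piMr ?wt_ge0// wt_le1.
apply: (fatou_N2 Lk) => //.
  apply: filterE => xi; have := ctendsZ (ft f xi) (wt_cvg1 2^-1 xi).
  by rewrite mulr1; apply: ctends_ext => n; rewrite mulrC.
move=> n; apply: le_trans (schur (eps_gt0 n) fi Lf).
rewrite -abel_plancherel//; last exact: eps_gt0.
apply: le_trans (le_trans (ler_norm _) (normr_Re _)).
rewrite le_eqVlt; apply/orP; left; apply/eqP; apply: eq_Rintegral => xi _.
rewrite mul_conjc normcM exprMn normcR real_normK ?num_real// expr2 wtM.
by rewrite -mulrDl -[X in wt (X * _)](_ : 1 = _) ?mul1r ?ReIm /= ?mulr0 ?subr0//; field.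
Qed.

Lemma ctends_atan (c : R) : c != 0 ->
  2 * atan (c / eps n) @[n --> \oo] --> Num.sg c * pi.
Proof.
have pos (b : R) : 0 < b -> 2 * atan (b / eps n) @[n --> \oo] --> (pi : R).
  move=> b0; rewrite (_ : pi = 2 * (pi / 2)); last by field.
  apply: cvgM; first exact: cvg_cst.
  apply: (@cvg_comp _ _ _ (fun n => b / eps n) atan _ +oo); last exact: cvgy_atan.
  rewrite /eps; under eq_fun do rewrite invrK.
  have ny : (n.+1%:R : R) @[n --> \oo] --> +oo.
    apply/cvgryPge => A; near=> n.
    by apply: (@le_trans _ _ n%:R); [near: n; exact: nbhs_infty_ger|rewrite ler_nat].
  apply: (@cvg_comp _ _ _ (fun n : nat => n.+1%:R) (fun y : R => b * y) _ +oo _ ny).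
  exact: (gt0_cvgMry b0 (@cvg_id _ _)).
move=> c0; have [cp|cn|ce] := ltrgt0P c; last by rewrite ce eqxx in c0.
  by rewrite gtr0_sg// mul1r; exact: pos.
rewrite ltr0_sg// mulN1r.
have := pos (- c); rewrite oppr_gt0 => /(_ cn) h.
have : - (2 * atan (- c / eps n)) @[n --> \oo] --> - pi by exact: cvgN.
apply: cvg_trans; apply: near_eq_cvg; near=> m.
by rewrite mulNr atanN mulrN opprK.
Unshelve. all: by end_near. Qed.

Lemma kern_box (e a b x : R) : 0 < e -> a < b ->
  cint setT (fun y => (kern e (y - x))%:C * box a b y) =
  (2 * atan ((b - x) / e) - 2 * atan ((a - x) / e))%:C.
Proof.
move=> e0 ab; rewrite -integral_kern_itv//.
rewrite (@eq_cint _ _ (fun y => box a b y * (kern e (y - x))%:C)); last first.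
  by move=> y; rewrite mulrC.
rewrite -cint_box; apply: complex_ext => //=.
by rewrite /Rintegral integral0.
Qed.

(** Both sides of the weighted identity converge as [eps n] tends to 0. The Poisson integral [k n]
    of the box is a difference of arctangents, which tends to [2 pi] inside the interval and to 0
    outside. *)
Lemma ft_box_inner f (a b M : R) : L2 f -> a < b ->
  (forall x, box (- M) M x * f x = f x) -> cinteg f ->
  cint setT (fun xi => ft f xi * (ft (box a b) xi)^*) =
  (2 * pi)%:C * cint setT (fun x => box a b x * f x).
Proof.
move=> Lf ab fM fi.
have bi : cinteg (box a b).
  have := cinteg_box_mul a b (L2_box a b).
  by congr cinteg; apply/funext => x; rewrite box_id.
have [Lft _] := plancherel_le fi Lf.
have [Lfb _] := plancherel_le bi (L2_box a b).
have l1 : ctends (fun n => cint setT (fun xi => (wt (1 * eps n) xi)%:C * ft f xi * (ft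
  (box a b) xi)^*))
    (cint setT (fun xi => ft f xi * (ft (box a b) xi)^*)).
  apply: L2to_cint; last exact: L2J.
  apply: cvg_mult1 => //.
  - by move=> n; apply: cmeasR; exact: measurable_wt.
  - by move=> n xi; rewrite normcR ger0_norm ?wt_ge0// mul1r wt_le1// eps_gt0.
  - by move=> xi; exact: wt_cvg1.
pose k n x : R := 2 * atan ((b - x) / eps n) - 2 * atan ((a - x) / eps n).
have mk n : measurable_fun [set: R] (k n).
  have ma (c : R) : measurable_fun [set: R] (fun x => 2 * atan ((c - x) / eps n)).
    apply: measurable_funM => //.
    apply: (measurableT_comp (continuous_measurable_fun (@continuous_atan R))).
    by apply: measurable_funM => //; exact: measurable_funB.
  exact: measurable_funB.
have kb n x : `|k n x| <= 2 * pi.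
  have h (c : R) : `|2 * atan c| <= pi.
    have := atan_ltpi2 c; have := atan_gtNpi2 c; rewrite ler_norml; lra.
  by apply: le_trans (ler_normB _ _) _; have := h ((b - x) / eps n);
    have := h ((a - x) / eps n); lra.
have l2 : L2to (fun n x => (k n x)%:C * f x) (fun x => ((2 * pi)%:C * box a b x) * f x).
  apply: (@cvg_mult _ _ _ (2 * pi)) => //.
  - by move=> n; exact: cmeasR.
  - by apply: cmeasM; [exact: cmeas_cst|exact: cmeas_box].
  - by move=> n x; rewrite normcR.
  - move=> x; rewrite normcM normcR ger0_norm ?mulr_ge0 ?pi_ge0// ler_piMr ?normc_box//.
    by rewrite mulr_ge0 ?pi_ge0.
  (* At [a] and [b] the limit is [pi], half the value [2 pi] taken on the closed interval; two
     points are negligible. *)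
  - apply: filterS2 (ae_neq a) (ae_neq b) => x xa xb.
    have ax : a - x != 0 by rewrite subr_eq0 eq_sym.
    have bx : b - x != 0 by rewrite subr_eq0 eq_sym.
    have : k n x @[n --> \oo] --> (Num.sg (b - x) - Num.sg (a - x)) * pi.
      by rewrite mulrBl; apply: cvgB; exact: ctends_atan.
    move=> /ctendsR.
    rewrite (_ : ((Num.sg (b - x) - Num.sg (a - x)) * pi)%:C = (2 * pi)%:C * box a b x)//.
    rewrite boxE; have [xa'|xa'|e] := ltgtP x a; last by rewrite e eqxx in xa.
      rewrite (gtr0_sg (x := a - x)) ?subr_gt0// gtr0_sg ?subr_gt0 ?(lt_trans xa')//.
      by rewrite subrr mul0r mulr0.
    rewrite (ltr0_sg (x := a - x)) ?subr_lt0// opprK.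
    have [xb'|xb'|e] := ltgtP x b; last by rewrite e eqxx in xb.
      by rewrite gtr0_sg ?subr_gt0// mulr1.
    by rewrite ltr0_sg ?subr_lt0// addNr mul0r mulr0.
(* L^2 convergence passes to integrals against L^2 functions. As [f] vanishes off [-M, M], the box
   of that interval can be inserted at no cost. *)
have l3 := L2to_cint l2 (L2_box (- M) M).
apply: (ctends_uniq l1).
rewrite (_ : (2 * pi)%:C * _ = cint setT (fun x => (2 * pi)%:C * box a b x * f x * box
  (- M) M x)); last first.
  rewrite -cintZ; last exact: cinteg_box_mul.
  by apply: eq_cint => x; rewrite -{1}fM; ring.
apply: ctends_ext l3 => n; rewrite mul1r.
transitivity (cint setT (fun x => f x * (cint setT (fun y => (kern (eps n)
  (y - x))%:C * box a b y))^*)).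
  apply: eq_cint => x; rewrite kern_box ?eps_gt0// conjcR -/(k n x) -[in RHS]fM; ring.
rewrite -abel_plancherel ?eps_gt0//; apply: eq_cint => x; ring.
Qed.

End plancherel_limit.

(** * The Fourier transform on L^2: existence, inversion, Plancherel *)

Section L2_fourier.
Context {R : realType}.
Local Notation mu := (@lebesgue_measure R).
Local Notation RR := (measurableTypeR R).
Implicit Types f g F G : R -> R[i].

Definition trunc (n : nat) f : R -> R[i] := fun x => box (- n%:R) n%:R x * f x.

Lemma cinteg_trunc n f : L2 f -> cinteg (trunc n f).
Proof. exact: cinteg_box_mul. Qed.

Lemma L2_trunc n f : L2 f -> L2 (trunc n f).
Proof. exact: L2_box_mul. Qed.

Lemma trunc_cvg f : L2 f -> L2to (fun n => trunc n f) f.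
Proof. exact: cvg_box. Qed.

Lemma truncated_fourierE n f : truncated_fourier n f = ft (trunc n f).
Proof.
apply/funext => xi; rewrite /truncated_fourier cint_mkcond; apply: eq_cint => x.
by rewrite /trunc mulrCA.
Qed.

Lemma L2_ft_trunc n f : L2 f -> L2 (ft (trunc n f)).
Proof.
by move=> Lf; have [] := plancherel_le (cinteg_trunc n Lf) (L2_trunc n Lf).
Qed.

Lemma is_fourierP f g : is_fourier f g <-> L2 f /\ L2to (fun n => ft (trunc n f)) g.
Proof.
have L n : L2 f -> L2 g -> L2 (truncated_fourier n f \- g).
  by move=> Lf Lg; rewrite truncated_fourierE; apply: L2B => //; exact: L2_ft_trunc.
have eN : (fun n => N2 (truncated_fourier n f \- g)) =
    (fun n => N2 (fun x => ft (trunc n f) x - g x)).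
  by apply/funext => n; rewrite truncated_fourierE.
split=> [[Lf Lg h]|[Lf [_ Lg h]]].
  split; first exact: Lf.
  split; [by move=> n; exact: L2_ft_trunc|exact: Lg|].
  have h2 := (cvg_L2norm (filterE _ (fun n => L n Lf Lg))).1 h.
  by rewrite eN in h2; exact: h2.
split; [exact: Lf|exact: Lg|].
by apply/(cvg_L2norm (filterE _ (fun n => L n Lf Lg))); rewrite eN.
Qed.

Lemma fourier_L2 f g : is_fourier f g -> L2 f. Proof. by case. Qed.
Lemma fourier_L2r f g : is_fourier f g -> L2 g. Proof. by case. Qed.
Lemma fourier_L2to f g : is_fourier f g -> L2to (fun n => ft (trunc n f)) g.
Proof. by move=> /is_fourierP[]. Qed.

Lemma is_fourier_uniq f g g' : is_fourier f g -> is_fourier f g' -> aeeq g g'.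
Proof. by move=> /fourier_L2to h /fourier_L2to; exact: L2to_uniq h. Qed.

Lemma is_fourier_ex f : L2 f -> exists g, is_fourier f g.
Proof.
move=> Lf; suff [g fg] : exists g, L2to (fun n => ft (trunc n f)) g.
  by exists g; apply/is_fourierP.
apply: L2_complete => [n|e e0]; first exact: L2_ft_trunc.
have [_ _ t0] := trunc_cvg Lf.
(* With this value of [delta], the bound [2 pi (2 delta + 2 delta)] supplied by [plancherel_le] and
   [N2D] is exactly [e]. *)
have e1 : 0 < e / (2 * pi * 4) by rewrite divr_gt0// !mulr_gt0// pi_gt0.
have := t0 => /cvgrPdist_le /(_ _ e1) [N _ HN]; exists N => m n Nm Nn.
have B k : (N <= k)%N -> N2 (fun x => trunc k f x - f x) <= e / (2 * pi * 4).
  by move=> /HN /=; rewrite sub0r normrN ger0_norm// N2_ge0.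
have fi : cinteg (fun x => trunc m f x - trunc n f x).
  by apply: cintegB; exact: cinteg_trunc.
have Ld : L2 (fun x => trunc m f x - trunc n f x) by apply: L2B; exact: L2_trunc.
have [_ H] := plancherel_le fi Ld.
rewrite (@eq_N2 _ _ (ft (fun x => trunc m f x - trunc n f x))); last first.
  move=> xi; rewrite [in RHS](@eq_ft _ _ (fun x => trunc m f x + (-1) * trunc n f x)); last first.
    by move=> x; rewrite mulN1r.
  rewrite ftD ?ftZ ?mulN1r//; try exact: cinteg_trunc.
  by apply: cintegZ; exact: cinteg_trunc.
apply: le_trans H _.
rewrite (@eq_N2 _ _ (fun x => (trunc m f x - f x) + - (trunc n f x - f x))); last first.
  by move=> x; congr nc; ring.
have Lm k : L2 (fun x => trunc k f x - f x) by apply: L2B => //; exact: L2_trunc.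
have := N2D (Lm m) (L2N (Lm n)); rewrite N2N => H.
have := B _ Nm; have := B _ Nn => b1 b2.
have p0 : 0 < (2 * pi : R) by rewrite mulr_gt0// pi_gt0.
apply: (@le_trans _ _ (2 * pi * (4 * (e / (2 * pi * 4))))).
  by rewrite ler_wpM2l ?(ltW p0)//; lra.
by rewrite mulrA [leLHS]mulrC divfK// !mulf_neq0// gt_eqF// pi_gt0.
Qed.

Lemma fourierP f : L2 f -> is_fourier f (fourier f).
Proof. by move=> /is_fourier_ex[g fg]; exact: (xgetPex (fun=> 0) (ex_intro _ g fg)). Qed.

Lemma is_fourier_ae f f' g : L2 f' -> aeeq f f' -> is_fourier f g -> is_fourier f' g.
Proof.
move=> Lf' ff' fg; have Lf := fourier_L2 fg; apply/is_fourierP; split => //.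
apply: L2to_ext (fourier_L2to fg) => n xi; apply: ae_eq_cint.
- by apply: cinteg_cmeas; apply: cinteg_ek; exact: cinteg_trunc.
- by apply: cinteg_cmeas; apply: cinteg_ek; exact: cinteg_trunc.
- by apply: filterS ff' => x; rewrite /trunc => ->.
Qed.

Lemma is_fourier_aer f g g' : L2 g' -> aeeq g g' -> is_fourier f g -> is_fourier f g'.
Proof.
move=> Lg' gg' fg; apply/is_fourierP; split; first exact: fourier_L2 fg.
exact: L2to_ae (fourier_L2to fg).
Qed.

Lemma is_fourierD f g F G : is_fourier f F -> is_fourier g G ->
  is_fourier (fun x => f x + g x) (fun x => F x + G x).
Proof.
move=> fF gG; have Lf := fourier_L2 fF; have Lg := fourier_L2 gG.
apply/is_fourierP; split; first exact: L2D.
apply: L2to_ext (L2toD (fourier_L2to fF) (fourier_L2to gG)) => n xi.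
rewrite -ftD; try exact: cinteg_trunc.
by apply: eq_ft => x; rewrite /trunc mulrDr.
Qed.

Lemma is_fourierZ c f F : is_fourier f F -> is_fourier (fun x => c * f x) (fun x => c * F x).
Proof.
move=> fF; have Lf := fourier_L2 fF; apply/is_fourierP; split; first exact: L2Z.
apply: L2to_ext (L2toZ c (fourier_L2to fF)) => n xi.
rewrite -ftZ; last exact: cinteg_trunc.
by apply: eq_ft => x; rewrite /trunc mulrCA.
Qed.

Lemma is_fourierN f F : is_fourier f F -> is_fourier (fun x => - f x) (fun x => - F x).
Proof.
move=> /(is_fourierZ (-1)); congr is_fourier; apply/funext => x; exact: mulN1r.
Qed.

Lemma is_fourierB f g F G : is_fourier f F -> is_fourier g G ->
  is_fourier (fun x => f x - g x) (fun x => F x - G x).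
Proof. by move=> fF gG; apply: is_fourierD => //; exact: is_fourierN. Qed.

Lemma is_fourier0 : is_fourier (fun=> 0) (fun=> 0 : R[i]).
Proof.
have [g h] := is_fourier_ex (@L2_0 R); have := is_fourierZ 0 h.
by congr is_fourier; apply/funext => x; rewrite mul0r.
Qed.

(** The truncated transforms are stationary from rank [M] on. *)
Lemma is_fourier_ft f (M : nat) : L2 f -> (forall x, trunc M f x = f x) -> is_fourier f (ft f).
Proof.
move=> Lf fM; have e n x : (M <= n)%N -> trunc n f x = f x.
  move=> Mn; rewrite -[in RHS]fM /trunc -[in LHS](fM x) /trunc mulrA; congr (_ * _).
  rewrite !boxE; case: (boolP (- M%:R <= x <= M%:R)) => h; last by rewrite mulr0.
  suff -> : - n%:R <= x <= n%:R :> bool by rewrite mulr1.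
  have Mn' : M%:R <= n%:R :> R by rewrite ler_nat.
  by move: h; rewrite -!ler_norml => /le_trans; apply.
have [g fg] := is_fourier_ex Lf.
have Lft : L2 (ft f).
  rewrite (_ : ft f = ft (trunc M f)); first exact: L2_ft_trunc.
  by apply/funext => xi; apply: eq_ft => x; rewrite fM.
apply/is_fourierP; split; first exact: Lf.
split; [by move=> n; exact: L2_ft_trunc|exact: Lft|].
have [_ _] := L2to_cst Lft; apply: cvg_trans; apply: near_eq_cvg; near=> n.
apply: eq_N2 => xi; congr (nc (_ - _)); apply: eq_ft => x; rewrite e//.
near: n; exact: nbhs_infty_ge.
Unshelve. all: by end_near. Qed.

Lemma cint_mulC f g : cint setT (fun x => f x * g x) = cint setT (fun x => g x * f x).
Proof. by apply: eq_cint => x; rewrite mulrC. Qed.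

(** The truncations are removed one at a time, first that of [f] with [g] still truncated, then that
    of [g], each time by L^2 convergence against a fixed L^2 function. *)
Lemma is_fourier_mul f g F G : is_fourier f F -> is_fourier g G ->
  cint setT (fun x => F x * g x) = cint setT (fun x => f x * G x).
Proof.
move=> fF gG; have Lf := fourier_L2 fF; have Lg := fourier_L2 gG.
have step m : cint setT (fun x => F x * trunc m g x) = cint setT (fun x => f x * ft
  (trunc m g) x).
  apply: (ctends_uniq (L2to_cint (fourier_L2to fF) (L2_trunc m Lg))).
  apply: ctends_ext (L2to_cint (trunc_cvg Lf) (L2_ft_trunc m Lg)) => n.
  have [_ ->] := ft_mul (cinteg_trunc n Lf) (cinteg_trunc m Lg).
  exact: cint_mulC.
have h1 := L2to_cint (trunc_cvg Lg) (fourier_L2r fF).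
have h2 := L2to_cint (fourier_L2to gG) Lf.
rewrite cint_mulC [RHS]cint_mulC; apply: (ctends_uniq h1).
by apply: ctends_ext h2 => m; rewrite cint_mulC -step cint_mulC.
Qed.

Lemma is_fourier_box (a b : R) : a < b -> is_fourier (box a b) (ft (box a b)).
Proof.
move=> ab; have [n [an bn]] : exists n : nat, - n%:R <= a /\ b <= n%:R.
  exists (Num.truncn (`|a| + `|b|)).+1.
  have h := ltW (truncnS_gt (`|a| + `|b|)).
  have := ler_norm (- a); have := ler_norm b; rewrite normrN.
  have := normr_ge0 a; have := normr_ge0 b; lra.
apply: (@is_fourier_ft _ n); first exact: L2_box.
move=> x; rewrite /trunc !boxE; case: (boolP (a <= x <= b)) => [/andP[ax xb]|_].
  by rewrite (le_trans an ax) (le_trans xb bn) mulr1.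
by rewrite mulr0.
Qed.

(** [ft_box_inner] asks for bounded support; letting the truncation of [f] grow lifts this
    restriction. *)
Lemma fourier_box f F (a b : R) : a < b -> is_fourier f F ->
  cint setT (fun xi => F xi * (ft (box a b) xi)^*) =
  (2 * pi)%:C * cint setT (fun x => f x * box a b x).
Proof.
move=> ab fF; have Lf := fourier_L2 fF.
have Lb : L2 (ft (box a b)) by exact: fourier_L2r (is_fourier_box ab).
apply: (ctends_uniq (L2to_cint (fourier_L2to fF) (L2J Lb))).
apply: ctends_ext (ctendsZ _ (L2to_cint (trunc_cvg Lf) (L2_box a b))) => n.
have M x : box (- n%:R) n%:R x * trunc n f x = trunc n f x.
  by rewrite /trunc mulrA box_id.
by rewrite (ft_box_inner (L2_trunc n Lf) ab M (cinteg_trunc n Lf)) cint_mulC.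
Qed.

Lemma pi2_neq0 : (2 * pi)%:C != 0 :> R[i].
Proof. by rewrite eq_complex /= eqxx andbT gt_eqF// mulr_gt0// pi_gt0. Qed.

(** The inversion formula, conjugated so that no inverse transform has to be defined. The two
    candidates for the transform have the same integral over every interval: the multiplication
    formula moves the transform onto the box, and [fourier_box] evaluates the result. *)
Lemma is_fourier_inv f F : is_fourier f F ->
  is_fourier (fun x => (F x)^*) (fun x => (2 * pi)%:C * (f x)^*).
Proof.
move=> fF; have Lf := fourier_L2 fF; have LF := fourier_L2r fF.
have [K cK] := is_fourier_ex (L2J LF); have LK := fourier_L2r cK.
have Lr : L2 (fun x => (2 * pi)%:C * (f x)^*) by apply: L2Z; exact: L2J.
suff h : aeeq K (fun x => (2 * pi)%:C * (f x)^*) by exact: is_fourier_aer Lr h cK.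
apply: aeeq_sub0; apply: ae0_of_intervals.
  by move=> a b; apply: cinteg_box_mul; exact: L2B.
move=> a b ab; rewrite (@eq_cint _ _ (fun x => box a b x * K x -
   box a b x * ((2 * pi)%:C * (f x)^*))); last by move=> x; rewrite mulrBr.
rewrite cintB; try exact: cinteg_box_mul.
apply/eqP; rewrite subr_eq0; apply/eqP.
rewrite cint_mulC -[LHS]cint_mulC.
rewrite -[LHS](is_fourier_mul (is_fourier_box ab) cK).
transitivity ((cint setT (fun x => F x * (ft (box a b) x)^*))^*).
  rewrite -cintJ.
    by apply: eq_cint => x; rewrite conjcM conjcK mulrC.
  by apply: cinteg_mul => //; apply: L2J; exact: fourier_L2r (is_fourier_box ab).
rewrite (fourier_box ab fF) conjcM conjcR -cintJ; last by rewrite /=; apply: cinteg_mul => //;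
  exact: L2_box.
rewrite -cintZ; last by apply: cintegJ; apply: cinteg_mul => //; exact: L2_box.
by apply: eq_cint => x; rewrite conjcM boxJ; ring.
Qed.

(** The multiplication formula moves the transform from [f] to the conjugate of [G], and inversion
    evaluates it there as [2 pi] times the conjugate of [g]. *)
Lemma plancherel f g F G : is_fourier f F -> is_fourier g G ->
  cint setT (fun x => F x * (G x)^*) = (2 * pi)%:C * cint setT (fun x => f x * (g x)^*).
Proof.
move=> fF gG; rewrite (is_fourier_mul fF (is_fourier_inv gG)) -cintZ.
  by apply: eq_cint => x; rewrite mulrCA.
by apply: cinteg_mul; [exact: fourier_L2 fF|apply: L2J; exact: fourier_L2 gG].
Qed.

Lemma cint_N2 f : cint setT (fun x => f x * (f x)^*) = (N2 f)%:C.
Proof.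
rewrite /N2; under eq_cint do rewrite mul_conjc.
by apply: complex_ext => //=; rewrite /Rintegral integral0.
Qed.

Lemma plancherel_N2 f F : is_fourier f F -> N2 F = 2 * pi * N2 f.
Proof.
move=> fF; have := plancherel fF fF; rewrite !cint_N2 => /(congr1 (@complex.Re R)).
by rewrite ReIm /= mul0r subr0.
Qed.

Lemma is_fourier_surj g : L2 g -> exists f, is_fourier f g.
Proof.
move=> Lg; have [K gK] := is_fourier_ex (L2J Lg).
exists (fun x => ((2 * pi)%:C)^-1 * (K x)^*).
have := is_fourierZ ((2 * pi)%:C)^-1 (is_fourier_inv gK).
congr is_fourier; apply/funext => x; by rewrite conjcK mulKf// pi2_neq0.
Qed.

Lemma is_fourier_inj f f' F : is_fourier f F -> is_fourier f' F -> aeeq f f'.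
Proof.
move=> fF fF'; apply: aeeq_sub0; apply: N2_eq0.
  by apply: L2B; [exact: fourier_L2 fF|exact: fourier_L2 fF'].
have := plancherel_N2 (is_fourierB fF fF'); rewrite (@eq_N2 _ _ (fun=> 0)); last first.
  by move=> x; rewrite subrr.
have [_ _] := @is_fourier0; rewrite /N2 Rintegral_cst// Normc.normc0 expr0n mul0r => _.
move/esym/eqP; rewrite !mulf_eq0 pnatr_eq0/= gt_eqF ?pi_gt0//= => /eqP.
by [].
Qed.

Lemma is_fourier_cvg (f F : nat -> R -> R[i]) g G : (forall n, is_fourier (f n) (F n)) ->
  is_fourier g G -> L2to f g <-> L2to F G.
Proof.
move=> fF gG.
have e n : N2 (fun x => F n x - G x) = 2 * pi * N2 (fun x => f n x - g x).
  exact: plancherel_N2 (is_fourierB (fF n) gG).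
split=> -[L1 L2' h]; split.
- by move=> n; exact: fourier_L2r (fF n).
- exact: fourier_L2r gG.
- by under eq_fun do rewrite e; exact: cvgZ0.
- by move=> n; exact: fourier_L2 (fF n).
- exact: fourier_L2 gG.
have p0 : (2 * pi : R) != 0 by rewrite gt_eqF// mulr_gt0// pi_gt0.
have h2 : (2 * pi)^-1 * N2 (fun x => F n x - G x) @[n --> \oo] --> (0 : R) by exact: cvgZ0.
apply: cvg_trans h2; apply: near_eq_cvg; near=> n.
by rewrite /= e mulKf.
Unshelve. all: by end_near. Qed.

Lemma N2_invariant (phi : measurableTypeR R -> measurableTypeR R) f :
  measurable_fun setT phi ->
  (forall A, measurable A -> mu (phi @^-1` A) = mu A) -> L2 f ->
  L2 (fun x => f (phi x)) /\ N2 (fun x => f (phi x)) = N2 f.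
Proof.
move=> mphi inv Lf; have mf := L2_cmeas Lf.
have mfp : cmeas (fun x => f (phi x)) by exact: (cmeas_comp mphi mf).
have e : (\int[mu]_x (nc (f (phi x)) ^+ 2)%:E = \int[mu]_x (nc (f x) ^+ 2)%:E)%E.
  apply: (integral_invariant mphi inv (f := fun x => (nc (f x) ^+ 2)%:E)).
  by apply/measurable_EFinP/measurable_funX/measurable_normc.
split; last by rewrite /N2 /Rintegral e.
apply/L2P; split => //; apply/integrableP; split.
  by apply/measurable_EFinP/measurable_funX/measurable_normc.
under eq_integral do rewrite gee0_abs ?lee_fin ?sqr_ge0//.
by rewrite e; apply: integrable_lty => //; exact: L2_sqint.
Qed.

Lemma N2_shift c f : L2 f -> L2 (fun x => f (x + c)) /\ N2 (fun x => f (x + c)) = N2 f.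
Proof.
apply: N2_invariant; last exact: lebesgue_measure_shift.
exact: measurable_funD.
Qed.

Lemma N2_opp f : L2 f -> L2 (fun x => f (- x)) /\ N2 (fun x => f (- x)) = N2 f.
Proof.
by apply: N2_invariant; [exact: oppr_measurable|exact: lebesgue_measure_opp].
Qed.

Lemma is_fourierJ f F : is_fourier f F ->
  is_fourier (fun x => (f x)^*) (fun xi => (F (- xi))^*).
Proof.
move=> fF; have Lf := fourier_L2 fF; have LF := fourier_L2r fF.
apply/is_fourierP; split; first exact: L2J.
have [_ _ h] := fourier_L2to fF.
split; [by move=> n; apply: L2_ft_trunc; exact: L2J| |].
  by apply: L2J; have [] := N2_opp LF.
apply: cvg_trans h; apply: near_eq_cvg; near=> n.
have [_ <-] := N2_opp (L2B (L2_ft_trunc n Lf) LF).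
rewrite -N2J; apply: eq_N2 => xi; rewrite conjcB -ftJ; last exact: cinteg_trunc.
by congr (nc (_ - _)); apply: eq_ft => x; rewrite /trunc conjcM boxJ.
Unshelve. all: by end_near. Qed.

Lemma L2_ek eta f : L2 f -> L2 (fun x => ek x eta * f x).
Proof.
have h : {ae mu, forall x, nc (ek x eta) <= 1} by apply: filterE => x; rewrite normc_ek.
by move=> Lf; have [] := L2M (cmeas_ek eta) h Lf.
Qed.

Lemma is_fourier_mod f F eta : is_fourier f F ->
  is_fourier (fun x => ek x (- eta) * f x) (fun xi => F (xi - eta)).
Proof.
move=> fF; have Lf := fourier_L2 fF; have LF := fourier_L2r fF.
have Lm : L2 (fun x => ek x (- eta) * f x).
  exact: L2_ek.
apply/is_fourierP; split => //.
have [_ _ h] := fourier_L2to fF.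
split; [by move=> n; exact: L2_ft_trunc|by have [] := N2_shift (- eta) LF|].
apply: cvg_trans h; apply: near_eq_cvg; near=> n.
have [_ <-] := N2_shift (- eta) (L2B (L2_ft_trunc n Lf) LF).
apply: eq_N2 => xi; congr (nc (_ - _)); rewrite -ft_mod; apply: eq_ft => x.
by rewrite /trunc mulrCA.
Unshelve. all: by end_near. Qed.

End L2_fourier.

(** * The Hardy space *)

Section hardy_space.
Context {R : realType}.
Local Notation mu := (@lebesgue_measure R).
Implicit Types f g h F G H : R -> R[i].

Lemma cint0 : cint setT (fun=> 0) = 0 :> R[i].
Proof. by apply: complex_ext; rewrite /= /Rintegral integral0. Qed.

Definition neg0 F := {ae mu, forall xi : R, xi < 0 -> F xi = 0}.

Lemma L2plusP f F : is_fourier f F -> L2plus f <-> neg0 F.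
Proof.
move=> fF; have e := is_fourier_uniq (fourierP (fourier_L2 fF)) fF.
split=> [[_ h]|h]; first by apply: filterS2 e h => xi <-.
split; first exact: fourier_L2 fF.
by apply: filterS2 e h => xi ->.
Qed.

Lemma L2plus_L2 f : L2plus f -> L2 f. Proof. by case. Qed.

Lemma L2plus_ae f g : L2 g -> aeeq f g -> L2plus f -> L2plus g.
Proof.
move=> Lg fg pf; have fF := fourierP (L2plus_L2 pf).
by apply/(L2plusP (is_fourier_ae Lg fg fF)); exact/(L2plusP fF).
Qed.

Lemma L2plusD f g : L2plus f -> L2plus g -> L2plus (fun x => f x + g x).
Proof.
move=> pf pg; have fF := fourierP (L2plus_L2 pf); have gG := fourierP (L2plus_L2 pg).
apply/(L2plusP (is_fourierD fF gG)); move/(L2plusP fF): pf; move/(L2plusP gG): pg.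
by apply: filterS2 => xi h1 h2 xi0; rewrite h1// h2// addr0.
Qed.

Lemma L2plusZ c f : L2plus f -> L2plus (fun x => c * f x).
Proof.
move=> pf; have fF := fourierP (L2plus_L2 pf).
apply/(L2plusP (is_fourierZ c fF)); move/(L2plusP fF): pf.
by apply: filterS => xi h xi0; rewrite h// mulr0.
Qed.

Lemma L2plusB f g : L2plus f -> L2plus g -> L2plus (fun x => f x - g x).
Proof.
move=> pf /(L2plusZ (-1)) /(L2plusD pf); congr L2plus; apply/funext => x.
by rewrite mulN1r.
Qed.

(** [ek x (- eta)] is [e^{i x eta}]; multiplication by it moves the spectrum to the right by
    [eta]. *)
Lemma L2plus_ek eta f : 0 <= eta -> L2plus f -> L2plus (fun x => ek x (- eta) * f x).
Proof.
move=> eta0 pf; have fF := fourierP (L2plus_L2 pf).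
apply/(L2plusP (is_fourier_mod eta fF)); move/(L2plusP fF): pf => [N [mN N0 sN]].
exists ((fun xi => xi + - eta) @^-1` N); split.
- have mc : measurable_fun setT (fun x : measurableTypeR R => x - eta : measurableTypeR R).
    exact: measurable_funB.
  by rewrite -[X in measurable X]setTI; exact: mc.
- by rewrite lebesgue_measure_shift.
- move=> xi /= h; apply: sN => /= h'; apply: h => xi0; apply: h'.
  by rewrite subr_lt0 (lt_le_trans xi0).
Qed.

Lemma pos0_orth f k F K : is_fourier f F -> is_fourier k K -> neg0 F ->
  {ae mu, forall xi : R, 0 <= xi -> K xi = 0} -> cint setT (fun x => f x * (k x)^*) = 0.
Proof.
move=> fF kK F0 K0; apply: (mulfI (@pi2_neq0 R)); rewrite mulr0 -(plancherel fF kK).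
rewrite (@ae_eq_cint _ _ (fun=> 0)).
- by apply: complex_ext; rewrite /= /Rintegral integral0.
- apply: cmeasM; first exact: L2_cmeas (fourier_L2r fF).
  by apply: cmeasJ; exact: L2_cmeas (fourier_L2r kK).
- exact: cmeas_cst.
- apply: filterS2 F0 K0 => xi F0 K0; have [xi0|xi0] := ltP xi 0.
    by rewrite F0// mul0r.
  by rewrite K0// conjc0 mulr0.
Qed.

Definition chi (xi : R) : R[i] := (\1_`[0%R, +oo[ xi)%:C.

Lemma chiE xi : chi xi = if 0 <= xi then 1 else 0.
Proof.
rewrite /chi indicE; case: ifPn => h; first by rewrite mem_set//= in_itv/= h.
by rewrite memNset//= in_itv/= andbT; exact/negP.
Qed.

Lemma cmeas_chi : cmeas chi.
Proof. by apply: cmeasR; exact: measurable_indic. Qed.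

Lemma normc_chi xi : nc (chi xi) <= 1.
Proof. by rewrite chiE; case: ifP; rewrite ?Normc.normc0 ?Normc.normc1. Qed.

Lemma L2_chi F : L2 F -> L2 (fun xi => chi xi * F xi).
Proof. by move=> LF; have [] := L2M cmeas_chi (filterE _ normc_chi) LF. Qed.

Lemma L2innerE f g : L2inner f g = cint setT (fun x => f x * (g x)^*).
Proof. by []. Qed.

(** The function whose transform is [chi F] has the property defining [Pi_plus], so [xget] does
    return a solution. Two solutions differ by an element of the Hardy space orthogonal to
    itself. *)
Lemma Pi_plus_fourier f F : is_fourier f F -> is_fourier (Pi_plus f) (fun xi => chi xi * F xi).
Proof.
move=> fF; have Lf := fourier_L2 fF; have LF := fourier_L2r fF.
have [h hH] := is_fourier_surj (L2_chi LF); have Lh := fourier_L2 hH.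
have ph : L2plus h.
  by apply/(L2plusP hH); apply: filterE => xi xi0; rewrite chiE leNgt xi0 mul0r.
have orth g : L2plus g -> L2inner (f \- h) g = 0.
  move=> pg; have gG := fourierP (L2plus_L2 pg).
  rewrite L2innerE -[LHS]conjcK -cintJ; last first.
    by apply: cinteg_mul; [exact: L2B|exact/L2J/L2plus_L2].
  rewrite (@eq_cint _ _ (fun x => g x * ((f \- h) x)^*)); last first.
    by move=> x; rewrite conjcM conjcK mulrC.
  rewrite (pos0_orth gG (is_fourierB fF hH)) ?conjc0//; first exact/(L2plusP gG).
  by apply: filterE => xi xi0; rewrite chiE xi0 mul1r subrr.
have [P1 P2] : [set h | L2plus h /\ forall g, L2plus g -> L2inner (f \- h) g = 0] (Pi_plus f).
  by apply: xgetPex; exists h.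
have LP := L2plus_L2 P1.
suff e : aeeq h (Pi_plus f) by exact: is_fourier_ae LP e hH.
apply: aeeq_sub0; apply: N2_eq0; first exact: L2B.
have pd := L2plusB ph P1.
suff : cint setT (fun x => (h x - Pi_plus f x) * (h x - Pi_plus f x)^*) = 0.
  by rewrite cint_N2 => /(congr1 (@complex.Re R)).
have Ld := L2plus_L2 pd.
rewrite (@eq_cint _ _ (fun x => (f \- Pi_plus f) x * (h x - Pi_plus f x)^* -
   (f \- h) x * (h x - Pi_plus f x)^*)); last first.
  by move=> x; rewrite -mulrBl /=; congr (_ * _); ring.
rewrite cintB; last 2 first.
- by apply: cinteg_mul; [exact: L2B|exact: L2J].
- by apply: cinteg_mul; [exact: L2B|exact: L2J].
have := P2 _ pd; rewrite L2innerE => ->.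
by have := orth _ pd; rewrite L2innerE => ->; rewrite subr0.
Qed.

Lemma L2plus_Pi f : L2 f -> L2plus (Pi_plus f).
Proof.
move=> Lf; apply/(L2plusP (Pi_plus_fourier (fourierP Lf))).
by apply: filterE => xi xi0; rewrite chiE leNgt xi0 mul0r.
Qed.

Lemma L2_Pi f : L2 f -> L2 (Pi_plus f). Proof. by move=> /L2plus_Pi /L2plus_L2. Qed.

(** A relation rather than an equation with [Pi_plus], so that any convenient representative, such
    as a sum or a product, can be named as the projection. *)
Definition isP f h := [/\ L2 f, L2 h & aeeq (Pi_plus f) h].

Lemma isP_self f : L2 f -> isP f (Pi_plus f).
Proof. by move=> Lf; split => //; [exact: L2_Pi|exact: filterE]. Qed.

Lemma isP_fourier f h F H : is_fourier f F -> is_fourier h H ->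
  aeeq H (fun xi => chi xi * F xi) -> isP f h.
Proof.
move=> fF hH e; have Lf := fourier_L2 fF; have Lh := fourier_L2 hH.
split => //; apply: is_fourier_inj (Pi_plus_fourier fF) _.
by apply: is_fourier_aer e hH; exact: L2_chi (fourier_L2r fF).
Qed.

Lemma isP_rev f h F : is_fourier f F -> isP f h -> is_fourier h (fun xi => chi xi * F xi).
Proof. by move=> fF [Lf Lh e]; exact: is_fourier_ae Lh e (Pi_plus_fourier fF). Qed.

Lemma isP_uniq f h h' : isP f h -> isP f h' -> aeeq h h'.
Proof. by move=> [_ _ e1] [_ _ e2]; apply: filterS2 e1 e2 => x ->. Qed.

Lemma isP_ae f f' h : L2 f' -> aeeq f f' -> isP f h -> isP f' h.
Proof.
move=> Lf' e Pf; have [Lf Lh _] := Pf; have fF := fourierP Lf.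
apply: (isP_fourier (is_fourier_ae Lf' e fF) (isP_rev fF Pf)).
exact: filterE.
Qed.

Lemma isPD f g h k : isP f h -> isP g k -> isP (fun x => f x + g x) (fun x => h x + k x).
Proof.
move=> Pf Pg; have fF := fourierP (let: And3 L _ _ := Pf in L).
have gG := fourierP (let: And3 L _ _ := Pg in L).
apply: isP_fourier (is_fourierD fF gG) (is_fourierD (isP_rev fF Pf) (isP_rev gG Pg)) _.
by apply: filterE => xi; rewrite mulrDr.
Qed.

Lemma isPZ c f h : isP f h -> isP (fun x => c * f x) (fun x => c * h x).
Proof.
move=> Pf; have fF := fourierP (let: And3 L _ _ := Pf in L).
apply: isP_fourier (is_fourierZ c fF) (is_fourierZ c (isP_rev fF Pf)) _.
by apply: filterE => xi; rewrite mulrCA.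
Qed.

Lemma isP_id f : L2plus f -> isP f f.
Proof.
move=> pf; have fF := fourierP (L2plus_L2 pf).
apply: (isP_fourier fF fF); move/(L2plusP fF): pf.
apply: filterS => xi h; rewrite chiE; case: leP => [|/h ->]; rewrite ?mul1r ?mul0r//.
Qed.

Lemma isP_plus f h : isP f h -> L2plus h.
Proof. by move=> [Lf Lh e]; apply: L2plus_ae e _ => //; exact: L2plus_Pi. Qed.

(** The conjugate has its spectrum in the nonpositive half-line, which meets the nonnegative one at
    frequency 0 only, a null set. *)
Lemma isP_conj f : L2plus f -> isP (fun x => (f x)^*) (fun=> 0).
Proof.
move=> pf; have fF := fourierP (L2plus_L2 pf).
apply: isP_fourier (is_fourierJ fF) (@is_fourier0 R) _.
move/(L2plusP fF): pf => [N [mN N0 sN]].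
have : {ae mu, forall xi : R, - xi < 0 -> fourier f (- xi) = 0}.
  exists ((fun xi => - xi) @^-1` N); split.
  - by rewrite -[X in measurable X]setTI; exact: (@oppr_measurable R setT).
  - by rewrite lebesgue_measure_opp.
  - by move=> xi /= h; apply: sN => /= h'; exact: h.
apply: filterS2 (ae_neq 0) => xi xi0 h; rewrite chiE; case: leP => xi1; last by rewrite mul0r.
by rewrite h ?conjc0 ?mulr0// oppr_lt0 lt_def xi0.
Qed.

Lemma N2_Pi f h : isP f h -> N2 h <= N2 f.
Proof.
move=> Pf; have Lf : L2 f by case: Pf.
have fF := fourierP Lf; have hH := isP_rev fF Pf.
have p0 : 0 < (2 * pi : R) by rewrite mulr_gt0// pi_gt0.
rewrite -(ler_pM2l p0) -(plancherel_N2 fF) -(plancherel_N2 hH).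
have [_] := L2M cmeas_chi (filterE _ normc_chi) (fourier_L2r fF).
by rewrite expr1n mul1r.
Qed.

(** The transform of a real function takes conjugate values at [xi] and [- xi], so the reflected
    conjugate of its nonnegative half restores the negative half. Frequency 0 is counted twice, on a
    null set. *)
Lemma isP_real g h : (forall x, (g x)^* = g x) -> isP g h ->
  aeeq g (fun x => h x + (h x)^*).
Proof.
move=> gr Pg; have Lg : L2 g by case: Pg.
have gG := fourierP Lg; have hH := isP_rev gG Pg.
have sH := is_fourierD hH (is_fourierJ hH).
have Lr := fourier_L2r sH.
have gG' : is_fourier g (fun xi => (fourier g (- xi))^*).
  by have := is_fourierJ gG; congr is_fourier; apply/funext => x; rewrite gr.
have e := is_fourier_uniq gG gG'.
apply: (is_fourier_inj gG); apply: (is_fourier_aer (fourier_L2r gG) _ sH).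
apply: filterS2 e (ae_neq 0) => xi exi xi0; rewrite conjcM !chiE oppr_ge0.
have [x0|x0|x0] := ltgtP xi 0; last by rewrite x0 eqxx in xi0.
  by rewrite mul0r add0r conjc1 mul1r -exi.
by rewrite mul1r conjc0 mul0r addr0.
Qed.

(** The condition is applied to the part of [f] with negative spectrum: by Plancherel its pairing
    with [f] is, up to [2 pi], the squared norm of [K], which therefore vanishes. *)
Lemma L2plus_orth f : L2 f ->
  (forall k K, is_fourier k K -> {ae mu, forall xi : R, 0 <= xi -> K xi = 0} ->
     cint setT (fun x => f x * (k x)^*) = 0) -> L2plus f.
Proof.
move=> Lf orth; have fF := fourierP Lf.
pose K xi := (1 - chi xi) * fourier f xi.
have LK : L2 K.
  have := L2B (fourier_L2r fF) (L2_chi (fourier_L2r fF)).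
  by congr L2; apply/funext => xi; rewrite /K mulrBl mul1r.
have [k kK] := is_fourier_surj LK.
have K0 : {ae mu, forall xi : R, 0 <= xi -> K xi = 0}.
  by apply: filterE => xi xi0; rewrite /K chiE xi0 subrr mul0r.
have := plancherel fF kK; rewrite (orth k K kK K0) mulr0.
rewrite (@eq_cint _ _ (fun xi => K xi * (K xi)^*)); last first.
  by move=> xi; rewrite /K chiE; case: ifP => _;
    rewrite ?subrr ?subr0 ?mul0r ?mul1r ?conjc0 ?mulr0.
rewrite cint_N2 => /(congr1 (@complex.Re R)) /= /(N2_eq0 LK) h.
apply/(L2plusP fF); apply: filterS h => xi; rewrite /K chiE => h xi0.
by move: h; rewrite leNgt xi0 subr0 mul1r.
Qed.

(* The modulations [e^{i x xi} g] with [xi >= 0] stay in the Hardy space, and [f]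
   is a superposition of such exponentials. *)
Lemma L2plusM f g : L2plus f -> L2plus g -> L2 (fun x => f x * g x) ->
  (exists M : R, {ae mu, forall x, nc (g x) <= M}) -> L2plus (fun x => f x * g x).
Proof.
move=> pf pg Lfg [M gM]; apply: L2plus_orth => // k K kK K0.
have Lf := L2plus_L2 pf; have Lg := L2plus_L2 pg; have Lk := fourier_L2 kK.
have fF := fourierP Lf; set F := fourier f in fF; have LF := fourier_L2r fF.
have F0 : neg0 F by exact/(L2plusP fF).
pose G x := (g x)^* * k x.
have LG : L2 G.
  have gM' : {ae mu, forall x, nc (g x)^* <= M}.
    by apply: filterS gM => x; rewrite normc_conjc.
  by have [] := L2M (cmeasJ (L2_cmeas Lg)) gM' Lk.
have Gi : cinteg G by apply: cinteg_mul => //; exact: L2J.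
have ftG xi : 0 <= xi -> ft G xi = 0.
  move=> xi0; have pe := L2plus_ek xi0 pg.
  have := pos0_orth (fourierP (L2plus_L2 pe)) kK _ K0.
  move=> /(_ ((L2plusP (fourierP (L2plus_L2 pe))).1 pe)) /(congr1 (@conjc R)).
  rewrite conjc0 -cintJ; last by apply: cinteg_mul; [exact: L2plus_L2|exact: L2J].
  move=> <-; apply: eq_cint => x.
  by rewrite !conjcM conjcK /G mulrA -ekNr opprK.
have FJ := is_fourier_inv fF; have h := L2to_cint (fourier_L2to FJ) LG.
(* The truncated transforms of the conjugate of [F] approximate [2 pi] times the conjugate of [f].
   Once the transform is moved to [G], the product vanishes at every frequency: [F] is zero on the
   negative ones and [ft G] on the others. *)
have z : cint setT (fun x => (2 * pi)%:C * (f x)^* * G x) = 0.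
  apply: (ctends_uniq h); apply: ctends_ext (ctends_cst 0) => n; apply/esym.
  rewrite cint_mulC.
  have [_ ->] := ft_mul Gi (cinteg_trunc n (L2J LF)).
  rewrite (@ae_eq_cint _ _ (fun=> 0)).
  - by apply: complex_ext; rewrite /= /Rintegral integral0.
  - apply: cmeasM; last exact: cmeas_ft.
    by apply: cinteg_cmeas; apply: cinteg_trunc; exact: L2J.
  - exact: cmeas_cst.
  - apply: filterS F0 => xi F0; have [xi0|xi0] := ltP xi 0.
      by rewrite /trunc F0// conjc0 mulr0 mul0r.
    by rewrite ftG// mulr0.
apply: (mulfI (@pi2_neq0 R)); rewrite mulr0 -[RHS]conjc0 -z -cintJ; last first.
  by apply: cinteg_mul => //; apply: L2Z; exact: L2J.
rewrite -cintZ; last by apply: cinteg_mul => //; exact: L2J.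
by apply: eq_cint => x; rewrite /G !conjcM !conjcK conjcR; ring.
Qed.

End hardy_space.

(** * Weak derivatives and Sobolev spaces *)

Section weak_derivative.
Context {R : realType}.
Local Notation mu := (@lebesgue_measure R).
Implicit Types f g h F G H : R -> R[i].

Lemma test_function_C0 (phi : R -> R) : test_function phi -> continuous phi.
Proof.
by move=> [d _ _] x; apply: differentiable_continuous; exact/derivable1_diffP.
Qed.

Lemma compact_support_bound (psi : R -> R) (N : nat) : continuous psi ->
  (forall x, N%:R < `|x| -> psi x = 0) -> exists C : R, forall x, `|psi x| <= C.
Proof.
move=> c z.
have N1 : - N%:R <= N%:R :> R by rewrite -subr_ge0 opprK addr_ge0.
have cn : {within `[- N%:R, N%:R], continuous (fun x => `|psi x|)}.
  apply: continuous_subspaceT => x.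
  by apply: (continuous_comp (c x)); exact: norm_continuous.
have [x0 _ hx0] := EVT_max N1 cn; exists `|psi x0| => x.
have [xN|xN] := ltP N%:R `|x|; first by rewrite z// normr0.
by apply: hx0; rewrite in_itv/= -ler_norml.
Qed.

Lemma test_function_bound (phi : R -> R) : test_function phi ->
  exists N : nat, [/\ forall x, N%:R < `|x| -> phi x = 0,
    forall x, N%:R < `|x| -> phi^`()%classic x = 0 &
    exists C : R, forall x, `|phi x| <= C /\ `|phi^`()%classic x| <= C].
Proof.
move=> tp; have [d c [M hM]] := tp; have c0 := test_function_C0 tp.
pose N := (Num.truncn `|M|).+1.
have MN : M < N%:R by apply: le_lt_trans (ler_norm M) (truncnS_gt _).
have z1 x : N%:R < `|x| -> phi x = 0 by move=> h; apply: hM; exact: lt_trans h.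
have z2 x : N%:R < `|x| -> phi^`()%classic x = 0.
  move=> h; rewrite derive1E (@near_eq_derive _ _ _ _ (cst 0)) ?derive_cst//.
  apply/nbhs_ballP; exists (`|x| - N%:R) => /=; first by rewrite subr_gt0.
  move=> y; rewrite /ball/= => xy; apply: z1.
  have := ler_normD (x - y) y; rewrite subrK; move: xy.
  by rewrite ltrBrDl => h1 h2; have := lt_le_trans h1 h2; lra.
have [C1 h1] := compact_support_bound c0 z1; have [C2 h2] := compact_support_bound c z2.
exists N; split; [exact: z1|exact: z2|exists (Num.max C1 C2) => x].
by rewrite !le_max h1 h2 orbT.
Qed.

Lemma test_functionM (phi psi : R -> R) : test_function phi ->
  (forall x, derivable psi x 1) -> continuous psi^`()%classic ->
  test_function (fun x => phi x * psi x) /\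
  forall x, (fun x => phi x * psi x)^`()%classic x =
    phi^`()%classic x * psi x + phi x * psi^`()%classic x.
Proof.
move=> tp ds cs; have [d c [M hM]] := tp; have c0 := test_function_C0 tp.
have cs0 : continuous psi.
  by move=> x; apply: differentiable_continuous; exact/derivable1_diffP.
have e x : (fun x => phi x * psi x)^`()%classic x =
    phi^`()%classic x * psi x + phi x * psi^`()%classic x.
  rewrite !derive1E deriveM//= /GRing.scale/= addrC; congr (_ + _); exact: mulrC.
split; last exact: e.
split.
- by move=> x; exact: derivableM.
- rewrite (_ : (fun x => phi x * psi x)^`()%classic =
    fun x => phi^`()%classic x * psi x + phi x * psi^`()%classic x); last exact/funext.
  move=> x; apply: cvgD; apply: cvgM; [exact: c|exact: cs0|exact: c0|exact: cs].
- by exists M => x xM; rewrite hM// mul0r.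
Qed.

Lemma test_function_int0 (phi : R -> R) : test_function phi ->
  \int[mu]_x phi^`()%classic x = 0.
Proof.
move=> tp; have [d c _] := tp; have c0 := test_function_C0 tp.
have [N [z1 z2 _]] := test_function_bound tp.
have N1 : - N.+1%:R < N.+1%:R :> R by rewrite -subr_gt0 opprK addr_gt0// ltr0n.
have zN : phi N.+1%:R = 0 by apply: z1; rewrite ger0_norm// ltr_nat.
have zmN : phi (- N.+1%:R) = 0 by apply: z1; rewrite normrN ger0_norm// ltr_nat.
transitivity (\int[mu]_(x in `[- N.+1%:R, N.+1%:R]) phi^`()%classic x).
  rewrite [RHS]Rintegral_mkcond; apply: eq_Rintegral => x _; rewrite patchE.
  case: ifPn => // xN; apply: z2; rewrite ltNge; apply: contra xN => xN.
  rewrite inE/= in_itv/= -ler_norml (le_trans xN)// ler_nat//.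
have cw : {within `[- N.+1%:R, N.+1%:R], continuous phi^`()%classic}.
  exact: continuous_subspaceT.
have dw : derivable_oo_LRcontinuous phi (- N.+1%:R) N.+1%:R.
  split; [by move=> x _; exact: d|exact: cvg_at_right_filter (c0 _)|].
  exact: cvg_at_left_filter (c0 _).
by rewrite /Rintegral (continuous_FTC2 N1 cw dw (fun x _ => erefl)) zN zmN subee.
Qed.

Section test.
Variables (phi : R -> R) (tphi : test_function phi).
Local Notation phi' := (phi^`()%classic).

Lemma measurable_test : measurable_fun [set: R] phi.
Proof. by apply: continuous_measurable_fun; exact: test_function_C0. Qed.

Lemma measurable_test' : measurable_fun [set: R] phi'.
Proof. by apply: continuous_measurable_fun; case: tphi. Qed.

Lemma L2_testM f : L2 f -> L2 (fun x => (phi x)%:C * f x).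
Proof.
move=> Lf; have [N [_ _ [C hC]]] := test_function_bound tphi.
have b : {ae mu, forall x, nc ((phi x)%:C : R[i]) <= C}.
  by apply: filterE => x; rewrite normcR; have [] := hC x.
by have [] := L2M (cmeasR measurable_test) b Lf.
Qed.

Lemma L2_testM' f : L2 f -> L2 (fun x => (phi' x)%:C * f x).
Proof.
move=> Lf; have [N [_ _ [C hC]]] := test_function_bound tphi.
have b : {ae mu, forall x, nc ((phi' x)%:C : R[i]) <= C}.
  by apply: filterE => x; rewrite normcR; have [] := hC x.
by have [] := L2M (cmeasR measurable_test') b Lf.
Qed.

Lemma test_trunc f : exists N, forall x, trunc N (fun x => (phi x)%:C * f x) x = (phi x)%:C * f x.
Proof.
have [N [z _ _]] := test_function_bound tphi; exists N => x.
rewrite /trunc boxE -ler_norml; case: leP => h; rewrite ?mul1r// z//.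
by rewrite !mul0r.
Qed.

Lemma test_trunc' f : exists N, forall x, trunc N (fun x => (phi' x)%:C * f x) x =
  (phi' x)%:C * f x.
Proof.
have [N [_ z _]] := test_function_bound tphi; exists N => x.
rewrite /trunc boxE -ler_norml; case: leP => h; rewrite ?mul1r// z//.
by rewrite !mul0r.
Qed.

Lemma cinteg_testM f : L2 f -> cinteg (fun x => (phi x)%:C * f x).
Proof.
move=> Lf; have [N e] := test_trunc f.
by have := cinteg_trunc N (L2_testM Lf); congr cinteg; apply/funext.
Qed.

Lemma cinteg_testM' f : L2 f -> cinteg (fun x => (phi' x)%:C * f x).
Proof.
move=> Lf; have [N e] := test_trunc' f.
by have := cinteg_trunc N (L2_testM' Lf); congr cinteg; apply/funext.
Qed.

Lemma continuous_sin_mul (xi : R) : continuous (fun x : R => sin (x * xi)).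
Proof.
move=> x; apply: differentiable_continuous; apply/derivable1_diffP.
by apply: ex_derive.
Qed.

Lemma continuous_cos_mul (xi : R) : continuous (fun x : R => cos (x * xi)).
Proof.
move=> x; apply: differentiable_continuous; apply/derivable1_diffP.
by apply: ex_derive.
Qed.

Lemma test_cos xi : test_function (fun x => phi x * cos (x * xi)) /\
  forall x, (fun x => phi x * cos (x * xi))^`()%classic x =
    phi' x * cos (x * xi) + phi x * - (xi * sin (x * xi)).
Proof.
have dc (x : R) : is_derive x 1 (fun x => cos (x * xi)) (- (xi * sin (x * xi))).
  by apply: is_derive_eq; rewrite /GRing.scale/=; ring.
have e : (fun x => cos (x * xi))^`()%classic = (fun x => - (xi * sin (x * xi))).
  by apply/funext => x; rewrite derive1E; have [_] := dc x.
have [] := @test_functionM phi (fun x => cos (x * xi)) tphi.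
- by move=> x; have [] := dc x.
- rewrite e => x; apply: cvgN; apply: cvgM; first exact: cvg_cst.
  exact: continuous_sin_mul.
by rewrite e => t h; split.
Qed.

Lemma test_sin xi : test_function (fun x => phi x * sin (x * xi)) /\
  forall x, (fun x => phi x * sin (x * xi))^`()%classic x =
    phi' x * sin (x * xi) + phi x * (xi * cos (x * xi)).
Proof.
have dc (x : R) : is_derive x 1 (fun x => sin (x * xi)) (xi * cos (x * xi)).
  by apply: is_derive_eq; rewrite /GRing.scale/=; ring.
have e : (fun x => sin (x * xi))^`()%classic = (fun x => xi * cos (x * xi)).
  by apply/funext => x; rewrite derive1E; have [_] := dc x.
have [] := @test_functionM phi (fun x => sin (x * xi)) tphi.
- by move=> x; have [] := dc x.
- rewrite e => x; apply: cvgM; first exact: cvg_cst.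
  exact: continuous_cos_mul.
by rewrite e => t h; split.
Qed.

(* The weak derivative tested against [phi(x) e^{- i x xi}]. *)
Lemma weak_derivative_ft f h xi : cinteg (fun x => (phi x)%:C * f x) ->
  cinteg (fun x => (phi' x)%:C * f x) -> cinteg (fun x => (phi x)%:C * h x) ->
  is_weak_derivative f h ->
  ft (fun x => (phi' x)%:C * f x) xi =
  'i%C * xi%:C * ft (fun x => (phi x)%:C * f x) xi - ft (fun x => (phi x)%:C * h x) xi.
Proof.
move=> j1 j2 j3 w; have [tc ec] := test_cos xi; have [ts es] := test_sin xi.
pose c x : R[i] := (cos (x * xi))%:C; pose s x : R[i] := (sin (x * xi))%:C.
have ekE x : ek x xi = c x - 'i%C * s x.
  by rewrite /ek /c /s; apply: complex_ext; rewrite !ReIm /=; ring.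
have Mc x : nc (c x) <= 1 by rewrite normcR cos_max.
have Ms x : nc (s x) <= 1 by rewrite normcR sin_max.
have mc : cmeas c.
  by apply: cmeasR; apply: continuous_measurable_fun; exact: continuous_cos_mul.
have ms : cmeas s.
  by apply: cmeasR; apply: continuous_measurable_fun; exact: continuous_sin_mul.
have i1 p : cinteg p -> cinteg (fun x => c x * p x) by apply: (@cintegMl _ _ _ 1).
have i2 p : cinteg p -> cinteg (fun x => s x * p x) by apply: (@cintegMl _ _ _ 1).
pose A := cint setT (fun x => c x * ((phi' x)%:C * f x)).
pose B := cint setT (fun x => s x * ((phi' x)%:C * f x)).
pose C := cint setT (fun x => c x * ((phi x)%:C * f x)).
pose D := cint setT (fun x => s x * ((phi x)%:C * f x)).
pose E := cint setT (fun x => c x * ((phi x)%:C * h x)).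
pose F := cint setT (fun x => s x * ((phi x)%:C * h x)).
have split_ft (p : R -> R[i]) : cinteg (fun x => c x * p x) -> cinteg (fun x => s x * p x) ->
    ft p xi = cint setT (fun x => c x * p x) - 'i%C * cint setT (fun x => s x * p x).
  move=> ip iq; rewrite -cintZ// -cintB//; last exact: cintegZ.
  by apply: eq_cint => x; rewrite ekE; ring.
rewrite !split_ft; [|exact: i1|exact: i2|exact: i1|exact: i2|exact: i1|exact: i2].
rewrite -/A -/B -/C -/D -/E -/F.
have h1 : A - xi%:C * D = - E.
  transitivity (cint setT (fun x => ((fun x => phi x * cos (x * xi))^`()%classic x)%:C * f x)).
    rewrite -cintZ; last exact: i2.
    rewrite -cintB; [|exact: i1|by apply: cintegZ; exact: i2].
    apply: eq_cint => x; rewrite ec /c /s; apply: complex_ext; rewrite !ReIm /=; ring.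
  rewrite (w _ tc); congr (- _); apply: eq_cint => x.
  by rewrite /c; apply: complex_ext; rewrite !ReIm /=; ring.
have h2 : B + xi%:C * C = - F.
  transitivity (cint setT (fun x => ((fun x => phi x * sin (x * xi))^`()%classic x)%:C * f x)).
    rewrite -cintZ; last exact: i1.
    rewrite -cintD; [|exact: i2|by apply: cintegZ; exact: i1].
    apply: eq_cint => x; rewrite es /c /s; apply: complex_ext; rewrite !ReIm /=; ring.
  rewrite (w _ ts); congr (- _); apply: eq_cint => x.
  by rewrite /s; apply: complex_ext; rewrite !ReIm /=; ring.
have -> : A = xi%:C * D - E by rewrite -h1; ring.
have -> : B = - F - xi%:C * C by rewrite -h2; ring.
have ii : 'i%C * 'i%C = -1 :> R[i] by rewrite -expr2 sqr_i.
apply/eqP; rewrite -subr_eq0; apply/eqP.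
transitivity ((1 + 'i%C * 'i%C) * (xi%:C * D) : R[i]); first ring.
by rewrite ii subrr mul0r.
Qed.

End test.

End weak_derivative.

(** * Weak derivatives on the Fourier side *)

Section weak_fourier.
Context {R : realType}.
Local Notation mu := (@lebesgue_measure R).
Implicit Types f g h F G H : R -> R[i].

Definition ixi (xi : R) : R[i] := 'i%C * xi%:C.

Lemma cmeas_ixi : cmeas ixi.
Proof. by apply: cmeasM; [exact: cmeas_cst|apply: cmeasR; exact: measurable_id]. Qed.

Lemma ixiJ xi : (ixi xi)^* = - ixi xi.
Proof. by apply: complex_ext; rewrite /ixi !ReIm /= ?oppr0; ring. Qed.

Lemma normc_ixi xi : nc (ixi xi) = `|xi|.
Proof.
rewrite /ixi normcM normcR (_ : nc 'i%C = 1) ?mul1r//.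
by rewrite /= expr0n expr1n add0r sqrtr1.
Qed.

Definition weak_der f h := [/\ L2 f, L2 h & is_weak_derivative f h].

Section test_transform.
Variables (phi : R -> R) (tp : test_function phi).
Local Notation phi' := (phi^`()%classic).

Lemma test_box : exists N : nat, (forall x, (phi x)%:C * box (- N%:R) N%:R x = (phi x)%:C) /\
  (forall x, (phi' x)%:C * box (- N%:R) N%:R x = (phi' x)%:C).
Proof.
have [N [z z' _]] := test_function_bound tp; exists N; split=> x;
  rewrite boxE -ler_norml; case: leP => h; rewrite ?mulr1// ?z// ?z'// mul0r//.
Qed.

Lemma L2_test : L2 (fun x => (phi x)%:C : R[i]).
Proof.
have [N [e _]] := test_box; have := L2_testM tp (L2_box (- N%:R) N%:R).
by congr L2; apply/funext.
Qed.

Lemma L2_test' : L2 (fun x => (phi' x)%:C : R[i]).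
Proof.
have [N [_ e]] := test_box; have := L2_testM' tp (L2_box (- N%:R) N%:R).
by congr L2; apply/funext.
Qed.

Lemma test_fourier : is_fourier (fun x => (phi x)%:C) (ft (fun x => (phi x)%:C)).
Proof.
have [N [e _]] := test_box; apply: (@is_fourier_ft _ _ N); first exact: L2_test.
by move=> x; rewrite /trunc mulrC e.
Qed.

Lemma test_fourier' : is_fourier (fun x => (phi' x)%:C) (ft (fun x => (phi' x)%:C)).
Proof.
have [N [_ e]] := test_box; apply: (@is_fourier_ft _ _ N); first exact: L2_test'.
by move=> x; rewrite /trunc mulrC e.
Qed.

Lemma cinteg_test : cinteg (fun x => (phi x)%:C : R[i]).
Proof.
have [N [e _]] := test_box; have := cinteg_mul L2_test (L2_box (- N%:R) N%:R).
by congr cinteg; apply/funext.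
Qed.

Lemma cinteg_test' : cinteg (fun x => (phi' x)%:C : R[i]).
Proof.
have [N [_ e]] := test_box; have := cinteg_mul L2_test' (L2_box (- N%:R) N%:R).
by congr cinteg; apply/funext.
Qed.

End test_transform.

(** The constant 1 has weak derivative 0. It is not in L^2, but [weak_derivative_ft] only asks for
    integrable products with the test function and its derivative. *)
Lemma ft_test' (phi : R -> R) xi : test_function phi ->
  ft (fun x => (phi^`()%classic x)%:C) xi = ixi xi * ft (fun x => (phi x)%:C) xi.
Proof.
move=> tp.
have w : is_weak_derivative (fun=> 1) (fun=> 0 : R[i]).
  move=> psi tpsi; have h0 := test_function_int0 tpsi.
  rewrite (@eq_cint _ _ (fun x => (psi^`()%classic x)%:C)); last by move=> x; rewrite mulr1.
  rewrite [RHS](_ : _ = 0).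
    by apply: complex_ext; [exact: h0|rewrite /= /Rintegral integral0].
  apply/eqP; rewrite oppr_eq0; apply/eqP.
  by rewrite (@eq_cint _ _ (fun=> 0)) ?cint0// => x; rewrite mulr0.
have e1 : (fun x => (phi x)%:C * 1) = (fun x => (phi x)%:C : R[i]).
  by apply/funext => x; rewrite mulr1.
have e2 : (fun x => (phi^`()%classic x)%:C * 1) = (fun x => (phi^`()%classic x)%:C : R[i]).
  by apply/funext => x; rewrite mulr1.
have e3 : (fun x => (phi x)%:C * 0) = (fun=> 0 : R[i]).
  by apply/funext => x; rewrite mulr0.
have i0 : cinteg (fun=> 0 : R[i]) by split; exact: integrable0.
have := @weak_derivative_ft _ phi tp (fun=> 1) (fun=> 0) xi.
rewrite e1 e2 e3 => /(_ (cinteg_test tp) (cinteg_test' tp) i0 w) ->.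
rewrite (_ : ft (fun=> 0) xi = 0) ?subr0//.
by rewrite /ft (@eq_cint _ _ (fun=> 0)) ?cint0// => x; rewrite mulr0.
Qed.

(** Plancherel turns both pairings with the real test function into integrals over frequencies,
    where the conjugate of the purely imaginary [ixi] supplies the minus sign. *)
Lemma is_weak_derivative_fourier f h F : is_fourier f F ->
  is_fourier h (fun xi => ixi xi * F xi) -> weak_der f h.
Proof.
move=> fF hH; have Lf := fourier_L2 fF; have Lh := fourier_L2 hH.
split => // phi tp.
have p1 := plancherel fF (test_fourier' tp); have p2 := plancherel hH (test_fourier tp).
have e : (2 * pi)%:C * cint setT (fun x => f x * (phi^`()%classic x)%:C^*) =
   - ((2 * pi)%:C * cint setT (fun x => h x * (phi x)%:C^*)).
  rewrite -p1 -p2 -cintN; last first.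
    by apply: cinteg_mul; [exact: fourier_L2r hH|apply: L2J;
      exact: fourier_L2r (test_fourier tp)].
  by apply: eq_cint => xi; rewrite ft_test'// conjcM ixiJ; ring.
apply: (mulfI (@pi2_neq0 R)); rewrite mulrN.
rewrite (@eq_cint _ _ (fun x => f x * (phi^`()%classic x)%:C^*)); last first.
  by move=> x; rewrite conjcR mulrC.
by rewrite e; congr (- (_ * _)); apply: eq_cint => x; rewrite conjcR mulrC.
Qed.

Lemma max0E (y : R) : Num.max 0 y = (y + `|y|) / 2.
Proof. by case: (leP 0 y) => h; [rewrite ger0_norm//|rewrite ltr0_norm//]; field. Qed.

Lemma continuous_max0 : continuous (fun y : R => Num.max 0 y).
Proof.
move=> y; rewrite /continuous_at; under eq_fun do rewrite max0E; rewrite max0E.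
apply: cvgM; last exact: cvg_cst.
by apply: cvgD; [exact: cvg_id|exact: norm_continuous].
Qed.

Lemma is_derive_pospart_sqr (y : R) :
  is_derive y 1 (fun y : R => Num.max 0 y ^+ 2) (2 * Num.max 0 y).
Proof.
have [y0|y0|->] := ltgtP y 0.
- have h : \forall z \near y, cst 0 z = Num.max 0 z ^+ 2.
    near=> z; have z0 : z < 0 by near: z; exact: lt_nbhsl.
    by rewrite max_l ?expr0n// ltW.
  rewrite mulr0; apply: (near_eq_is_derive h).
- have h : \forall z \near y, (fun z => z ^+ 2) z = Num.max 0 z ^+ 2.
    near=> z; have z0 : 0 < z by near: z; exact: lt_nbhsr.
    by rewrite max_r// ltW.
  apply: (near_eq_is_derive h).
  by apply: is_derive_eq; rewrite /GRing.scale/=; ring.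
pose f (y : R) : R := Num.max 0 y ^+ 2.
have d : (fun h : R => h^-1 *: ((f \o shift 0) (h *: (1 : R)) - f 0)) h @[h --> 0^'] --> (0 : R).
  apply/norm_cvg0P; apply: (@squeeze0 _ _ _ _ _ (fun h : R => `|h|)).
    near=> h; rewrite normr_ge0 andTb.
    have h0 : h != 0 by near: h; exact: nbhs_dnbhs_neq.
    rewrite /f /= maxxx expr0n subr0 addr0 /GRing.scale/= mulr1 normrM normfV.
    rewrite ler_pdivrMl ?normr_gt0// -expr2 normrX ler_sqr ?nnegrE//.
    by case: (leP 0 h) => // _; rewrite normr0.
  have : `|h| @[h --> (0 : R)] --> `|0 : R| by exact: norm_continuous.
  by rewrite normr0; apply: cvg_trans; apply: cvg_app; exact: nbhs_dnbhs.
rewrite mulr0; split; first by apply/cvg_ex; exists 0; exact: d.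
by rewrite /derive; apply/cvg_lim => //; exact: d.
Unshelve. all: by end_near. Qed.

(** The bump [(1 - (x / (N + 1))^2)_+^2]: squaring the positive part gives just the C^1 regularity
    asked of test functions. *)
Definition cutoff (N : nat) (x : R) : R := Num.max 0 (1 - (eps N * x) ^+ 2) ^+ 2.

Lemma cutoff_bounds N (x : R) : 0 <= cutoff N x <= 1.
Proof.
rewrite sqr_ge0/=; have t0 := sqr_ge0 (eps N * x).
have m1 : Num.max 0 (1 - (eps N * x) ^+ 2) <= 1 by rewrite ge_max ler01/= lerBlDr lerDl.
by rewrite expr_le1// le_max lexx.
Qed.

Lemma cutoff_sub1 N (x : R) : `|cutoff N x - 1| <= 2 * x ^+ 2 * eps N ^+ 2.
Proof.
have /andP[c0 c1] := cutoff_bounds N x; rewrite distrC ger0_norm ?subr_ge0//.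
rewrite /cutoff (_ : 2 * _ * _ = 2 * (eps N * x) ^+ 2); last by ring.
have := sqr_ge0 (eps N * x); set t := (eps N * x) ^+ 2 => t0.
by have [h|h] := leP 0 (1 - t); [nra|rewrite expr0n /=; lra].
Qed.

Lemma is_derive_cutoff N (x : R) : is_derive x 1 (cutoff N)
  (2 * Num.max 0 (1 - (eps N * x) ^+ 2) * - (2 * eps N ^+ 2 * x)).
Proof.
have d1 : is_derive x 1 (fun x : R => 1 - (eps N * x) ^+ 2) (- (2 * eps N ^+ 2 * x)).
  by apply: is_derive_eq; rewrite /GRing.scale/=; ring.
have := is_derive_pospart_sqr (1 - (eps N * x) ^+ 2) => d2.
have := @is_derive1_comp R (fun y : R => Num.max 0 y ^+ 2) (fun x : R => 1 -
  (eps N * x) ^+ 2) x _ _ d2 d1.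
by [].
Qed.

Lemma derive_cutoff N : (cutoff N)^`()%classic =
  (fun x => 2 * Num.max 0 (1 - (eps N * x) ^+ 2) * - (2 * eps N ^+ 2 * x)).
Proof. by apply/funext => x; rewrite derive1E; have [_] := is_derive_cutoff N x. Qed.

Lemma cutoff_out N (x : R) : N.+1%:R < `|x| -> 1 - (eps N * x) ^+ 2 <= 0.
Proof.
move=> Nx; rewrite subr_le0 -real_normK ?num_real// normrM ger0_norm ?(ltW (eps_gt0 N))//.
by rewrite exprn_ege1// /eps mulrC ler_pdivlMr ?mul1r ?(ltW Nx).
Qed.

Lemma cutoff_test N : test_function (cutoff N).
Proof.
split.
- by move=> x; have [] := is_derive_cutoff N x.
- rewrite derive_cutoff => x; apply: cvgM.
    apply: cvgM; first exact: cvg_cst.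
    apply: (@continuous_comp _ _ _ (fun x : R => 1 - (eps N * x) ^+ 2) (fun y => Num.max 0 y)).
      apply: differentiable_continuous; apply/derivable1_diffP.
      by apply: ex_derive.
    exact: continuous_max0.
  by apply: cvgN; apply: cvgM; [exact: cvg_cst|exact: cvg_id].
- exists N.+1%:R => x Nx; rewrite /cutoff max_l ?expr0n//; exact: cutoff_out.
Qed.

(** The derivative is [- 4 eps] times the positive part times [eps x], and both factors have modulus
    at most 1 on the support. Its uniform decay kills the term where the derivative falls on the
    cutoff. *)
Lemma cutoff_derive_bound N (x : R) : `|(cutoff N)^`()%classic x| <= 4 * eps N.
Proof.
rewrite derive_cutoff; have e0 := @eps_gt0 R N.
have [h|h] := ltP N.+1%:R `|x|.
  rewrite (max_l (cutoff_out h)) mulr0 mul0r normr0; exact: mulr_ge0 (ler0n _ 4) (ltW e0).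
rewrite normrM normrN.
have m0 : 0 <= Num.max 0 (1 - (eps N * x) ^+ 2) by rewrite le_max lexx.
have m1 : Num.max 0 (1 - (eps N * x) ^+ 2) <= 1.
  by rewrite ge_max ler01/= lerBlDr lerDl sqr_ge0.
rewrite (ger0_norm (mulr_ge0 _ m0))// normrM ger0_norm; last by rewrite mulr_ge0 ?sqr_ge0.
have ex : eps N * `|x| <= 1 by rewrite /eps mulrC ler_pdivrMr ?mul1r.
have ex0 : 0 <= eps N * `|x| by rewrite mulr_ge0 ?(ltW e0).
rewrite [leLHS](_ : _ = (4 * eps N) * (Num.max 0 (1 - (eps N * x) ^+ 2) * (eps N * `|x|)));
  last by ring.
by rewrite ler_piMr ?mulr_ge0// ?(ltW e0)// mulr_ile1.
Qed.

(** For each cutoff, [weak_derivative_ft] expresses the transform of [phi N h] as [i xi] times that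
    of [phi N f] minus that of [(phi N)' f], and the last one tends to 0 in L^2. As [i xi] is
    unbounded, the limit is taken after integration over bounded intervals. *)
Lemma fourier_weak_derivative f h F : weak_der f h -> is_fourier f F ->
  is_fourier h (fun xi => ixi xi * F xi).
Proof.
move=> [Lf Lh w] fF; have LF := fourier_L2r fF.
have hH := fourierP Lh; set H := fourier h in hH; have LH := fourier_L2r hH.
pose phi := cutoff; have tp N : test_function (phi N) by exact: cutoff_test.
have cvg_phi k : L2 k -> L2to (fun N x => (phi N x)%:C * k x) k.
  apply: cvg_mult1.
  - by move=> N; apply: cmeasR; exact: measurable_test (tp N).
  - move=> N x; rewrite normcR; have /andP[c0 c1] := cutoff_bounds N x.
    by rewrite ger0_norm.
  - move=> x; apply: ctendsR; apply/subr_cvg0/norm_cvg0P.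
    apply: (@squeeze0 _ _ _ _ _ (fun N => 2 * x ^+ 2 * (eps N * eps N))).
      by near=> N; rewrite normr_ge0 andTb -expr2; exact: cutoff_sub1.
    by apply: cvgZ0; rewrite -(mulr0 0); apply: cvgM; exact: eps_cvg0.
have cvg_phi' : L2to (fun N x => ((phi N)^`()%classic x)%:C * f x) (fun=> 0).
  apply: (@le_L2to _ _ _ (fun N => 16 * N2 f * (eps N * eps N))).
  - by move=> N; exact: L2_testM' (tp N) _ Lf.
  - exact: L2_0.
  - move=> N.
    have b : {ae mu, forall x, nc (((phi N)^`()%classic x)%:C : R[i]) <= 4 * eps N}.
      by apply: filterE => x; rewrite normcR; exact: cutoff_derive_bound.
    have [_ ] := L2M (cmeasR (measurable_test' (tp N))) b Lf.
    rewrite (@eq_N2 _ _ (fun x => ((phi N)^`()%classic x)%:C * f x - 0)); last first.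
      by move=> x; rewrite subr0.
    by rewrite (_ : _ ^+ 2 * _ = 16 * N2 f * (eps N * eps N)); last by ring.
  - by apply: cvgZ0; rewrite -(mulr0 0); apply: cvgM; exact: eps_cvg0.
have fN N k : L2 k -> is_fourier (fun x => (phi N x)%:C * k x) (ft (fun x => (phi N x)%:C * k x)).
  move=> Lk; have [M e] := test_trunc (tp N) k.
  by apply: (@is_fourier_ft _ _ M) => //; exact: L2_testM.
have fN' N : is_fourier (fun x => ((phi N)^`()%classic x)%:C * f x)
    (ft (fun x => ((phi N)^`()%classic x)%:C * f x)).
  have [M e] := test_trunc' (tp N) f.
  by apply: (@is_fourier_ft _ _ M) => //; exact: L2_testM'.
have c1 := (is_fourier_cvg (fun N => fN N f Lf) fF).1 (cvg_phi f Lf).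
have c2 := (is_fourier_cvg (fun N => fN N h Lh) hH).1 (cvg_phi h Lh).
have c3 := (is_fourier_cvg fN' (@is_fourier0 R)).1 cvg_phi'.
have mF : cmeas (fun xi => ixi xi * F xi) by apply: cmeasM; [exact: cmeas_ixi|exact: L2_cmeas].
have Lb a b : L2 (fun xi => box a b xi * ixi xi).
  have bb : {ae mu, forall xi, nc (box a b xi * ixi xi) <= Num.max `|a| `|b|}.
    apply: filterE => xi; rewrite normcM normc_ixi boxE; case: ifP => [/andP[ax xb]|_].
      rewrite Normc.normc1 mul1r; have [x0|x0] := leP 0 xi.
        by rewrite ger0_norm// le_max; apply/orP; right; exact: le_trans xb (ler_norm _).
      rewrite ltr0_norm// le_max; apply/orP; left; rewrite -(normrN a).
      by apply: le_trans (ler_norm _); rewrite lerN2.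
    by rewrite Normc.normc0 mul0r le_max normr_ge0.
  have := L2M (cmeasM (cmeas_box a b) cmeas_ixi) bb (L2_box a b) => -[+ _].
  by congr L2; apply/funext => xi; rewrite mulrAC box_id.
have ib a b : cinteg (fun xi => box a b xi * (ixi xi * F xi)).
  by have := cinteg_mul (Lb a b) LF; congr cinteg; apply/funext => xi; rewrite mulrA.
have e : aeeq H (fun xi => ixi xi * F xi).
  apply: aeeq_sub0; apply: ae0_of_intervals => [a b|a b ab].
    have := cintegB (cinteg_box_mul a b LH) (ib a b).
    by congr cinteg; apply/funext => xi; rewrite mulrBr.
  rewrite (@eq_cint _ _ (fun xi => box a b xi * H xi - box a b xi * (ixi xi * F xi))); last first.
    by move=> xi; rewrite mulrBr.
  rewrite (cintB (cinteg_box_mul a b LH) (ib a b)); apply/eqP; rewrite subr_eq0; apply/eqP.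
  have d1 := L2to_cint c1 (Lb a b); have d2 := L2to_cint c2 (L2_box a b).
  have d3 := L2to_cint c3 (L2_box a b).
  rewrite (cint_mulC (box a b)).
  rewrite [RHS](@eq_cint _ _ (fun xi => F xi * (box a b xi * ixi xi))); last first.
    by move=> xi; ring.
  apply: (ctends_uniq d2).
  have := ctendsD d1 (ctendsZ (-1) d3).
  rewrite (_ : _ + -1 * _ = cint setT (fun x => F x * (box a b x * ixi x))); last first.
    rewrite [X in -1 * X](_ : _ = 0) ?mulr0 ?addr0//.
    by rewrite (@eq_cint _ _ (fun=> 0)) ?cint0// => x; rewrite mul0r.
  apply: ctends_ext => N; have Lphi k : L2 k -> L2 (ft (fun x => (phi N x)%:C * k x)).
    by move=> Lk; exact: fourier_L2r (fN N k Lk).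
  rewrite -cintZ; last by apply: cinteg_mul; [exact: fourier_L2r (fN' N)|exact: L2_box].
  rewrite -cintD.
  - apply: eq_cint => xi; rewrite (weak_derivative_ft (tp N) xi (cinteg_testM (tp N) Lf)
    (cinteg_testM' (tp N) Lf) (cinteg_testM (tp N) Lh) w) /ixi; ring.
  - by apply: cinteg_mul; [exact: Lphi|exact: Lb].
  - by apply: cintegZ; apply: cinteg_mul; [exact: fourier_L2r (fN' N)|exact: L2_box].
exact: is_fourier_aer (ae_eq_L2 mF e LH) e hH.
Unshelve. all: by end_near. Qed.

End weak_fourier.

(** * Calculus in H^1: sup bound, Leibniz rule, projections *)

Section weak_calculus.
Context {R : realType}.
Local Notation mu := (@lebesgue_measure R).
Implicit Types f g h k F G H : R -> R[i].

Lemma weak_der_uniq f h h' : weak_der f h -> weak_der f h' -> aeeq h h'.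
Proof.
move=> w w'; have fF : is_fourier f (fourier f) by apply: fourierP; case: w.
exact: is_fourier_inj (fourier_weak_derivative w fF) (fourier_weak_derivative w' fF).
Qed.

Lemma weak_derD f f' g g' : weak_der f f' -> weak_der g g' ->
  weak_der (fun x => f x + g x) (fun x => f' x + g' x).
Proof.
move=> wf wg; have fF : is_fourier f (fourier f) by apply: fourierP; case: wf.
have gG : is_fourier g (fourier g) by apply: fourierP; case: wg.
apply: is_weak_derivative_fourier (is_fourierD fF gG) _.
have := is_fourierD (fourier_weak_derivative wf fF) (fourier_weak_derivative wg gG).
by congr is_fourier; apply/funext => xi; rewrite mulrDr.
Qed.

Lemma weak_derZ c f f' : weak_der f f' -> weak_der (fun x => c * f x) (fun x => c * f' x).
Proof.
move=> wf; have fF : is_fourier f (fourier f) by apply: fourierP; case: wf.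
apply: is_weak_derivative_fourier (is_fourierZ c fF) _.
have := is_fourierZ c (fourier_weak_derivative wf fF).
by congr is_fourier; apply/funext => xi; rewrite mulrCA.
Qed.

Lemma weak_derB f f' g g' : weak_der f f' -> weak_der g g' ->
  weak_der (fun x => f x - g x) (fun x => f' x - g' x).
Proof.
move=> wf /(weak_derZ (-1)) /(weak_derD wf); congr weak_der; apply/funext => x;
  by rewrite mulN1r.
Qed.

Lemma weak_derJ f f' : weak_der f f' ->
  weak_der (fun x => (f x)^*) (fun x => (f' x)^*).
Proof.
move=> wf; have fF : is_fourier f (fourier f) by apply: fourierP; case: wf.
apply: is_weak_derivative_fourier (is_fourierJ fF) _.
have := is_fourierJ (fourier_weak_derivative wf fF).
congr is_fourier; apply/funext => xi; rewrite conjcM ixiJ; congr (_ * _).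
by rewrite /ixi; apply: complex_ext; rewrite !ReIm /=; ring.
Qed.

Lemma weak_der_ae f g f' g' : L2 g -> L2 g' -> aeeq f g -> aeeq f' g' ->
  weak_der f f' -> weak_der g g'.
Proof.
move=> Lg Lg' e e' wf; have fF : is_fourier f (fourier f) by apply: fourierP; case: wf.
apply: is_weak_derivative_fourier (is_fourier_ae Lg e fF) _.
exact: is_fourier_ae Lg' e' (fourier_weak_derivative wf fF).
Qed.

Lemma weak_der_dx f h : weak_der f h -> weak_der f (dx f).
Proof.
move=> [Lf Lh w].
have [Ld wd] := @xgetPex _ (fun=> 0) [set h | L2 h /\ is_weak_derivative f h] (ex_intro _ h
  (conj Lh w)).
by split.
Qed.

Lemma dx_ae f h : weak_der f h -> aeeq (dx f) h.
Proof. by move=> w; exact: weak_der_uniq (weak_der_dx w) w. Qed.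

Lemma isP_der f f' h h' : weak_der f f' -> isP f h -> isP f' h' -> weak_der h h'.
Proof.
move=> wf Pf Pf'; have fF : is_fourier f (fourier f) by apply: fourierP; case: wf.
apply: is_weak_derivative_fourier (isP_rev fF Pf) _.
have := isP_rev (fourier_weak_derivative wf fF) Pf'.
by congr is_fourier; apply/funext => xi; rewrite mulrCA.
Qed.

Lemma L2plus_der f f' : weak_der f f' -> L2plus f -> L2plus f'.
Proof.
move=> wf pf; have Lf' : L2 f' by case: wf.
have := weak_der_uniq (isP_der wf (isP_id pf) (isP_self Lf')) wf.
by move=> e; exact: L2plus_ae Lf' e (L2plus_Pi Lf').
Qed.

(** The excess [(|f| - B)_+] lies pointwise below [|k n - f|] for every [n], so its norm is 0. *)
Lemma L2to_bounded (k : nat -> R -> R[i]) f (B : R) : L2to k f ->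
  (forall n x, nc (k n x) <= B) -> {ae mu, forall x, nc (f x) <= B}.
Proof.
move=> [Lk Lf kf] kB; pose g x := (Num.max 0 (nc (f x) - B))%:C : R[i].
have mg : cmeas g.
  apply: cmeasR; apply: measurable_maxr; first exact: measurable_cst.
  by apply: measurable_funB; [exact: measurable_normc (L2_cmeas Lf)|exact: measurable_cst].
have gk n x : nc (g x) <= nc (k n x - f x).
  rewrite normcR ger0_norm ?le_max ?lexx// ge_max normc_ge0/= normcB.
  apply: le_trans (le_trans (ler_norm _) (normc_lipschitz (f x) (k n x))).
  by rewrite lerB.
have gk2 n x : nc (g x) ^+ 2 <= nc (k n x - f x) ^+ 2.
  by rewrite ler_sqr ?nnegrE ?normc_ge0.
have Lg : L2 g.
  by have [] := le_L2 mg (L2_sqint (L2B (Lk 0) Lf)) (gk2 0).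
have gN n : N2 g <= N2 (fun x => k n x - f x).
  by have [] := le_L2 mg (L2_sqint (L2B (Lk n) Lf)) (gk2 n).
have g0 : aeeq g (fun=> 0).
  apply: N2_eq0 => //; apply/eqP; rewrite eq_le N2_ge0 andbT.
  rewrite -(cvg_lim (@Rhausdorff R) kf); apply: limr_ge; first exact: cvgP kf.
  exact: nearW gN.
apply: filterS g0 => x gx0; have := congr1 (fun z => nc z) gx0;
  rewrite normcR Normc.normc0 => /eqP.
rewrite normr_eq0 => /eqP gx; rewrite -subr_le0 -gx le_max lexx orbT//.
Qed.

Lemma ixi1_neq0 xi : (1 + ixi xi)^* != 0 :> R[i].
Proof.
apply/eqP => /(congr1 (fun z => Re z)); rewrite /ixi !ReIm /= mul0r mul1r => h.
have := @oner_neq0 R; rewrite -h => /eqP; apply; ring.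
Qed.

(** [|1 + i xi|^-2] is half of [kern 1], whose mass is [2 pi]; hence the constant [pi]. *)
Lemma inv_ixi1 : L2 (fun xi : R => ((1 + ixi xi)^*)^-1) /\
  N2 (fun xi : R => ((1 + ixi xi)^*)^-1) <= pi.
Proof.
have e (xi : R) : nc ((1 + ixi xi)^*)^-1 ^+ 2 = 2^-1 * kern 1 xi.
  have d := @den_gt0 R 1 ltr01 xi.
  have z2 : nc (1 + ixi xi)^* ^+ 2 = 1 ^+ 2 + xi ^+ 2.
    by rewrite normc_sqr /ixi !ReIm /=; ring.
  have z1 : nc ((1 + ixi xi)^*)^-1 ^+ 2 * nc (1 + ixi xi)^* ^+ 2 = 1.
    by rewrite -exprMn -normcM mulVf ?ixi1_neq0// Normc.normc1 expr1n.
  apply: (mulIf (lt0r_neq0 d)); rewrite -{1}z2 z1 /kern; field.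
  by rewrite -[X in X + _](expr1n _ 2) lt0r_neq0.
have m : cmeas (fun xi => ((1 + ixi xi)^*)^-1 : R[i]).
  have -> : (fun xi => ((1 + ixi xi)^*)^-1 : R[i]) =
      (fun xi => (2^-1 * kern 1 xi)%:C * (1 + ixi xi)).
    apply/funext => xi; rewrite -e -(normc_conjc (_ ^-1)) -mul_conjc conjcK -mulrA.
    have z0 : 1 + ixi xi != 0 by apply: contra (ixi1_neq0 xi) => /eqP ->; rewrite conjc0.
    by rewrite -conjc_inv conjcK mulrCA mulVf ?mulr1.
  apply: cmeasM; last by apply: cmeasD; [exact: cmeas_cst|exact: cmeas_ixi].
  apply: cmeasR; apply: measurable_funM; first exact: measurable_cst.
  exact: measurable_kern.
have ik0 : mu.-integrable setT (fun x => (kern 1 x : R)%:E).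
  apply/integrableP; split; first by apply/measurable_EFinP; exact: measurable_kern.
  under eq_integral do rewrite gee0_abs ?lee_fin ?kern_ge0//.
  by rewrite integral_kern// ltry.
have ik : mu.-integrable setT (fun x => (2^-1 * kern 1 x : R)%:E).
  by under eq_fun do rewrite EFinM; exact: integrableZl.
have le_e (xi : R) : nc ((1 + ixi xi)^*)^-1 ^+ 2 <= 2^-1 * kern 1 xi by rewrite e.
have [LL NN] := le_L2 m ik le_e; split=> //.
apply: (le_trans NN); rewrite RintegralZl// /Rintegral integral_kern//= mulrA mulVf ?mul1r//.
Qed.

(** The transform of [f] is [(1 + i xi)^-1], which is in L^2, times the transform [W] of
    [S = f + f']. Cauchy-Schwarz bounds every truncated inversion integral at every point by
    [sqrt (pi * 2 pi N2 S)], hence by [2 pi sqrt (N2 S)], and [L2to_bounded] carries the bound to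
    the limit. *)
Lemma weak_der_bound f f' : weak_der f f' ->
  {ae mu, forall x, nc (f x) <= Num.sqrt (N2 (fun x => f x + f' x))}.
Proof.
move=> wf; have Lf : L2 f by case: wf.
have Lf' : L2 f' by case: wf.
have fF : is_fourier f (fourier f) by exact: fourierP.
set F := fourier f in fF; have fF' := fourier_weak_derivative wf fF.
have LF := fourier_L2r fF; have LJF := L2J LF.
pose S := fun x => f x + f' x; have LS : L2 S := L2D Lf Lf'.
pose W xi := F xi + ixi xi * F xi.
have sW : is_fourier S W by exact: is_fourierD.
have LW := fourier_L2r sW; have LJW := L2J LW.
have [Li Ni] := inv_ixi1.
pose k n := ft (trunc n (fun x => (F x)^*)).
have kb n x : nc (k n x) <= 2 * pi * Num.sqrt (N2 S).
  rewrite /k /ft (@eq_cint _ _ (fun xi => (ek xi x * ((1 + ixi xi)^*)^-1) * trunc n (fun xi =>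
    (W xi)^*) xi)); last first.
    move=> xi; rewrite /trunc /W (_ : F xi + ixi xi * F xi = (1 + ixi xi) * F xi); last by ring.
    rewrite conjcM; have := ixi1_neq0 xi; set z := (_ + _)^* => z0.
    rewrite (_ : ek xi x / z * _ = ek xi x * (box (- n%:R) n%:R xi * (F xi)^*) * (z^-1 * z));
      last by ring.
    by rewrite mulVf ?mulr1.
  have p0 : 0 <= pi :> R by exact: pi_ge0.
  rewrite -ler_sqr ?nnegrE ?normc_ge0 ?mulr_ge0 ?sqrtr_ge0//.
  have b : {ae mu, forall xi, nc (ek xi x) <= 1} by apply: filterE => xi; rewrite normc_ek.
  have [Le Ne] := L2M (cmeas_ek x) b Li.
  apply: (le_trans (cauchy_schwarz Le (L2_trunc n LJW))).
  rewrite expr1n mul1r in Ne; have {}Ne := le_trans Ne Ni.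
  have [_ Nt] := L2M (cmeas_box (- n%:R) n%:R) (filterE _ (normc_box (- n%:R) n%:R)) LJW.
  rewrite expr1n mul1r N2J (plancherel_N2 sW) in Nt.
  apply: (le_trans (ler_pM (N2_ge0 _) (N2_ge0 _) Ne Nt)).
  rewrite [leRHS]exprMn sqr_sqrtr ?N2_ge0//.
  have := mulr_ge0 (sqr_ge0 (pi : R)) (N2_ge0 S); nra.
have kf : L2to k (fun x => (2 * pi)%:C * (f x)^*) := fourier_L2to (is_fourier_inv fF).
apply: filterS (L2to_bounded kf kb) => x.
by rewrite normcM normcR normc_conjc ger0_norm ?ler_pM2l ?mulr_ge0 ?mulr_gt0 ?pi_gt0 ?pi_ge0.
Qed.

(** By inversion the conjugate of [f] is a limit of superpositions of exponentials [e^{- i x xi}],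
    and for one exponential the Leibniz rule against [g] is [weak_derivative_ft]. The conjugate on
    the first factor is what inversion provides; [weak_derM] removes it. *)
Lemma weak_der_product f f' g g' : weak_der f f' -> weak_der g g' ->
  is_weak_derivative (fun x => (f x)^* * g x) (fun x => (f' x)^* * g x + (f x)^* * g' x).
Proof.
move=> wf wg phi tp; have Lf : L2 f by case: wf.
have Lf' : L2 f' by case: wf.
have Lg : L2 g by case: wg.
have Lg' : L2 g' by case: wg.
have fF : is_fourier f (fourier f) by exact: fourierP.
set F := fourier f in fF; have fF' := fourier_weak_derivative wf fF.
have LJF := L2J (fourier_L2r fF); have LJF' := L2J (fourier_L2r fF').
pose k n := ft (trunc n (fun x => (F x)^*)).
pose k' n := ft (trunc n (fun x => (ixi x * F x)^*)).
have kf : L2to k (fun x => (2 * pi)%:C * (f x)^*) := fourier_L2to (is_fourier_inv fF).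
have kf' : L2to k' (fun x => (2 * pi)%:C * (f' x)^*) := fourier_L2to (is_fourier_inv fF').
have Lpg := L2_testM tp Lg; have Lpg' := L2_testM tp Lg'; have Lp'g := L2_testM' tp Lg.
have c1 := L2to_cint kf Lp'g; have c2 := L2to_cint kf' Lpg.
have c3 := L2to_cint kf Lpg'.
have e : cint setT (fun x => (2 * pi)%:C * (f x)^* * ((phi^`()%classic x)%:C * g x)) =
    -1 * cint setT (fun x => (2 * pi)%:C * (f' x)^* * ((phi x)%:C * g x)) +
    -1 * cint setT (fun x => (2 * pi)%:C * (f x)^* * ((phi x)%:C * g' x)).
  apply: (ctends_uniq c1); have := ctendsD (ctendsZ (-1) c2) (ctendsZ (-1) c3).
  apply: ctends_ext => n.
  have i0 := cinteg_trunc n LJF; have i1 := cinteg_trunc n LJF'.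
  have h1 := (ft_mul (cinteg_testM' tp Lg) i0).2.
  have h2 := (ft_mul (cinteg_testM tp Lg) i1).2.
  have h3 := (ft_mul (cinteg_testM tp Lg') i0).2.
  rewrite (cint_mulC (k' n)) h2 (cint_mulC (k n)) h3 (cint_mulC (k n)) h1.
  have [wL1 wL2 w] := wg.
  have j2 := (ft_mul i1 (cinteg_testM tp Lg)).1.
  have j3 := (ft_mul i0 (cinteg_testM tp Lg')).1.
  apply: etrans (congr2 +%R (esym (cintZ (-1) j2)) (esym (cintZ (-1) j3))) _.
  apply: etrans (esym (cintD (cintegZ (-1) j2) (cintegZ (-1) j3))) _.
  apply: eq_cint => xi; rewrite (weak_derivative_ft tp xi (cinteg_testM tp Lg)
    (cinteg_testM' tp Lg) (cinteg_testM tp Lg') w).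
  by rewrite /trunc conjcM ixiJ /ixi; ring.
apply: (mulfI (@pi2_neq0 R)); rewrite mulrN.
have i1 := cinteg_mul (L2J Lf) Lp'g; have i2 := cinteg_mul (L2J Lf') Lpg.
have i3 := cinteg_mul (L2J Lf) Lpg'.
rewrite (@eq_cint _ (fun x => _ * (_ * g x)) (fun x => (f x)^* *
  ((phi^`()%classic x)%:C * g x))); last first.
  by move=> x; ring.
rewrite -(cintZ _ i1) (@eq_cint _ _ (fun x => (2 * pi)%:C * (f x)^* *
  ((phi^`()%classic x)%:C * g x))); last first.
  by move=> x; rewrite mulrA.
rewrite e !mulN1r -opprD; congr (- _).
rewrite (@eq_cint _ (fun x => _ * (f' x)^* * _) (fun x => (2 * pi)%:C * ((f' x)^* *
  ((phi x)%:C * g x)))); last by move=> x; rewrite -mulrA.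
rewrite (cintZ _ i2) (@eq_cint _ (fun x => _ * (f x)^* * _) (fun x => (2 * pi)%:C * ((f x)^* *
  ((phi x)%:C * g' x)))); last by move=> x; rewrite -mulrA.
rewrite (cintZ _ i3) -mulrDr -(cintD i2 i3); congr (_ * _).
by apply: eq_cint => x; ring.
Qed.

Lemma weak_derM f f' g g' : weak_der f f' -> weak_der g g' ->
  weak_der (fun x => f x * g x) (fun x => f' x * g x + f x * g' x).
Proof.
move=> wf wg; have [Lf Lf' _] := wf; have [Lg Lg' _] := wg.
have bf := weak_der_bound wf; have bg := weak_der_bound wg.
have [Lfg _] := L2M (L2_cmeas Lf) bf Lg; have [Lfg' _] := L2M (L2_cmeas Lf) bf Lg'.
have [Lf'g _] := L2M (L2_cmeas Lg) bg Lf'.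
split=> //.
  by apply: L2D Lfg'; move: Lf'g; congr L2; apply/funext => x; rewrite mulrC.
have := weak_der_product (weak_derJ wf) wg.
by congr is_weak_derivative; apply/funext => x; rewrite !conjcK.
Qed.

End weak_calculus.

(** * From Bessel weights to weak derivatives *)

Section sobolev.
Context {R : realType}.
Local Notation mu := (@lebesgue_measure R).
Implicit Types f g h k F G H : R -> R[i].

Lemma measurable_weight (s : R) : measurable_fun [set: R] (fun xi : R => (1 + xi ^+ 2) `^
  (s / 2)).
Proof.
apply: (measurableT_comp (measurable_powR (s / 2))).
apply: measurable_funD; first exact: measurable_cst.
exact: measurable_funX.
Qed.

Lemma le_bessel (p : R -> R[i]) (s : R) f : cmeas p ->
  (forall xi, nc (p xi) <= (1 + xi ^+ 2) `^ (s / 2)) -> sobolev s f ->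
  L2 (fun xi => p xi * fourier f xi) /\
  N2 (fun xi => p xi * fourier f xi) <= N2 (bessel s f).
Proof.
move=> mp ps [Lf Lb]; have LF := fourier_L2r (fourierP Lf).
apply: le_L2; [by apply: cmeasM => //; exact: L2_cmeas|exact: L2_sqint|] => xi.
rewrite !normcM normcR ger0_norm ?powR_ge0//.
rewrite ler_sqr ?nnegrE ?mulr_ge0 ?normc_ge0 ?powR_ge0//.
by rewrite ler_wpM2r ?normc_ge0.
Qed.

Lemma weight_ge1 (s xi : R) : 0 <= s -> 1 <= (1 + xi ^+ 2) `^ (s / 2).
Proof.
move=> s0; have x1 : 1 <= 1 + xi ^+ 2 by rewrite lerDl sqr_ge0.
by rewrite -[leLHS](powRr0 (1 + xi ^+ 2)) ler_powR// divr_ge0.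
Qed.

Lemma weight_ge_norm (s xi : R) : 1 <= s -> `|xi| <= (1 + xi ^+ 2) `^ (s / 2).
Proof.
move=> s1; have x1 : 1 <= 1 + xi ^+ 2 by rewrite lerDl sqr_ge0.
have : (1 + xi ^+ 2) `^ 2^-1 <= (1 + xi ^+ 2) `^ (s / 2).
  by rewrite ler_powR// ler_peMl// invr_ge0.
apply: le_trans; rewrite powR12_sqrt ?(le_trans ler01 x1)//.
by rewrite -sqrtr_sqr ler_sqrt ?(le_trans ler01 x1)// lerDr.
Qed.

Lemma weight_ge_sqr (s xi : R) : 2 <= s -> xi ^+ 2 <= (1 + xi ^+ 2) `^ (s / 2).
Proof.
move=> s1; have x1 : 1 <= 1 + xi ^+ 2 by rewrite lerDl sqr_ge0.
have : (1 + xi ^+ 2) `^ 1 <= (1 + xi ^+ 2) `^ (s / 2).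
  by rewrite ler_powR// ler_pdivlMr ?mul1r.
by apply: le_trans; rewrite powRr1 ?lerDr// (le_trans ler01 x1).
Qed.

Lemma pi2_ge1 : 1 <= 2 * pi :> R.
Proof. by have := @pi_ge2 R; lra. Qed.

Lemma N2_fourier_le f F : is_fourier f F -> N2 f <= N2 F.
Proof.
by move=> fF; rewrite (plancherel_N2 fF) ler_peMl ?N2_ge0// pi2_ge1.
Qed.

(** The two bounds will turn continuity of [u] in time with values in H^s into sup bounds on its
    increments. *)
Lemma sobolev_weak_der (s : R) f : 1 <= s -> sobolev s f ->
  exists f', [/\ weak_der f f', N2 f <= N2 (bessel s f) & N2 f' <= N2 (bessel s f)].
Proof.
move=> s1 sf; have [Lf Lb] := sf; have fF := fourierP Lf.
have s0 : 0 <= s by rewrite (le_trans ler01).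
have [L1 N1] : L2 (fun xi => ixi xi * fourier f xi) /\
    N2 (fun xi => ixi xi * fourier f xi) <= N2 (bessel s f).
  by apply: le_bessel => // [|xi]; [exact: cmeas_ixi|rewrite normc_ixi; exact: weight_ge_norm].
have [f' f'F] := is_fourier_surj L1; exists f'; split.
- exact: is_weak_derivative_fourier fF f'F.
- apply: le_trans (N2_fourier_le fF) _.
  have w1 (xi : R) : nc (1 : R[i]) <= (1 + xi ^+ 2) `^ (s / 2) by rewrite Normc.normc1 weight_ge1.
  have [_] := le_bessel (cmeas_cst 1) w1 sf.
  by rewrite (@eq_N2 _ _ (fourier f))// => xi; rewrite mul1r.
- exact: le_trans (N2_fourier_le f'F) N1.
Qed.

Lemma sobolev2_weak_der (s : R) f : 2 <= s -> sobolev s f ->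
  exists f' f'', weak_der f f' /\ weak_der f' f''.
Proof.
move=> s2 sf; have [Lf Lb] := sf; have fF := fourierP Lf.
have s1 : 1 <= s by apply: le_trans s2; rewrite ler1n.
have [L1 _] : L2 (fun xi => ixi xi * fourier f xi) /\
    N2 (fun xi => ixi xi * fourier f xi) <= N2 (bessel s f).
  by apply: le_bessel => // [|xi]; [exact: cmeas_ixi|rewrite normc_ixi; exact: weight_ge_norm].
have [L2 _] : L2 (fun xi => (ixi xi * ixi xi) * fourier f xi) /\
    N2 (fun xi => (ixi xi * ixi xi) * fourier f xi) <= N2 (bessel s f).
  apply: le_bessel => // [|xi]; first by apply: cmeasM; exact: cmeas_ixi.
  by rewrite normcM normc_ixi -expr2 real_normK ?num_real//; exact: weight_ge_sqr.
have [f' f'F] := is_fourier_surj L1; have [f'' f''F] := is_fourier_surj L2.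
exists f', f''; split; first exact: is_weak_derivative_fourier fF f'F.
apply: is_weak_derivative_fourier f'F _.
by move: f''F; congr is_fourier; apply/funext => xi; rewrite mulrA.
Qed.

Lemma weak_der_sobolev f f' : weak_der f f' -> sobolev 1 f.
Proof.
move=> wf; have Lf : L2 f by case: wf.
have fF := fourierP Lf; have fF' := fourier_weak_derivative wf fF.
have LF := fourier_L2r fF; have LF' := fourier_L2r fF'.
split=> //; have [ii _] := sqint2 (L2_sqint LF) (L2_sqint LF').
have mb : cmeas (bessel 1 f).
  by apply: cmeasM; [apply: cmeasR; exact: measurable_weight|exact: L2_cmeas].
have [] // := le_L2 mb ii _ => xi.
have x0 : 0 <= 1 + xi ^+ 2 by rewrite addr_ge0 ?sqr_ge0.
rewrite /bessel (normcM (ixi xi)) normc_ixi normcM normcR ger0_norm ?powR_ge0// mul1r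
  powR12_sqrt// !exprMn sqr_sqrtr//.
rewrite real_normK ?num_real//.
have := mulr_ge0 (sqr_ge0 xi) (sqr_ge0 (nc (fourier f xi)));
  have := sqr_ge0 (nc (fourier f xi)); nra.
Qed.

(** [fourier] respects differences only a.e., so the weighted transforms are compared through
    [ae_eq_L2]. *)
Lemma sobolevB (s : R) f g : sobolev s f -> sobolev s g -> sobolev s (f \- g).
Proof.
move=> [Lf Lbf] [Lg Lbg]; have Lfg := L2B Lf Lg; split; first exact: Lfg.
have e := is_fourier_uniq (is_fourierB (fourierP Lf) (fourierP Lg)) (fourierP Lfg).
apply: ae_eq_L2 (L2B Lbf Lbg); last first.
  by apply: filterS e => xi e; rewrite /bessel -mulrBr e.
apply: cmeasM; first by apply: cmeasR; exact: measurable_weight.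
exact: L2_cmeas (fourier_L2r (fourierP Lfg)).
Qed.

End sobolev.

(** * The Lax pair *)

Section lax.
Context {R : realType}.
Local Notation mu := (@lebesgue_measure R).
Local Notation I := (Complex 0 1 : R[i]).
Implicit Types b f g h k p q F G H : R -> R[i].

Lemma L2_bmul b b' h : weak_der b b' -> L2 h -> L2 (fun x => b x * h x).
Proof.
by move=> wb; have [Lb _ _] := wb; move=> /(L2M (L2_cmeas Lb) (weak_der_bound wb)) [].
Qed.

Lemma L2_mulb b b' h : weak_der b b' -> L2 h -> L2 (fun x => h x * b x).
Proof. by move=> wb /(L2_bmul wb); congr L2; apply/funext => x; rewrite mulrC. Qed.

(** A function of H^1 is bounded, as [L2plusM] requires of one factor. Consequently the outer
    operators with symbols [u] and [u'] are plain multiplications on the Hardy space. *)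
Lemma L2plus_bmul b b' h : weak_der b b' -> L2plus b -> L2plus h ->
  L2plus (fun x => b x * h x).
Proof.
move=> wb pb ph; have := L2plusM ph pb (L2_mulb wb (L2plus_L2 ph)) 
  (ex_intro (fun M : R => {ae mu, forall x, nc (b x) <= M}) _ (weak_der_bound wb)).
by congr L2plus; apply/funext => x; rewrite mulrC.
Qed.

(** Symbol and argument are given up to a.e. equality, so that nested Toeplitz operators can be
    evaluated from the inside out. *)
Lemma isP_toeplitz b c f g h : L2 b -> L2 f -> aeeq b c -> aeeq f g ->
  isP (fun x => c x * g x) h -> L2 (toeplitz b f) /\ aeeq (toeplitz b f) h.
Proof.
move=> Lb Lf bc fg P; have [Lcg Lh _] := P.
have e : aeeq (fun x => c x * g x) (fun x => b x * f x) by apply: filterS2 bc fg => x -> ->.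
have Lbf := ae_eq_L2 (cmeasM (L2_cmeas Lb) (L2_cmeas Lf)) e Lcg.
by have [_ _ e'] := isP_ae Lbf e P; split; [exact: L2_Pi|exact: e'].
Qed.

(** [h - p] keeps only the negative frequencies of [h], and conjugation reflects them. *)
Lemma isP_compl h p : isP h p -> L2plus (fun x => (h x - p x)^*).
Proof.
move=> P; have [Lh Lp _] := P; have hH := fourierP Lh; have pH := isP_rev hH P.
apply/(L2plusP (is_fourierJ (is_fourierB hH pH))); apply: filterE => xi xi0.
by rewrite chiE oppr_ge0 (ltW xi0) mul1r subrr conjc0.
Qed.

Section at_time.
Variables (u u' u'' : R -> R[i]).
Hypotheses (pu : L2plus u) (wu : weak_der u u') (wu' : weak_der u' u'').
Local Notation v := (fun x => (u x)^*).
Local Notation v' := (fun x => (u' x)^*).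
Local Notation v'' := (fun x => (u'' x)^*).

Let pu' : L2plus u'. Proof. exact: L2plus_der wu pu. Qed.
Let wv : weak_der v v'. Proof. exact: weak_derJ. Qed.
Let wv' : weak_der v' v''. Proof. exact: weak_derJ. Qed.

Lemma lax_LE h h' p : weak_der h h' -> isP (fun x => v x * h x) p ->
  L2 (lax_L u h) /\ aeeq (lax_L u h) (fun x => - I * h' x - u x * p x).
Proof.
move=> wh P; have [Lh Lh' _] := wh; have [Lu _ _] := wu.
have [LT eT] := isP_toeplitz (L2J Lu) Lh (filterE _ (fun=> erefl)) (filterE _ (fun=> erefl)) P.
have up := L2plus_bmul wu pu (isP_plus P).
have [LT2 eT2] := isP_toeplitz Lu LT (filterE _ (fun=> erefl)) eT (isP_id up).
have [_ Ld _] := weak_der_dx wh.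
split; first exact: L2B (L2Z _ Ld) LT2.
by apply: filterS2 (dx_ae wh) eT2 => x e1 e2; rewrite /lax_L /Dop /= e1 e2.
Qed.

(** The argument [k] comes with an explicit representative [h] because the lemma will be applied to
    [k = lax_L u f], which is known only a.e. *)
Lemma lax_BE h k p q r : L2 k -> aeeq k h -> isP (fun x => v x * h x) p ->
  isP (fun x => v' x * h x) q -> isP (fun x => v x * (u x * p x)) r ->
  L2 (lax_B u k) /\ aeeq (lax_B u k) (fun x => u x * q x - u' x * p x + I * (u x * r x)).
Proof.
move=> Lk kh Pp Pq Pr; have [Lu Lu' _] := wu.
have [_ Ldu _] := weak_der_dx wu; have [_ Ldv _] := weak_der_dx wv.
have [L1 e1] := isP_toeplitz Ldv Lk (dx_ae wv) kh Pq.
have [L2' e2] := isP_toeplitz Lu L1 (filterE _ (fun=> erefl)) e1 (isP_id (L2plus_bmul wu pu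
  (isP_plus Pq))).
have [L3 e3] := isP_toeplitz (L2J Lu) Lk (filterE _ (fun=> erefl)) kh Pp.
have [L4 e4] := isP_toeplitz Ldu L3 (dx_ae wu) e3 (isP_id (L2plus_bmul wu' pu' (isP_plus Pp))).
have [L5 e5] := isP_toeplitz Lu L3 (filterE _ (fun=> erefl)) e3 (isP_id (L2plus_bmul wu pu
  (isP_plus Pp))).
have [L6 e6] := isP_toeplitz (L2J Lu) L5 (filterE _ (fun=> erefl)) e5 Pr.
have [L7 e7] := isP_toeplitz Lu L6 (filterE _ (fun=> erefl)) e6 (isP_id (L2plus_bmul wu pu
  (isP_plus Pr))).
split; first exact: L2D (L2B L2' L4) (L2Z _ L7).
apply: filterS2 (filterI e2 e4) e7 => x [e2x e4x] e7x.
by rewrite /lax_B -[conjf u]/v e2x e4x e7x.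
Qed.

Lemma eq_isP f1 f2 h1 h2 : isP f1 h1 -> (forall x, f1 x = f2 x) ->
  (forall x, h1 x = h2 x) -> isP f2 h2.
Proof. by move=> P /funext <- /funext <-. Qed.

Section commutator.
Variables (f f' g : R -> R[i]).
Hypothesis (wf : weak_der f f').
Hypothesis Pg : isP (fun x => u' x * v x + u x * v' x) g.

Let Lf : L2 f. Proof. by case: wf. Qed.
Let Lf' : L2 f'. Proof. by case: wf. Qed.
Let Lu'' : L2 u''. Proof. by case: wu'. Qed.
Let P b := Pi_plus b.
(** Names for the projected products occurring in [B L f] and [L B f]. By the Leibniz rule the
    derivative of [p] is [q + m], that of [q] is [q2 + q1], and that of [r] is
    [ra + rb + rc + rd]. *)
Let p := P (fun x => v x * f x).
Let q := P (fun x => v' x * f x).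
Let m := P (fun x => v x * f' x).
Let r := P (fun x => v x * (u x * p x)).
Let q1 := P (fun x => v' x * f' x).
Let q2 := P (fun x => v'' x * f x).
Let ra := P (fun x => v' x * (u x * p x)).
Let rb := P (fun x => v x * (u' x * p x)).
Let rc := P (fun x => v x * (u x * q x)).
Let rd := P (fun x => v x * (u x * m x)).
Let re := P (fun x => v x * (u x * r x)).

Let Pp : isP (fun x => v x * f x) p. Proof. exact: isP_self (L2_bmul wv Lf). Qed.
Let Pq : isP (fun x => v' x * f x) q. Proof. exact: isP_self (L2_bmul wv' Lf). Qed.
Let Pm : isP (fun x => v x * f' x) m. Proof. exact: isP_self (L2_bmul wv Lf'). Qed.
Let Lp : L2 p. Proof. by case: Pp. Qed.
Let Lq : L2 q. Proof. by case: Pq. Qed.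
Let Lm : L2 m. Proof. by case: Pm. Qed.
Let Pr : isP (fun x => v x * (u x * p x)) r.
Proof. exact: isP_self (L2_bmul wv (L2_bmul wu Lp)). Qed.
Let Lr : L2 r. Proof. by case: Pr. Qed.
Let Pq1 : isP (fun x => v' x * f' x) q1. Proof. exact: isP_self (L2_bmul wv' Lf'). Qed.
Let Pq2 : isP (fun x => v'' x * f x) q2. Proof. exact: isP_self (L2_mulb wf (L2J Lu'')). Qed.
Let Pra : isP (fun x => v' x * (u x * p x)) ra.
Proof. exact: isP_self (L2_bmul wv' (L2_bmul wu Lp)). Qed.
Let Prb : isP (fun x => v x * (u' x * p x)) rb.
Proof. exact: isP_self (L2_bmul wv (L2_bmul wu' Lp)). Qed.
Let Prc : isP (fun x => v x * (u x * q x)) rc.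
Proof. exact: isP_self (L2_bmul wv (L2_bmul wu Lq)). Qed.
Let Prd : isP (fun x => v x * (u x * m x)) rd.
Proof. exact: isP_self (L2_bmul wv (L2_bmul wu Lm)). Qed.
Let Pre : isP (fun x => v x * (u x * r x)) re.
Proof. exact: isP_self (L2_bmul wv (L2_bmul wu Lr)). Qed.

Let wp : weak_der p (fun x => q x + m x).
Proof. exact: isP_der (weak_derM wv wf) Pp (isPD Pq Pm). Qed.

Let wq : weak_der q (fun x => q2 x + q1 x).
Proof. exact: isP_der (weak_derM wv' wf) Pq (isPD Pq2 Pq1). Qed.

Let wr : weak_der r (fun x => ra x + (rb x + (rc x + rd x))).
Proof.
apply: isP_der (weak_derM wv (weak_derM wu wp)) Pr _.
apply: (eq_isP (isPD Pra (isPD Prb (isPD Prc Prd)))) => x //; ring.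
Qed.

Let Bf := fun x => u x * q x - u' x * p x + I * (u x * r x).
Let Bf' := fun x => (u' x * q x + u x * (q2 x + q1 x)) -
  (u'' x * p x + u' x * (q x + m x)) +
  I * (u' x * r x + u x * (ra x + (rb x + (rc x + rd x)))).

Let wBf : weak_der Bf Bf'.
Proof.
exact: weak_derD (weak_derB (weak_derM wu wq) (weak_derM wu' wp)) (weak_derZ I (weak_derM wu wr)).
Qed.

Let pBf : L2plus Bf.
Proof.
apply: L2plusD (L2plusB _ _) (L2plusZ I _).
- exact: L2plus_bmul wu pu (isP_plus Pq).
- exact: L2plus_bmul wu' pu' (isP_plus Pp).
- exact: L2plus_bmul wu pu (isP_plus Pr).
Qed.

(** In each product of [Bf] both factors are in H^1 and in the Hardy space; for [u'] the first point
    is where [u] in H^2 enters. *)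
Lemma lax_B_domain : weak_der (lax_B u f) Bf' /\ L2plus (lax_B u f).
Proof.
have [LB eB] := lax_BE Lf (filterE _ (fun=> erefl)) Pp Pq Pr.
have {}eB : aeeq Bf (lax_B u f) by apply: filterS eB => x ->.
have [_ LBf' _] := wBf; split; last exact: L2plus_ae LB eB pBf.
exact: weak_der_ae LB LBf' eB (filterE _ (fun=> erefl)) wBf.
Qed.

Lemma lax_commutatorE ut k : L2 ut -> aeeq ut (fun x => I * u'' x + 2 * (u x * g x)) ->
  isP (fun x => (ut x)^* * f x) k ->
  L2 (commutator (lax_B u) (lax_L u) f) /\
  aeeq (commutator (lax_B u) (lax_L u) f) (fun x => - (ut x * p x) - u x * k x).
Proof.
move=> Lut eut Pk.
have [LL eL] := lax_LE wf Pp.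
have P1 : isP (fun x => v x * (- I * f' x - u x * p x)) (fun x => - I * m x - r x).
  by apply: (eq_isP (isPD (isPZ (- I) Pm) (isPZ (-1) Pr))) => x; ring.
have P2 : isP (fun x => v' x * (- I * f' x - u x * p x)) (fun x => - I * q1 x - ra x).
  by apply: (eq_isP (isPD (isPZ (- I) Pq1) (isPZ (-1) Pra))) => x; ring.
have P3 : isP (fun x => v x * (u x * (- I * m x - r x))) (fun x => - I * rd x - re x).
  by apply: (eq_isP (isPD (isPZ (- I) Prd) (isPZ (-1) Pre))) => x; ring.
have [LBL eBL] := lax_BE LL eL P1 P2 P3.
have P4 : isP (fun x => v x * Bf x) (fun x => rc x - rb x + I * re x).
  by apply: (eq_isP (isPD (isPD Prc (isPZ (-1) Prb)) (isPZ I Pre))) => x; rewrite ?/Bf; ring.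
have [wB pB] := lax_B_domain.
have [LB eB] := lax_BE Lf (filterE _ (fun=> erefl)) Pp Pq Pr.
have P5 : isP (fun x => v x * lax_B u f x) (fun x => rc x - rb x + I * re x).
  apply: isP_ae (L2_bmul wv LB) _ P4.
  by apply: filterS eB => x ->.
have [LLB eLB] := lax_LE wB P5.
split; first exact: L2B LBL LLB.
(* Two derivatives of [u] give [(|u|^2)'] a derivative in L^2, hence also its projection [g]. So [g]
   is bounded and multiplies the Hardy space into itself. *)
have wg : weak_der (fun x => u' x * v x + u x * v' x)
   (fun x => (u'' x * v x + u' x * v' x) + (u' x * v' x + u x * v'' x)).
  exact: weak_derD (weak_derM wu' wv) (weak_derM wu wv').
have wgp := isP_der wg Pg (isP_self (let: And3 _ L _ := wg in L)).
have Pgp := isP_plus Pg; have wgc := weak_derJ wgp.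
have Lgvf := L2_bmul wgc (L2_bmul wv Lf).
pose s := P (fun x => (g x)^* * (v x * f x)); have Ps : isP _ s := isP_self Lgvf.
have gr x : (u' x * v x + u x * v' x)^* = u' x * v x + u x * v' x.
  by rewrite conjcD !conjcM !conjcK addrC; congr (_ + _); rewrite mulrC.
have eg := isP_real gr Pg.
have Pgc : isP (fun x => (g x)^* * p x) s.
  have P0 := isP_conj (L2plus_bmul wgp Pgp (isP_compl Pp)).
  apply: (eq_isP (isPD Ps (isPZ (-1) P0))) => x; last by rewrite mulr0 addr0.
  by rewrite conjcM conjcK; ring.
have Pgp1 : isP (fun x => (u' x * v x + u x * v' x) * p x) (fun x => g x * p x + s x).
  apply: isP_ae (isPD (isP_id (L2plus_bmul wgp Pgp (isP_plus Pp))) Pgc).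
    exact: L2_bmul wg Lp.
  by apply: filterS eg => x ->; rewrite mulrDl.
have Prab : isP (fun x => (u' x * v x + u x * v' x) * p x) (fun x => ra x + rb x).
  by apply: (eq_isP (isPD Pra Prb)) => x //; ring.
have e1 := isP_uniq Pgp1 Prab.
(* The conjugate of the evolution equation reads [- i v'' + 2 v conj g]; times [f], its terms
   project to [q2] and [s]. *)
have Pk' : isP (fun x => (ut x)^* * f x) (fun x => - I * q2 x + 2 * s x).
  apply: isP_ae (isPD (isPZ (- I) Pq2) (isPZ 2 Ps)); first by case: Pk.
  apply: filterS eut => x ->.
  rewrite !(conjcD, conjcM) (_ : I^* = - I); last by apply: complex_ext; rewrite /= ?oppr0.
  by rewrite conjc1; ring.
have e2 := isP_uniq Pk Pk'.
apply: filterS2 (filterI eBL eLB) (filterI eut (filterI e1 e2)) => x [a1 a2] [a3 [a4 a5]].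
rewrite /commutator /= a1 a2 a3 a5 /Bf'.
have II : I * I = -1 by apply: complex_ext; rewrite !ReIm /=; ring.
(* After all cancellations [ra] and [rb] enter only through [- 2 u (ra + rb)], and [a4] identifies
   their sum with [g p + s]. *)
have -> : ra x = g x * p x + s x - rb x by rewrite a4; ring.
ring: II.
Qed.

End commutator.
End at_time.
End lax.

(** * The equation in projected form and the difference quotients *)

Section evolution.
Context {R : realType}.
Local Notation mu := (@lebesgue_measure R).
Local Notation I := (Complex 0 1 : R[i]).
Implicit Types f g h k p q d w F G H : R -> R[i].

Lemma sqmodE f : sqmod f = (fun x => f x * (f x)^*).
Proof. by apply/funext => x; rewrite mul_conjc. Qed.

(** On the Fourier side [|xi| = - i (i xi) (2 chi(xi) - 1)]. Added to [D f = - i f'], the resulting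
    formula for [|D| f] leaves [- 2 i g]. *)
Lemma absD_ae f f' g : weak_der f f' -> isP f' g ->
  aeeq (absD f) (fun x => - I * (2 * g x - f' x)).
Proof.
move=> wf Pg; have Lf : L2 f by case: wf.
have fF := fourierP Lf; have fF' := fourier_weak_derivative wf fF.
have hH := is_fourierZ (- I) (is_fourierB (is_fourierZ 2 (isP_rev fF' Pg)) fF').
have eH : (fun xi => - I * (2 * (chi xi * (ixi xi * fourier f xi)) - ixi xi * fourier f xi))
    = (fun xi => `|xi|%:C * fourier f xi).
  apply/funext => xi; rewrite [LHS](_ : _ = - (I * ixi xi) * (2 * chi xi - 1) * fourier f xi);
    last by ring.
  congr (_ * _); rewrite chiE; have -> : - (I * ixi xi) = xi%:C.
    by rewrite /ixi; apply: complex_ext; rewrite !ReIm /=; ring.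
  by case: leP => h; [rewrite ger0_norm//|rewrite ltr0_norm// rmorphN]; ring.
rewrite eH in hH; have Lh := fourier_L2 hH.
have e1 := is_fourier_uniq (fourierP Lh) hH.
have [Lk ek] := @xgetPex _ (fun=> 0)
  [set h | L2 h /\ aeeq (fourier h) (fun xi => `|xi|%:C * fourier f xi)] (ex_intro _ _
    (conj Lh e1)).
exact: is_fourier_inj (is_fourier_aer (fourier_L2r hH) ek (fourierP Lk)) hH.
Qed.

Lemma equation_derivative u u' u'' ut g : weak_der u u' -> weak_der u' u'' ->
  isP (fun x => u' x * (u x)^* + u x * (u' x)^*) g ->
  aeeq (fun x => I * ut x + dx (dx u) x + (Dop (sqmod u) x + absD (sqmod u) x) * u x)
    (fun=> 0) ->
  aeeq ut (fun x => I * u'' x + 2 * (u x * g x)).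
Proof.
move=> wu wu' Pg eq; have [_ Lu' _] := wu; have [_ Lu'' _] := wu'.
have [_ Ldu _] := weak_der_dx wu; have e1 := dx_ae wu.
have e1' : aeeq u' (dx u) by apply: filterS e1 => x ->.
have e0 : aeeq u'' u'' by exact: filterE.
(* The outer [dx] acts on the representative [dx u], which is only a.e. equal to [u']. *)
have e2 := dx_ae (weak_der_ae Ldu Lu'' e1' e0 wu').
have ws : weak_der (sqmod u) (fun x => u' x * (u x)^* + u x * (u' x)^*).
  by rewrite sqmodE; exact: weak_derM wu (weak_derJ wu).
have e3 := dx_ae ws; have e4 := absD_ae ws Pg.
have II : I * I = -1 by apply: complex_ext; rewrite !ReIm /=; ring.
apply: filterS2 (filterI eq e2) (filterI e3 e4) => x [a1 a2] [a3 a4].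
rewrite /Dop a2 a3 a4 in a1.
rewrite -[RHS]add0r -[X in X + _](mulr0 (- I)) -a1; ring: II.
Qed.

Lemma N2_bmul b b' h : weak_der b b' -> L2 h ->
  N2 (fun x => b x * h x) <= N2 (fun x => b x + b' x) * N2 h.
Proof.
move=> wb Lh; have [Lb _ _] := wb.
by have [_] := L2M (L2_cmeas Lb) (weak_der_bound wb) Lh; rewrite sqr_sqrtr ?N2_ge0.
Qed.

Section increment.
(** In the application [c] is [(t' - t)^-1], [u1] is [u t'], and [S] is the squared H^s norm, in the
    sense of [N2 (bessel s _)], of the increment. The local notation [d] is the error of the
    difference quotient of [u]. *)
Variables (f f' u u' u1 u1' w' ut p p' k : R -> R[i]) (c S : R).
Hypotheses (wf : weak_der f f') (pu : L2plus u) (wu : weak_der u u')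
  (pu1 : L2plus u1) (wu1 : weak_der u1 u1') (Lut : L2 ut)
  (Pp : isP (fun x => (u x)^* * f x) p) (Pk : isP (fun x => (ut x)^* * f x) k)
  (wp : weak_der p p')
  (ww : weak_der (fun x => u1 x - u x) w')
  (NS : N2 (fun x => u1 x - u x) <= S) (NS' : N2 w' <= S).
Local Notation d := (fun x => c%:C * (u1 x - u x) - ut x).

Lemma increment_bound : {ae mu, forall x, nc (u1 x - u x) <= Num.sqrt (4 * S)}.
Proof.
have [Lw Lw' _] := ww.
apply: filterS (weak_der_bound ww) => x h; apply: le_trans h _.
rewrite ler_wsqrtr//; apply: (le_trans (N2D Lw Lw')).
by move: NS NS'; lra.
Qed.

(** Up to sign, [E] is a.e. [p d + u ee + (u1 - u) ee + (u1 - u) k], with [ee] the projection of [f]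
    times the conjugate of [d]. Smallness of [d] in L^2 is paired with the boundedness of [p], [u]
    and [f], and smallness of [u1 - u] in sup norm with [ee] and [k] in L^2. Three uses of [N2D]
    give the weights 2, 8, 8 and 4; the sup bound [4 S] raises the last two to 32 and 16. *)
Lemma lax_L_increment :
  let E := fun x => c%:C * (lax_L u1 f x - lax_L u f x) - (- (ut x * p x) - u x * k x) in
  L2 E /\
  N2 E <= (2 * N2 (fun x => p x + p' x) + 8 * N2 (fun x => u x + u' x) * N2
    (fun x => f x + f' x)) * N2 d
    + 32 * N2 (fun x => f x + f' x) * (S * N2 d) + 16 * N2 k * S.
Proof.
move=> E; have [Lf Lf' _] := wf; have [Lw Lw' _] := ww.
have Lp : L2 p by case: Pp.
have Lk : L2 k by case: Pk.
have P1 := isP_self (L2_bmul (weak_derJ wu1) Lf); set p1 := Pi_plus _ in P1.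
have [LL1 e1] := lax_LE pu1 wu1 wf P1.
have [LL e] := lax_LE pu wu wf Pp.
have Ld : L2 d := L2B (L2Z c%:C Lw) Lut.
pose ee x := c%:C * (p1 x - p x) - k x.
have Pe : isP (fun x => f x * (d x)^*) ee.
  apply: (eq_isP (isPD (isPZ c%:C (isPD P1 (isPZ (-1) Pp))) (isPZ (-1) Pk))) => x.
    by rewrite conjcB conjcM conjcR conjcB; ring.
  by rewrite /ee; ring.
have Lee : L2 ee by case: Pe.
have Nee : N2 ee <= N2 (fun x => f x + f' x) * N2 d.
  apply: le_trans (N2_Pi Pe) _; apply: le_trans (N2_bmul wf (L2J Ld)) _.
  by rewrite N2J.
have LE : L2 E.
  apply: L2B (L2Z _ (L2B LL1 LL)) (L2B (L2N (L2_mulb wp Lut)) (L2_bmul wu Lk)).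
split=> //.
pose A x := p x * d x; pose B1 x := u x * ee x; pose B2 x := (u1 x - u x) * ee x.
pose W x := (u1 x - u x) * k x.
have LA : L2 A := L2_bmul wp Ld.
have LB1 : L2 B1 := L2_bmul wu Lee.
have LB2 : L2 B2 := L2_bmul ww Lee.
have LW : L2 W := L2_bmul ww Lk.
have S0 : 0 <= S := le_trans (N2_ge0 _) NS.
have eE : aeeq E (fun x => - (A x + (B1 x + B2 x + W x))).
  by apply: filterS2 e1 e => x e1x ex; rewrite /E e1x ex /A /B1 /B2 /W /ee; ring.
have LR := L2D LA (L2D (L2D LB1 LB2) LW).
rewrite (ae_eq_N2 (L2_cmeas LE) (L2_cmeas (L2N LR)) eE) N2N.
have NA : N2 A <= N2 (fun x => p x + p' x) * N2 d := N2_bmul wp Ld.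
have NB1 : N2 B1 <= N2 (fun x => u x + u' x) * (N2 (fun x => f x + f' x) * N2 d).
  by apply: le_trans (N2_bmul wu Lee) _; rewrite ler_wpM2l ?N2_ge0.
have NB2 : N2 B2 <= 4 * S * (N2 (fun x => f x + f' x) * N2 d).
  have [_] := L2M (L2_cmeas Lw) increment_bound Lee; rewrite sqr_sqrtr ?mulr_ge0// => h.
  by apply: le_trans h _; rewrite ler_wpM2l ?mulr_ge0.
have NW : N2 W <= 4 * S * N2 k.
  by have [_] := L2M (L2_cmeas Lw) increment_bound Lk; rewrite sqr_sqrtr ?mulr_ge0.
have h1 := N2D LA (L2D (L2D LB1 LB2) LW); have h2 := N2D (L2D LB1 LB2) LW.
have h3 := N2D LB1 LB2.
apply: le_trans h1 _; move: NA NB1 NB2 NW h2 h3; clear.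
move: (N2 (fun x => p x + p' x)) (N2 (fun x => u x + u' x)) (N2 (fun x => f x + f' x)) (N2 d)
  (N2 k).
move: (N2 A) (N2 B1) (N2 B2) (N2 W) (N2 (fun x => B1 x + B2 x)) (N2 (fun x => B1 x + B2 x + W x)).
move=> *; lra.
Qed.

End increment.
End evolution.

Theorem lemma2p3 (R : realType) (T s : R) (u : R -> R -> R[i]) (hT : 0 < T)
    (hs : 2 <= s) (hu : continuous_sobolev_plus T s u)
    (heq : solves_equation T u) :
  forall f : R -> R[i], sobolev_plus 1 f ->
  forall t : R, 0 <= t <= T ->
    (* [B_u, L_u] f is defined: B_u f belongs to the domain of L_u *)
    sobolev_plus 1 (lax_B (u t) f) /\
    L2_derivative T (fun t' => lax_L (u t') f) t
      (commutator (lax_B (u t)) (lax_L (u t)) f).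
Proof.
move=> f [sf pf] t tT.
have s1 : 1 <= s by apply: le_trans hs; rewrite ler1n.
have [f' [wf _ _]] := sobolev_weak_der (lexx 1) sf.
have [hu1 hu2] := hu; have [su pu] := hu1 t tT.
have [u' [u'' [wu wu']]] := sobolev2_weak_der hs su.
have [ut [_ Lut cut] eqt] := heq t tT.
have [Lf Lf' _] := wf; have [Lu Lu' _] := wu; have wv := weak_derJ wu.
have wg := weak_derD (weak_derM wu' wv) (weak_derM wu (weak_derJ wu')).
have Pg := isP_self (let: And3 L _ _ := wg in L).
have eut := equation_derivative wu wu' Pg eqt.
have wvf := weak_derM wv wf.
have Pp := isP_self (let: And3 L _ _ := wvf in L); set p := Pi_plus _ in Pp.
have wp := isP_der wvf Pp (isP_self (let: And3 _ L _ := wvf in L)).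
have Pk := isP_self (L2_mulb wf (L2J Lut)).
have Lk := let: And3 _ L _ := Pk in L.
have [wB pB] := lax_B_domain pu wu wu' wf.
split; first by split; [exact: weak_der_sobolev wB|exact: pB].
have [LC eC] := lax_commutatorE pu wu wu' wf Pg Lut eut Pk.
have LL t' : 0 <= t' <= T -> L2 (lax_L (u t') f).
  move=> t'T; have [su' pu1] := hu1 t' t'T; have [u1' [wu1 _ _]] := sobolev_weak_der s1 su'.
  by have [] := lax_LE pu1 wu1 wf (isP_self (L2_bmul (weak_derJ wu1) Lf)).
split; [exact: LL|exact: LC|].
have inT : \forall t' \near within `[0, T] t^', 0 <= t' <= T.
  by apply: (@filterS _ _ _ `[0, T]%classic) (withinT _ _) => t' /=; rewrite in_itv.
pose S t' := N2 (bessel s (u t' \- u t)).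
pose d t' := N2 (fun x => ((t' - t)^-1)%:C * (u t' x - u t x) - ut x).
(* Continuity is stated along the full neighbourhoods of [t], the derivative along the punctured
   ones; the limit restricts to the finer filter. *)
have Sto : S t' @[t' --> within `[0, T] t^'] --> (0 : R).
  have : S t' @[t' --> within `[0, T] (nbhs t)] --> (0 : R).
    apply/cvg_L2norm; last exact: hu2 t tT.
    apply: (@filterS _ _ _ `[0, T]%classic) (withinT _ _) => t' /=; rewrite in_itv => t'T.
    by have [] := sobolevB (hu1 t' t'T).1 su.
  by apply: cvg_trans; apply: cvg_app => P; apply: (@filterS _ (nbhs t) _) => t' h _ /h.
have dto : d t' @[t' --> within `[0, T] t^'] --> (0 : R).
  apply/cvg_L2norm; last exact: cut.
  apply: filterS inT => t' t'T; have [[Lu1 _] _] := hu1 t' t'T.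
  exact: L2B (L2Z _ (L2B Lu1 Lu)) Lut.
apply/cvg_L2norm.
  apply: filterS inT => t' t'T; exact: L2B (L2Z _ (L2B (LL _ t'T) (LL _ tT))) LC.
(* The coefficient of [N2 d] in [lax_L_increment], with the derivative of [p] written as the
   projection of the derivative of [conj u * f]. It does not depend on [t']. *)
pose K1 := 2 * N2 (fun x => p x + Pi_plus (fun x => (u' x)^* * f x +
  (u t x)^* * f' x) x) + 8 * N2 (fun x => u t x + u' x) * N2 (fun x => f x + f' x).
apply: (@squeeze0 _ _ _ _ _ (fun t' => K1 * d t' + 32 * N2 (fun x => f x + f' x) *
  (S t' * d t') + 16 * N2 (Pi_plus (fun x => (ut x)^* * f x)) * S t')).
  apply: filterS inT => t' t'T; rewrite N2_ge0 andTb.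
  have [su' pu1] := hu1 t' t'T; have [u1' [wu1 _ _]] := sobolev_weak_der s1 su'.
  have [w' [ww Nw Nw']] := sobolev_weak_der s1 (sobolevB su' su).
  have [LE] := lax_L_increment (t' - t)^-1 wf pu wu pu1 wu1 Lut Pp Pk wp ww Nw Nw'.
  (* The error to be bounded and the one in [lax_L_increment] differ only by the a.e. formula [eC]
     for the commutator. *)
  apply: le_trans; rewrite le_eqVlt; apply/orP; left; apply/eqP.
  apply: ae_eq_N2; [exact: L2_cmeas (L2B (L2Z _ (L2B (LL _ t'T)
    (LL _ tT))) LC)|exact: L2_cmeas LE|].
  by apply: filterS eC => x ->.
apply: cvgD0; last exact: cvgZ0.
apply: cvgD0; first exact: cvgZ0.
apply: cvgZ0; have : S t' * d t' @[t' --> within `[0, T] t^'] --> (0 * 0 : R).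
  by apply: cvgM; [exact: Sto|exact: dto].
by rewrite mulr0.
Qed.
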